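(* Let $K$ be a field. (1) Let $E$ be an essential graph and let $F$ be a graph obtained from $E$ by an in-splitting or an out-splitting. Then $\mathcal L(E)$ is graded Morita equivalent to $\mathcal L(F)$. (2) Let $E$ and $F$ be essential graphs. If the adjacency matrices $A_E$ and $A_F$ are strongly shift equivalent, then $\mathcal L(E)$ is graded Morita equivalent to $\mathcal L(F)$. (3) Let $E$ and $F$ be finite graphs with no sinks. If $\mathcal L(E)$ is graded Morita equivalent to $\mathcal L(F)$, then the adjacency matrices $A_E$ and $A_F$ are shift equivalent.
   Context: Graphs are directed graphs $E=(E^0,E^1,r,s)$ with vertex set $E^0$, edge set $E^1$, and range and source maps $r,s:E^1\to E^0$. Finite means $E^0$ and $E^1$ are finite. A sink is a vertex emitting no edge; a source is a vertex receiving no edge. A graph is essential if it is finite and has neither sources nor sinks. The adjacency matrix $A_E$ has $(i,j)$ entry the number of edges from the $i$-th to the $j$-th vertex, for a fixed ordering of $E^0$. Out-splitting (for $E$ without sinks): for each $v\in E^0$ partition $s^{-1}(v)$ into nonempty disjoint subsets $\mathcal E_v^1,\dots,\mathcal E_v^{m(v)}$, $m(v)\ge1$. The out-split graph has vertices $v^i$ ($v\in E^0$, $1\le i\le m(v)$) and edges $e^j$ ($e\in E^1$, $1\le j\le m(r(e))$), with $s(e^j)=s(e)^i$ where $e\in\mathcal E_{s(e)}^i$, and $r(e^j)=r(e)^j$. In-splitting (for $E$ without sources): for each $v\in E^0$ partition $r^{-1}(v)$ into nonempty disjoint subsets $\mathcal E^v_1,\dots,\mathcal E^v_{m(v)}$,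 $m(v)\ge1$. The in-split graph has vertices $v_i$ ($v\in E^0$, $1\le i\le m(v)$) and edges $e_j$ ($e\in E^1$, $1\le j\le m(s(e))$), with $s(e_j)=s(e)_j$, and $r(e_j)=r(e)_i$ where $e\in\mathcal E^{r(e)}_i$. Square nonnegative integer matrices $A,B$ (possibly of different sizes) are elementary shift equivalent if there are nonnegative integer matrices $R,S$ with $A=RS$ and $B=SR$; strong shift equivalence is the equivalence relation on square nonnegative integer matrices generated by this. $A$ and $B$ are shift equivalent if there are nonnegative integer matrices $R,S$ and an integer $l\ge1$ with $A^l=RS$, $B^l=SR$, $AR=RB$, $SA=BS$. The Leavitt path algebra $\mathcal L(E)$ over $K$ is the $K$-algebra generated by the sets $\{v: v\in E^0\}$, $\{\alpha:\alpha\in E^1\}$, $\{\alpha^*:\alpha\in E^1\}$ subject to: (1) $vw=\delta_{v,w}v$ for $v,w\in E^0$; (2) $s(\alpha)\alpha=\alpha r(\alpha)=\alpha$ and $r(\alpha)\alpha^*=\alpha^*s(\alpha)=\alpha^*$ for $\alpha\in E^1$; (3) $\alpha^*\beta=\delta_{\alpha,\beta}r(\alpha)$ for $\alpha,\beta\in E^1$; (4) $\sum_{\alpha\in s^{-1}(v)}\alpha\alpha^*=v$ for every $v\in E^0$ with $s^{-1}(v)\neq\emptyset$. It is $\mathbb Z$-graded by $\deg v=0$, $\deg\alpha=1$, $\deg\alpha^*=-1$. For a $\mathbb Z$-graded ring $R$, $\mathrm{Gr}\text{-}R$ is the category of graded right $R$-modules with degree-preserving homomorphisms, and $\mathcal T_j:M\mapsto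 M(j)$, $M(j)_i=M_{i+j}$, are the shift functors ($j\in\mathbb Z$). A functor $\phi:\mathrm{Gr}\text{-}R\to\mathrm{Gr}\text{-}R'$ is graded if $\phi\mathcal T_j=\mathcal T_j\phi$ for all $j$. It is a graded equivalence if it is graded and there is a graded functor $\psi:\mathrm{Gr}\text{-}R'\to\mathrm{Gr}\text{-}R$ with $\psi\phi$ and $\phi\psi$ naturally isomorphic to the identity functors. $R$ and $R'$ are graded Morita equivalent if there is a graded equivalence between $\mathrm{Gr}\text{-}R$ and $\mathrm{Gr}\text{-}R'$. *)

(* Defs.v *)
From HB Require Import structures.
From mathcomp Require Import all_boot all_order all_algebra.
From mathcomp Require Import boolp.

Set Implicit Arguments.
Unset Strict Implicit.
Unset Printing Implicit Defensive.

Import GRing.Theory.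
Local Open Scope ring_scope.
Local Open Scope quotient_scope.

#[local] Obligation Tactic := try by [].

Record digraph := Digraph {
  vert : finType;
  edge : finType;
  src : edge -> vert;
  rng : edge -> vert
}.

Definition no_sinks (E : digraph) : Prop :=
  forall v : vert E, exists e : edge E, src e = v.

Definition no_sources (E : digraph) : Prop :=
  forall v : vert E, exists e : edge E, rng e = v.

Definition essential (E : digraph) : Prop := no_sinks E /\ no_sources E.

(* The vertices are ordered by the enumeration of the finType [vert E]. *)
Definition adjmx (E : digraph) : 'M[nat]_#|vert E| :=
  \matrix_(i, j)
    #|[set e : edge E | (src e == enum_val i) && (rng e == enum_val j)]|.

(* For an end map [endp] (either [src] or [rng]), a partition of each fibre
   of [endp] into [blocks v] nonempty, pairwise disjoint blocks. *)
Record fibre_partition (E : digraph) (endp : edge E -> vert E) :=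
  FibrePartition {
  blocks : vert E -> nat;
  block : forall v : vert E, 'I_(blocks v) -> {set edge E};
  blocks_gt0 : forall v, (0 < blocks v)%N;
  block_neq0 : forall v (i : 'I_(blocks v)), block i != set0;
  block_disjoint : forall v (i j : 'I_(blocks v)),
    i != j -> [disjoint block i & block j];
  block_cover : forall v,
    \bigcup_(i < blocks v) block i = [set e | endp e == v]
}.

(* The vertex v^i is the pair [Tagged _ i : {v & 'I_(blocks v)}], the edge e^j
   the pair [Tagged _ j]; [F] is the split graph up to the names [fv], [fe] of
   its vertices and edges. *)
Definition is_out_split (E : digraph) (P : fibre_partition (@src E))
    (F : digraph) : Prop :=
  exists (fv : {v : vert E & 'I_(blocks P v)} -> vert F)
         (fe : {e : edge E & 'I_(blocks P (rng e))} -> edge F),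
    [/\ bijective fv,
        bijective fe,
        forall (e : edge E) (j : 'I_(blocks P (rng e)))
               (i : 'I_(blocks P (src e))), e \in block i ->
          src (fe (Tagged (fun e => 'I_(blocks P (rng e))) j))
          = fv (Tagged (fun v => 'I_(blocks P v)) i)
      & forall (e : edge E) (j : 'I_(blocks P (rng e))),
          rng (fe (Tagged (fun e => 'I_(blocks P (rng e))) j))
          = fv (Tagged (fun v => 'I_(blocks P v)) j)].

Definition is_in_split (E : digraph) (P : fibre_partition (@rng E))
    (F : digraph) : Prop :=
  exists (fv : {v : vert E & 'I_(blocks P v)} -> vert F)
         (fe : {e : edge E & 'I_(blocks P (src e))} -> edge F),
    [/\ bijective fv,
        bijective fe,
        forall (e : edge E) (j : 'I_(blocks P (src e))),
          src (fe (Tagged (fun e => 'I_(blocks P (src e))) j))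
          = fv (Tagged (fun v => 'I_(blocks P v)) j)
      & forall (e : edge E) (j : 'I_(blocks P (src e)))
               (i : 'I_(blocks P (rng e))), e \in block i ->
          rng (fe (Tagged (fun e => 'I_(blocks P (src e))) j))
          = fv (Tagged (fun v => 'I_(blocks P v)) i)].

Definition out_splitting (E F : digraph) : Prop :=
  exists P : fibre_partition (@src E), is_out_split P F.

Definition in_splitting (E F : digraph) : Prop :=
  exists P : fibre_partition (@rng E), is_in_split P F.

Definition elementary_shift_equiv m n (A : 'M[nat]_m) (B : 'M[nat]_n) : Prop :=
  exists (R : 'M[nat]_(m, n)) (S : 'M[nat]_(n, m)),
    A = R *m S /\ B = S *m R.

Inductive strong_shift_equiv :
    forall m n, 'M[nat]_m -> 'M[nat]_n -> Prop :=
| sse_elementary m n (A : 'M[nat]_m) (B : 'M[nat]_n) :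
    elementary_shift_equiv A B -> strong_shift_equiv A B
| sse_refl m (A : 'M[nat]_m) : strong_shift_equiv A A
| sse_sym m n (A : 'M[nat]_m) (B : 'M[nat]_n) :
    strong_shift_equiv A B -> strong_shift_equiv B A
| sse_trans m n p (A : 'M[nat]_m) (B : 'M[nat]_n) (C : 'M[nat]_p) :
    strong_shift_equiv A B -> strong_shift_equiv B C ->
    strong_shift_equiv A C.

Definition shift_equiv m n (A : 'M[nat]_m) (B : 'M[nat]_n) : Prop :=
  exists (R : 'M[nat]_(m, n)) (S : 'M[nat]_(n, m)) (l : nat),
    [/\ (1 <= l)%N,
        A ^+ l = R *m S,
        B ^+ l = S *m R,
        A *m R = R *m B
      & S *m A = B *m S].

Record category := Category {
  obj :> Type;
  mor : obj -> obj -> Type;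
  idm : forall X, mor X X;
  compm : forall X Y Z, mor Y Z -> mor X Y -> mor X Z;
  compm1 : forall X Y (f : mor X Y), compm f (idm X) = f;
  comp1m : forall X Y (f : mor X Y), compm (idm Y) f = f;
  compmA : forall X Y Z W (f : mor Z W) (g : mor Y Z) (h : mor X Y),
    compm f (compm g h) = compm (compm f g) h
}.

Arguments idm {c} X.
Arguments compm {c X Y Z} f g.

Record functor (C D : category) := Functor {
  fobj :> C -> D;
  fmap : forall X Y : C, mor X Y -> mor (fobj X) (fobj Y);
  fmap1 : forall X : C, fmap (idm X) = idm (fobj X);
  fmapM : forall (X Y Z : C) (f : mor Y Z) (g : mor X Y),
    fmap (compm f g) = compm (fmap f) (fmap g)
}.

Arguments fmap {C D} f {X Y} _ : rename.

Program Definition id_functor (C : category) : functor C C :=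
  @Functor C C (fun X => X) (fun _ _ f => f) _ _.

Program Definition comp_functor (C D B : category)
    (G : functor D B) (F : functor C D) : functor C B :=
  @Functor C B (fun X => G (F X)) (fun _ _ f => fmap G (fmap F f)) _ _.
Next Obligation. by move=> C D B G F X /=; rewrite !fmap1. Qed.
Next Obligation. by move=> C D B G F X Y Z f g /=; rewrite !fmapM. Qed.

Definition naturally_isomorphic (C D : category) (F G : functor C D) : Prop :=
  exists (eta : forall X, mor (F X) (G X)) (theta : forall X, mor (G X) (F X)),
    [/\ forall (X Y : C) (f : mor X Y),
          compm (eta Y) (fmap F f) = compm (fmap G f) (eta X),
        forall X, compm (theta X) (eta X) = idm (F X)
      & forall X, compm (eta X) (theta X) = idm (G X)].

(* [V] is the internal direct sum of the additive subgroups [Vc n]. *)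
Definition is_decomposition (V : zmodType) (Vc : int -> V -> Prop) : Prop :=
  [/\ forall n, Vc n 0 /\ (forall x y, Vc n x -> Vc n y -> Vc n (x - y)),
      forall x : V, exists (s : seq int) (f : int -> V),
        (forall n, Vc n (f n)) /\ x = \sum_(n <- s) f n
    & forall (s : seq int) (f : int -> V), uniq s ->
        (forall n, Vc n (f n)) -> \sum_(n <- s) f n = 0 ->
        forall n, n \in s -> f n = 0].

(* Unital rings, possibly trivial. *)
Record graded_ring := GradedRing {
  gr_ring :> pzRingType;
  gr_comp : int -> gr_ring -> Prop;
  gr_decomposition : is_decomposition gr_comp;
  gr_compM : forall i j x y,
    gr_comp i x -> gr_comp j y -> gr_comp (i + j) (x * y)
}.

Arguments gr_comp : clear implicits.

(* A right R-module is a left module over the converse ring [R^c]: the scaling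
   [(r : R^c) *: m] is the right action m r. *)
Record graded_module (R : graded_ring) := GradedModule {
  gm_mod :> lmodType R^c;
  gm_comp : int -> gm_mod -> Prop;
  gm_decomposition : is_decomposition gm_comp;
  gm_compM : forall i j (m : gm_mod) (r : R),
    gm_comp i m -> gr_comp R j r -> gm_comp (i + j) ((r : R^c) *: m)
}.

Arguments gm_comp {R} M _ _ : rename.

Record graded_hom (R : graded_ring) (M N : graded_module R) := GradedHom {
  gh_fun :> M -> N;
  gh_linear : linear gh_fun;
  gh_degree : forall i m, gm_comp M i m -> gm_comp N i (gh_fun m)
}.

Lemma graded_hom_ext (R : graded_ring) (M N : graded_module R)
  (f g : graded_hom M N) : (forall m, f m = g m) -> f = g.
Proof.
case: f g => [f lf df] [g lg dg] /= /funext fg; move: lf df lg dg.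
by rewrite {}fg => *; congr GradedHom; exact: Prop_irrelevance.
Qed.

Program Definition graded_id (R : graded_ring) (M : graded_module R) :
    graded_hom M M := @GradedHom R M M (fun m => m) _ _.

Program Definition graded_comp (R : graded_ring) (M N P : graded_module R)
    (f : graded_hom N P) (g : graded_hom M N) : graded_hom M P :=
  @GradedHom R M P (fun m => f (g m)) _ _.
Next Obligation. by move=> R M N P f g a u v; rewrite !gh_linear. Qed.
Next Obligation. by move=> R M N P f g i m Mm; do 2!apply: gh_degree. Qed.

Program Definition Gr (R : graded_ring) : category :=
  @Category (graded_module R) (@graded_hom R)
    (@graded_id R) (@graded_comp R) _ _ _.
Next Obligation. by move=> *; apply: graded_hom_ext. Qed.
Next Obligation. by move=> *; apply: graded_hom_ext. Qed.
Next Obligation. by move=> *; apply: graded_hom_ext. Qed.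

Lemma shift_decomposition (V : zmodType) (Vc : int -> V -> Prop) (j : int) :
  is_decomposition Vc -> is_decomposition (fun i => Vc (i + j)).
Proof.
case=> Vsub Vspan Vfree; split.
- by move=> n; apply: Vsub.
- move=> x; have [s [f [Vf ->]]] := Vspan x.
  exists [seq n - j | n <- s], (fun n => f (n + j)); split=> //.
  by rewrite big_map; apply: eq_bigr => n _; rewrite subrK.
- move=> s f us Vf sf n ns.
  have addI : injective (fun k : int => k + j) by exact: addIr.
  have -> : f n = f (n + j - j) by rewrite addrK.
  apply: (Vfree [seq n + j | n <- s] (fun n => f (n - j))).
  + by rewrite map_inj_uniq.
  + by move=> k; have := Vf (k - j); rewrite subrK.
  + by rewrite big_map -[RHS]sf; apply: eq_bigr => k _; rewrite addrK.
  + exact: (map_f (fun k : int => k + j)) ns.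
Qed.

Program Definition shift_module (R : graded_ring) (j : int)
    (M : graded_module R) : graded_module R :=
  @GradedModule R M (fun i => gm_comp M (i + j)) _ _.
Next Obligation.
by move=> R j M; apply: shift_decomposition; apply: gm_decomposition.
Qed.
Next Obligation.
by move=> R j M i k m r Mm Rr; rewrite /= addrAC; apply: gm_compM.
Qed.

Program Definition shift_hom (R : graded_ring) (j : int)
    (M N : graded_module R) (f : graded_hom M N) :
    graded_hom (shift_module j M) (shift_module j N) :=
  @GradedHom R (shift_module j M) (shift_module j N) f _ _.
Next Obligation. by move=> R j M N f; exact: (gh_linear f). Qed.
Next Obligation. by move=> R j M N f i m; exact: (gh_degree f). Qed.

Program Definition shift_functor (R : graded_ring) (j : int) :
    functor (Gr R) (Gr R) :=
  @Functor (Gr R) (Gr R) (shift_module j) (@shift_hom R j) _ _.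
Next Obligation. by move=> *; apply: graded_hom_ext. Qed.
Next Obligation. by move=> *; apply: graded_hom_ext. Qed.

(* Leibniz equality of functors: equality on objects and on morphisms. *)
Definition graded_functor (R R' : graded_ring)
    (phi : functor (Gr R) (Gr R')) : Prop :=
  forall j : int, comp_functor phi (shift_functor R j)
                  = comp_functor (shift_functor R' j) phi.

Definition graded_equivalence (R R' : graded_ring)
    (phi : functor (Gr R) (Gr R')) : Prop :=
  graded_functor phi /\
  exists psi : functor (Gr R') (Gr R),
    [/\ graded_functor psi,
        naturally_isomorphic (comp_functor psi phi) (id_functor (Gr R))
      & naturally_isomorphic (comp_functor phi psi) (id_functor (Gr R'))].

Definition graded_morita_equiv (R R' : graded_ring) : Prop :=
  exists phi : functor (Gr R) (Gr R'), graded_equivalence phi.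

Section Leavitt.
Variables (K : fieldType) (E : digraph).

(* Formal expressions of a non-unital K-algebra in the generators; the unit of
   the quotient is the sum of the vertices, see [lpa_mul1]. *)
Inductive lpa_term : Type :=
| LVert of vert E
| LEdge of edge E
| LGhost of edge E
| LZero
| LAdd of lpa_term & lpa_term
| LScale of K & lpa_term
| LMul of lpa_term & lpa_term.

HB.instance Definition _ := gen_eqMixin lpa_term.
HB.instance Definition _ := gen_choiceMixin lpa_term.

Notation "s <+> t" := (LAdd s t) (at level 50, left associativity).
Notation "s <*> t" := (LMul s t) (at level 40, left associativity).
Notation "a <:> t" := (LScale a t) (at level 40).

(* The least congruence containing the axioms of (non-unital, associative)
   K-algebras and, from [lc_vert] on, the defining relations. *)
Inductive lpa_congr : lpa_term -> lpa_term -> Prop :=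
| lc_refl s : lpa_congr s s
| lc_sym s t : lpa_congr s t -> lpa_congr t s
| lc_trans s t u : lpa_congr s t -> lpa_congr t u -> lpa_congr s u
| lc_add s s' t t' : lpa_congr s s' -> lpa_congr t t' ->
    lpa_congr (s <+> t) (s' <+> t')
| lc_scale a s s' : lpa_congr s s' -> lpa_congr (a <:> s) (a <:> s')
| lc_mul s s' t t' : lpa_congr s s' -> lpa_congr t t' ->
    lpa_congr (s <*> t) (s' <*> t')
| lc_addA s t u : lpa_congr (s <+> (t <+> u)) (s <+> t <+> u)
| lc_addC s t : lpa_congr (s <+> t) (t <+> s)
| lc_add0 s : lpa_congr (LZero <+> s) s
| lc_addN s : lpa_congr ((-1 <:> s) <+> s) LZero
| lc_scaleA a b s : lpa_congr (a <:> (b <:> s)) ((a * b) <:> s)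
| lc_scale1 s : lpa_congr (1 <:> s) s
| lc_scaleDr a s t : lpa_congr (a <:> (s <+> t)) ((a <:> s) <+> (a <:> t))
| lc_scaleDl a b s : lpa_congr ((a + b) <:> s) ((a <:> s) <+> (b <:> s))
| lc_mulA s t u : lpa_congr (s <*> (t <*> u)) (s <*> t <*> u)
| lc_mulDl s t u : lpa_congr ((s <+> t) <*> u) ((s <*> u) <+> (t <*> u))
| lc_mulDr s t u : lpa_congr (s <*> (t <+> u)) ((s <*> t) <+> (s <*> u))
| lc_scaleAl a s t : lpa_congr (a <:> (s <*> t)) ((a <:> s) <*> t)
| lc_scaleAr a s t : lpa_congr (a <:> (s <*> t)) (s <*> (a <:> t))
| lc_vert v w :
    lpa_congr (LVert v <*> LVert w) (if v == w then LVert v else LZero)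
| lc_src_edge e : lpa_congr (LVert (src e) <*> LEdge e) (LEdge e)
| lc_edge_rng e : lpa_congr (LEdge e <*> LVert (rng e)) (LEdge e)
| lc_rng_ghost e : lpa_congr (LVert (rng e) <*> LGhost e) (LGhost e)
| lc_ghost_src e : lpa_congr (LGhost e <*> LVert (src e)) (LGhost e)
| lc_ghost_edge e f :
    lpa_congr (LGhost e <*> LEdge f) (if e == f then LVert (rng e) else LZero)
| lc_cuntz_krieger v : [set e | src e == v] != set0 ->
    lpa_congr (\big[LAdd/LZero]_(e in [set e | src e == v])
                 (LEdge e <*> LGhost e))
              (LVert v).

Definition lpa_rel : rel lpa_term := fun s t => `[< lpa_congr s t >].

Lemma lpa_rel_equiv : equiv_class_of lpa_rel.
Proof.
split.
- by move=> s; apply/asboolP/lc_refl.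
- by move=> s t; apply/asboolP/asboolP => /lc_sym.
- by move=> t s u /asboolP st /asboolP tu; apply/asboolP/(lc_trans st tu).
Qed.

Canonical lpa_rel_canonical := EquivRelPack lpa_rel_equiv.

Definition lpa := {eq_quot lpa_rel}.
HB.instance Definition _ := Choice.on lpa.
HB.instance Definition _ := EqQuotient.on lpa.

Definition lpa_cl (t : lpa_term) : lpa := \pi t.

Lemma lpa_clP s t : lpa_cl s = lpa_cl t <-> lpa_congr s t.
Proof.
by split=> [/eqmodP /asboolP | st]; last by apply/eqmodP/asboolP.
Qed.

Lemma lpa_ind (P : lpa -> Prop) : (forall t, P (lpa_cl t)) -> forall x, P x.
Proof. by move=> Pt x; rewrite -[x]reprK; apply: Pt. Qed.

Definition lpa_zero : lpa := lpa_cl LZero.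
Definition lpa_add (x y : lpa) : lpa := lpa_cl (repr x <+> repr y).
Definition lpa_scale (a : K) (x : lpa) : lpa := lpa_cl (a <:> repr x).
Definition lpa_opp (x : lpa) : lpa := lpa_scale (-1) x.
Definition lpa_mul (x y : lpa) : lpa := lpa_cl (repr x <*> repr y).

Lemma lpa_repr t : lpa_congr (repr (lpa_cl t)) t.
Proof. by apply/lpa_clP; rewrite /lpa_cl reprK. Qed.

Lemma lpa_addE s t : lpa_add (lpa_cl s) (lpa_cl t) = lpa_cl (s <+> t).
Proof. by apply/lpa_clP/lc_add; apply: lpa_repr. Qed.

Lemma lpa_scaleE a t : lpa_scale a (lpa_cl t) = lpa_cl (a <:> t).
Proof. by apply/lpa_clP/lc_scale; apply: lpa_repr. Qed.

Lemma lpa_mulE s t : lpa_mul (lpa_cl s) (lpa_cl t) = lpa_cl (s <*> t).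
Proof. by apply/lpa_clP/lc_mul; apply: lpa_repr. Qed.

Lemma lpa_addA : associative lpa_add.
Proof.
elim/lpa_ind=> s; elim/lpa_ind=> t; elim/lpa_ind=> u.
by rewrite !lpa_addE; apply/lpa_clP/lc_addA.
Qed.

Lemma lpa_addC : commutative lpa_add.
Proof.
elim/lpa_ind=> s; elim/lpa_ind=> t.
by rewrite !lpa_addE; apply/lpa_clP/lc_addC.
Qed.

Lemma lpa_add0 : left_id lpa_zero lpa_add.
Proof. by elim/lpa_ind=> s; rewrite !lpa_addE; apply/lpa_clP/lc_add0. Qed.

Lemma lpa_addN : left_inverse lpa_zero lpa_opp lpa_add.
Proof.
elim/lpa_ind=> s.
by rewrite /lpa_opp lpa_scaleE !lpa_addE; apply/lpa_clP/lc_addN.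
Qed.

HB.instance Definition _ :=
  GRing.isZmodule.Build lpa lpa_addA lpa_addC lpa_add0 lpa_addN.

Lemma lpa_scaleA a b x : lpa_scale a (lpa_scale b x) = lpa_scale (a * b) x.
Proof. by elim/lpa_ind: x => s; rewrite !lpa_scaleE; apply/lpa_clP/lc_scaleA. Qed.

Lemma lpa_scale1 : left_id 1 lpa_scale.
Proof. by elim/lpa_ind => s; rewrite !lpa_scaleE; apply/lpa_clP/lc_scale1. Qed.

Lemma lpa_scaleDr : right_distributive lpa_scale +%R.
Proof.
move=> a; elim/lpa_ind=> s; elim/lpa_ind=> t.
by rewrite /GRing.add /= !(lpa_addE, lpa_scaleE); apply/lpa_clP/lc_scaleDr.
Qed.

Lemma lpa_scaleDl x : {morph lpa_scale^~ x : a b / a + b}.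
Proof.
move=> a b; elim/lpa_ind: x => s.
rewrite !lpa_scaleE [RHS]lpa_addE; exact/lpa_clP/lc_scaleDl.
Qed.

HB.instance Definition _ := GRing.Zmodule_isLmodule.Build K lpa
  lpa_scaleA lpa_scale1 lpa_scaleDr lpa_scaleDl.

Lemma lpa_mulA : associative lpa_mul.
Proof.
elim/lpa_ind=> s; elim/lpa_ind=> t; elim/lpa_ind=> u.
by rewrite !lpa_mulE; apply/lpa_clP/lc_mulA.
Qed.

Lemma lpa_mulDl : left_distributive lpa_mul +%R.
Proof.
elim/lpa_ind=> s; elim/lpa_ind=> t; elim/lpa_ind=> u.
rewrite /GRing.add /= !(lpa_addE, lpa_mulE); exact/lpa_clP/lc_mulDl.
Qed.

Lemma lpa_mulDr : right_distributive lpa_mul +%R.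
Proof.
elim/lpa_ind=> s; elim/lpa_ind=> t; elim/lpa_ind=> u.
rewrite /GRing.add /= !(lpa_addE, lpa_mulE); exact/lpa_clP/lc_mulDr.
Qed.

Lemma lpa_mulZl a x y : lpa_mul (a *: x) y = a *: lpa_mul x y.
Proof.
elim/lpa_ind: x => s; elim/lpa_ind: y => t; apply/esym.
rewrite /GRing.scale /= !(lpa_scaleE, lpa_mulE); exact/lpa_clP/lc_scaleAl.
Qed.

Lemma lpa_mulZr a x y : lpa_mul x (a *: y) = a *: lpa_mul x y.
Proof.
elim/lpa_ind: x => s; elim/lpa_ind: y => t; apply/esym.
rewrite /GRing.scale /= !(lpa_scaleE, lpa_mulE); exact/lpa_clP/lc_scaleAr.
Qed.

Lemma lpa_mul0l x : lpa_mul 0 x = 0.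
Proof. by rewrite -(scale0r (0 : lpa) : (0 : K) *: _ = _) lpa_mulZl !scale0r. Qed.

Lemma lpa_mul0r x : lpa_mul x 0 = 0.
Proof. by rewrite -(scale0r (0 : lpa) : (0 : K) *: _ = _) lpa_mulZr !scale0r. Qed.

Definition lpa_vert (v : vert E) : lpa := lpa_cl (LVert v).
Definition lpa_edge (e : edge E) : lpa := lpa_cl (LEdge e).
Definition lpa_ghost (e : edge E) : lpa := lpa_cl (LGhost e).

Definition lpa_one : lpa := \sum_v lpa_vert v.

Lemma lpa_cl_if (b : bool) s :
  lpa_cl (if b then s else LZero) = if b then lpa_cl s else 0.
Proof. by case: b. Qed.

Lemma lpa_vertM v w :
  lpa_mul (lpa_vert v) (lpa_vert w) = if v == w then lpa_vert v else 0.
Proof. by rewrite lpa_mulE -lpa_cl_if; apply/lpa_clP/lc_vert. Qed.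

Lemma lpa_mul_suml I (r : seq I) (F : I -> lpa) x :
  lpa_mul (\sum_(i <- r) F i) x = \sum_(i <- r) lpa_mul (F i) x.
Proof.
apply: (big_morph (lpa_mul^~ x)) => [y z|]; first exact: lpa_mulDl.
exact: lpa_mul0l.
Qed.

Lemma lpa_mul_sumr I (r : seq I) (F : I -> lpa) x :
  lpa_mul x (\sum_(i <- r) F i) = \sum_(i <- r) lpa_mul x (F i).
Proof.
apply: (big_morph (lpa_mul x)) => [y z|]; first exact: lpa_mulDr.
exact: lpa_mul0r.
Qed.

Lemma lpa_one_vert v : lpa_mul lpa_one (lpa_vert v) = lpa_vert v.
Proof.
rewrite lpa_mul_suml (bigD1 v) //= lpa_vertM eqxx big1 ?addr0 // => w wv.
by rewrite lpa_vertM (negbTE wv).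
Qed.

Lemma lpa_vert_one v : lpa_mul (lpa_vert v) lpa_one = lpa_vert v.
Proof.
rewrite lpa_mul_sumr (bigD1 v) //= lpa_vertM eqxx big1 ?addr0 // => w wv.
by rewrite lpa_vertM eq_sym (negbTE wv).
Qed.

Lemma lpa_src_edge e : lpa_mul (lpa_vert (src e)) (lpa_edge e) = lpa_edge e.
Proof. by rewrite lpa_mulE; apply/lpa_clP/lc_src_edge. Qed.

Lemma lpa_edge_rng e : lpa_mul (lpa_edge e) (lpa_vert (rng e)) = lpa_edge e.
Proof. by rewrite lpa_mulE; apply/lpa_clP/lc_edge_rng. Qed.

Lemma lpa_rng_ghost e : lpa_mul (lpa_vert (rng e)) (lpa_ghost e) = lpa_ghost e.
Proof. by rewrite lpa_mulE; apply/lpa_clP/lc_rng_ghost. Qed.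

Lemma lpa_ghost_src e : lpa_mul (lpa_ghost e) (lpa_vert (src e)) = lpa_ghost e.
Proof. by rewrite lpa_mulE; apply/lpa_clP/lc_ghost_src. Qed.

Lemma lpa_mul1 : left_id lpa_one lpa_mul.
Proof.
elim/lpa_ind; elim=> [v|e|e||s IHs t IHt|a s IHs|s IHs t IHt].
- exact: lpa_one_vert.
- by rewrite -[lpa_cl _]lpa_src_edge lpa_mulA lpa_one_vert.
- by rewrite -[lpa_cl _]lpa_rng_ghost lpa_mulA lpa_one_vert.
- exact: lpa_mul0r.
- by rewrite -lpa_addE lpa_mulDr IHs IHt.
- by rewrite -lpa_scaleE lpa_mulZr IHs.
- by rewrite -lpa_mulE lpa_mulA IHs.
Qed.

Lemma lpa_mulr1 : right_id lpa_one lpa_mul.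
Proof.
elim/lpa_ind; elim=> [v|e|e||s IHs t IHt|a s IHs|s IHs t IHt].
- exact: lpa_vert_one.
- by rewrite -[lpa_cl _]lpa_edge_rng -lpa_mulA lpa_vert_one.
- by rewrite -[lpa_cl _]lpa_ghost_src -lpa_mulA lpa_vert_one.
- exact: lpa_mul0l.
- by rewrite -lpa_addE lpa_mulDl IHs IHt.
- by rewrite -lpa_scaleE lpa_mulZl IHs.
- by rewrite -lpa_mulE -lpa_mulA IHt.
Qed.

HB.instance Definition _ := GRing.Zmodule_isPzRing.Build lpa
  lpa_mulA lpa_mul1 lpa_mulr1 lpa_mulDl lpa_mulDr.

(* The components of the grading: the least family of subspaces containing the
   generators in their degrees and compatible with multiplication. *)
Inductive lpa_comp : int -> lpa -> Prop :=
| lg_vert v : lpa_comp 0 (lpa_vert v)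
| lg_edge e : lpa_comp 1 (lpa_edge e)
| lg_ghost e : lpa_comp (-1) (lpa_ghost e)
| lg_zero n : lpa_comp n 0
| lg_add n x y : lpa_comp n x -> lpa_comp n y -> lpa_comp n (x + y)
| lg_scale n (a : K) x : lpa_comp n x -> lpa_comp n (a *: x)
| lg_mul m n x y : lpa_comp m x -> lpa_comp n y -> lpa_comp (m + n) (x * y).

Lemma lpa_comp_sum n I (r : seq I) (F : I -> lpa) :
  (forall i, lpa_comp n (F i)) -> lpa_comp n (\sum_(i <- r) F i).
Proof.
by move=> Fn; apply: (big_ind (lpa_comp n)) => //; [apply: lg_zero | apply: lg_add].
Qed.

(* The components are independent: [lpa_act t] makes [t] act on the families of
   elements of [lpa] indexed by [int], a generator of degree d shifting the
   index by d; an element of degree d sends the family concentrated in degree 0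
   with value 1 to one concentrated in degree d. *)
Fixpoint lpa_act (t : lpa_term) (f : int -> lpa) (n : int) : lpa :=
  match t with
  | LVert v => lpa_vert v * f n
  | LEdge e => lpa_edge e * f (n - 1)
  | LGhost e => lpa_ghost e * f (n + 1)
  | LZero => 0
  | LAdd s t => lpa_act s f n + lpa_act t f n
  | LScale a s => a *: lpa_act s f n
  | LMul s t => lpa_act s (lpa_act t f) n
  end.

Lemma lpa_act_ext t f g : f =1 g -> lpa_act t f =1 lpa_act t g.
Proof. by move=> /funext->. Qed.

Lemma lpa_actD t f g n :
  lpa_act t (fun k => f k + g k) n = lpa_act t f n + lpa_act t g n.
Proof.
elim: t f g n => [v|e|e||s IHs t IHt|a s IHs|s IHs t IHt] f g n /=;
  rewrite ?mulrDr ?addr0 //.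
- by rewrite IHs IHt addrACA.
- by rewrite IHs scalerDr.
- by rewrite -IHs; apply: lpa_act_ext => k; rewrite IHt.
Qed.

Lemma lpa_actZ t a f n : lpa_act t (fun k => a *: f k) n = a *: lpa_act t f n.
Proof.
have mulZ (x y : lpa) : x * (a *: y) = a *: (x * y) by exact: lpa_mulZr.
elim: t f n => [v|e|e||s IHs t IHt|b s IHs|s IHs t IHt] f n /=;
  rewrite ?mulZ ?scaler0 //.
- by rewrite IHs IHt scalerDr.
- by rewrite IHs !scalerA mulrC.
- by rewrite -IHs; apply: lpa_act_ext => k; rewrite IHt.
Qed.

Lemma lpa_clD s t : lpa_cl (s <+> t) = lpa_cl s + lpa_cl t.
Proof. by rewrite -lpa_addE. Qed.

Lemma lpa_clM s t : lpa_cl (s <*> t) = lpa_cl s * lpa_cl t.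
Proof. by rewrite -lpa_mulE. Qed.

Lemma lpa_clZ a s : lpa_cl (a <:> s) = a *: lpa_cl s.
Proof. by rewrite -lpa_scaleE. Qed.

Lemma lpa_act_sum I (r : seq I) (P : pred I) (F : I -> lpa_term) f n :
  lpa_act (\big[LAdd/LZero]_(i <- r | P i) F i) f n
  = \sum_(i <- r | P i) lpa_act (F i) f n.
Proof. exact: (big_morph (fun t => lpa_act t f n)). Qed.

Lemma lpa_cl_sum I (r : seq I) (P : pred I) (F : I -> lpa_term) :
  lpa_cl (\big[LAdd/LZero]_(i <- r | P i) F i)
  = \sum_(i <- r | P i) lpa_cl (F i).
Proof. exact: (big_morph _ lpa_clD). Qed.

Lemma lpa_act_congr s t : lpa_congr s t -> forall f, lpa_act s f =1 lpa_act t f.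
Proof.
elim=> {s t} /=.
- by [].
- by move=> s t _ IH f n /=; rewrite IH.
- by move=> s t u _ IH1 _ IH2 f n /=; rewrite IH1 IH2.
- by move=> s s' t t' _ IH1 _ IH2 f n /=; rewrite IH1 IH2.
- by move=> a s s' _ IH f n /=; rewrite IH.
- by move=> s s' t t' _ IH1 _ IH2 f n /=; rewrite IH1; apply/lpa_act_ext/IH2.
- by move=> * n /=; rewrite addrA.
- by move=> * n /=; rewrite addrC.
- by move=> * n /=; rewrite add0r.
- by move=> s f n /=; rewrite scaleN1r addNr.
- by move=> * n /=; rewrite scalerA.
- by move=> * n /=; rewrite scale1r.
- by move=> * n /=; rewrite scalerDr.
- by move=> * n /=; rewrite scalerDl.
- by [].
- by [].
- by move=> s t u f n /=; rewrite -lpa_actD.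
- by [].
- by move=> a s t f n /=; rewrite -lpa_actZ.
- move=> v w f n /=; rewrite mulrA [_ * lpa_vert w]lpa_vertM.
  by case: eqP => //= _; rewrite mul0r.
- by move=> e f n /=; rewrite mulrA [_ * lpa_edge e]lpa_src_edge.
- by move=> e f n /=; rewrite mulrA [_ * lpa_vert _]lpa_edge_rng.
- by move=> e f n /=; rewrite mulrA [_ * lpa_ghost e]lpa_rng_ghost.
- by move=> e f n /=; rewrite mulrA [_ * lpa_vert _]lpa_ghost_src.
- move=> e e' f n /=; rewrite addrK mulrA -lpa_clM.
  rewrite (iffRL (lpa_clP _ _) (lc_ghost_edge e e')).
  by case: eqP => //= _; rewrite mul0r.
- move=> v vE f n; rewrite lpa_act_sum /=.
  rewrite /lpa_vert -(iffRL (lpa_clP _ _) (lc_cuntz_krieger vE)) lpa_cl_sum.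
  rewrite mulr_suml; apply: eq_bigr => e _.
  by rewrite subrK mulrA lpa_clM.
Qed.

Lemma lpa_act_comp n x : lpa_comp n x ->
  forall f k, lpa_act (repr x) f k = x * f (k - n).
Proof.
have actE t f k : lpa_act (repr (lpa_cl t)) f k = lpa_act t f k.
  exact: (lpa_act_congr (lpa_repr t)).
elim=> {n x}.
- by move=> v f k; rewrite actE /= subr0.
- by move=> e f k; rewrite actE.
- by move=> e f k; rewrite actE /= opprK.
- by move=> n f k; rewrite actE /= mul0r.
- move=> n x y _ IHx _ IHy f k.
  by rewrite actE /= IHx IHy mulrDl.
- move=> n a x _ IHx f k.
  by rewrite actE /= IHx; apply/esym/lpa_mulZl.
- move=> m n x y _ IHx _ IHy f k; rewrite actE /= IHx IHy mulrA.
  by rewrite opprD addrA.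
Qed.

Lemma lpa_comp_decomposition : is_decomposition lpa_comp.
Proof.
split.
- move=> n; split=> [|x y nx ny]; first exact: lg_zero.
  by rewrite -scaleN1r; apply/lg_add/lg_scale.
- pose D x := exists (s : seq int) (f : int -> lpa),
    [/\ uniq s, forall n, lpa_comp n (f n) & x = \sum_(n <- s) f n].
  suff DD : forall x, D x by move=> x; have [s [f [_ ? ->]]] := DD x; exists s, f.
  have Dhom n x : lpa_comp n x -> D x.
    move=> nx; exists [:: n], (fun k => if k == n then x else 0).
    split=> // [k|]; last by rewrite big_seq1 eqxx.
    by case: eqP => [->//|_]; apply: lg_zero.
  have D0 : D 0 by apply: (Dhom 0); apply: lg_zero.
  have DDadd y z : D y -> D z -> D (y + z).
    move=> [s [f [us nf ->]]] [t [g [ut ng ->]]].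
    pose f' n := if n \in s then f n else 0.
    pose g' n := if n \in t then g n else 0.
    exists (undup (s ++ t)), (fun n => f' n + g' n); split.
    + exact: undup_uniq.
    + move=> n; apply: lg_add; rewrite /f' /g'; case: ifP => // _.
        exact: lg_zero.
      exact: lg_zero.
    + have widen r (h : int -> lpa) : uniq r -> {subset r <= s ++ t} ->
        \sum_(n <- r) h n =
        \sum_(n <- undup (s ++ t)) (if n \in r then h n else 0).
        move=> ur rs; rewrite -big_mkcond /= -[RHS]big_filter; apply: perm_big.
        apply: uniq_perm => // [|n]; first by rewrite filter_uniq ?undup_uniq.
        rewrite mem_filter mem_undup; apply/idP/andP => [nr|[]//].
        by split=> //; apply: rs.
      rewrite big_split /= -!widen // => n nr; rewrite mem_cat nr ?orbT //.
  have Dsum I (r : seq I) (F : I -> lpa) :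
      (forall i, D (F i)) -> D (\sum_(i <- r) F i).
    by move=> DF; apply: (big_ind D).
  elim/lpa_ind; elim=> [v|e|e||s IHs t IHt|a s [r [f [ur nf xE]]]|s IHs t IHt].
  + exact: Dhom (lg_vert v).
  + exact: Dhom (lg_edge e).
  + exact: Dhom (lg_ghost e).
  + exact: D0.
  + by rewrite lpa_clD; apply: DDadd.
  + exists r, (fun n => a *: f n); split=> // [n|]; first exact: lg_scale.
    by rewrite lpa_clZ xE scaler_sumr.
  + rewrite lpa_clM; case: IHs => [r [f [_ nf ->]]].
    case: IHt => [r' [g [_ ng ->]]].
    rewrite mulr_suml; apply/Dsum => i; rewrite mulr_sumr; apply/Dsum => j.
    exact: Dhom (lg_mul (nf i) (ng j)).
- move=> s f us nf sf n ns.
  pose d (k : int) : lpa := if k == 0 then 1 else 0.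
  have act0 : lpa_act (repr (0 : lpa)) d n = 0.
    by rewrite (lpa_act_comp (lg_zero 0)) mul0r.
  have actD (x y : lpa) :
      lpa_act (repr (x + y)) d n = lpa_act (repr x) d n + lpa_act (repr y) d n.
    exact: (lpa_act_congr (lpa_repr (repr x <+> repr y))).
  have := act0; rewrite -sf.
  rewrite (big_morph (fun x => lpa_act (repr x) d n) actD act0).
  rewrite (bigD1_seq n) //= (lpa_act_comp (nf n)) /d subrr eqxx mulr1.
  rewrite big1 ?addr0 // => k kn; rewrite (lpa_act_comp (nf k)).
  by rewrite subr_eq0 eq_sym (negbTE kn) mulr0.
Qed.

Definition leavitt : graded_ring :=
  @GradedRing lpa lpa_comp lpa_comp_decomposition lg_mul.

End Leavitt.

(* Main.v *)
(* Equivalences.  A graded right L(E)-module over a graph without sinks is the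
   same as a graded vector space M with compatible isomorphisms from each M.v to
   the sum of the M.r(e) over the edges e leaving v, each e raising degrees by
   one; in matrix terms M = A M (1).  If A = RS and B = SR, then M |-> SM turns
   such a structure for A into one for B, and N |-> RN(1) is inverse to it since
   RSM(1) = AM(1) = M.  The structures make sense for every nonnegative matrix,
   so the chain defining a strong shift equivalence may pass through graphs with
   sinks.  Splittings are elementary equivalences of this kind.

   Shift equivalence.  Let P_v = v L(E).  Conjugating by the paths of length l
   turns any finite matrix over the degree-zero part of L(E) into a matrix of
   scalars, one block per vertex, once l is large.  Splitting idempotent scalar
   matrices, every summand of a finite sum of shifts of the P_v has, in all
     large
   degrees, a basis with some number r(w) of elements at each vertex w; passing
   to the next degree replaces the row r by rA, and two rows of the same module
   in the same degree agree after multiplication by a power of A.  A graded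
   equivalence sends P_v to such a summand, because the images under the inverse
   equivalence of the projectives P_w generate P_v and v is a finite sum.  The
   rows of the modules phi(P_v) and psi(P_w) form the matrices R and S. *)
Require Import Defs.
From HB Require Import structures.
From mathcomp Require Import all_boot all_order all_algebra.
From mathcomp Require Import boolp functions.
From mathcomp Require Import zify.

Set Implicit Arguments.
Unset Strict Implicit.
Unset Printing Implicit Defensive.

Import GRing.Theory.
Local Open Scope ring_scope.

#[local] Obligation Tactic := try by [].

(** * Linear maps, submodules and decompositions *)

(** A graded functor has to commute with the shifts by an equality of functors, not merely up to
    isomorphism. All constructions therefore keep the underlying module under a shift and alter only
    its degree predicate: the two composites then involve propositionally equal predicates, and
    function extensionality with proof irrelevance identifies them. In the passage from an
    equivalence to matrices, the functor is given as a bare functor. Its additivity, the injectivity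
    of images of injective maps and the generation of modules are all derived from full
    faithfulness, the maps out of the modules generated by one vertex taking the place of elements.
    Here strictness helps: the image of a shifted projective is literally the shifted image, so one
    matrix of types governs all degrees. Counts of basis elements can be compared because the
    vertices are linearly independent in [lpa], which is read off from a concrete representation on
    functions; this gives scalar matrices well-defined coefficients at each vertex. *)

Definition mklin (R : pzRingType) (U V : lmodType R) (f : U -> V)
  (fl : linear f) : {linear U -> V} :=
  HB.pack f (GRing.isLinear.Build R U V _ f fl).

Record submodule (R : pzRingType) (V : lmodType R) := Submodule {
  smem :> V -> Prop;
  smem0 : smem 0;
  smemP : forall a x y, smem x -> smem y -> smem (a *: x + y)
}.

Section SubmoduleType.
Variables (R : pzRingType) (V : lmodType R) (S : submodule V).

Definition smem_pred : {pred V} := fun x => `[< S x >].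

Lemma smem_submod : submod_closed smem_pred.
Proof.
split=> [|a x y /asboolP Sx /asboolP Sy]; apply/asboolP; first exact: smem0.
exact: smemP.
Qed.

HB.instance Definition _ :=
  GRing.isSubmodClosed.Build R V smem_pred smem_submod.

Definition subm := {x : V | smem_pred x}.
HB.instance Definition _ := SubChoice.on subm.
HB.instance Definition _ := [SubChoice_isSubLmodule of subm by <:].

Definition mksub (x : V) (Sx : S x) : subm := exist _ x (asboolT Sx).

Lemma submP (x : subm) : S (val x). Proof. by case: x => x /= /asboolP. Qed.

End SubmoduleType.

(** Projections act coordinatewise on submodules, products and families, so gradings of these are
    built from projections rather than from lists of components. *)
Definition is_projections (V : zmodType) (Vc : int -> V -> Prop)
    (pr : int -> V -> V) : Prop :=
  [/\ forall n x, Vc n (pr n x),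
      forall n x y, pr n (x - y) = pr n x - pr n y,
      forall n x, Vc n x -> pr n x = x,
      forall n m x, m != n -> Vc m x -> pr n x = 0
    & forall x, exists2 s : seq int, uniq s &
        (forall n, n \notin s -> pr n x = 0) /\ x = \sum_(n <- s) pr n x].

Lemma projections_decomposition (V : zmodType) (Vc : int -> V -> Prop) pr :
  is_projections Vc pr -> is_decomposition Vc.
Proof.
case=> prV prB prid pr0 prsum.
have pr00 n : pr n 0 = 0 by rewrite -{1}(subrr 0) prB subrr.
have prN n x : pr n (- x) = - pr n x by rewrite -sub0r prB pr00 sub0r.
have prD n x y : pr n (x + y) = pr n x + pr n y.
  by rewrite -{1}[y]opprK prB prN opprK.
split.
- move=> n; split=> [|x y /prid <- /prid <-]; first by rewrite -(pr00 n).
  by rewrite -prB.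
- by move=> x; have [s _ [_ xE]] := prsum x; exists s, (pr^~ x).
- move=> s f us Vf sf n ns.
  have := pr00 n; rewrite -sf (big_morph (pr n) (prD n) (pr00 n)).
  rewrite (bigD1_seq n) //= prid // big1 ?addr0 // => m mn.
  exact: pr0 (Vf m).
Qed.

Section Projections.
Variables (V : zmodType) (Vc : int -> V -> Prop).
Hypothesis Vdec : is_decomposition Vc.

Lemma decomp0 n : Vc n 0. Proof. by have [/(_ n) []] := Vdec. Qed.

Lemma decompB n x y : Vc n x -> Vc n y -> Vc n (x - y).
Proof. by have [/(_ n) [_ +] _ _] := Vdec; apply. Qed.

Lemma decompN n x : Vc n x -> Vc n (- x).
Proof. by move=> nx; rewrite -sub0r; apply/decompB/nx/decomp0. Qed.

Lemma decompD n x y : Vc n x -> Vc n y -> Vc n (x + y).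
Proof. by move=> nx ny; rewrite -[y]opprK; apply/decompB/decompN. Qed.

Lemma decomp_sum n I (r : seq I) (P : pred I) (F : I -> V) :
  (forall i, P i -> Vc n (F i)) -> Vc n (\sum_(i <- r | P i) F i).
Proof.
by move=> nF; apply: (big_ind (Vc n)) => //;
  [apply: decomp0 | apply: decompD].
Qed.

(* The list in [is_decomposition] may have repetitions. *)
Lemma decomp_uniq x : exists (s : seq int) (f : int -> V),
  [/\ uniq s, forall n, Vc n (f n), forall n, n \notin s -> f n = 0
    & x = \sum_(n <- s) f n].
Proof.
have [_ span _] := Vdec; have [s [f [Vf ->]]] := span x.
exists (undup s), (fun n => f n *+ count_mem n s); split.
- exact: undup_uniq.
- move=> n; elim: (count_mem n s) => [|k IH]; first exact: decomp0.
  by rewrite mulrS; apply: decompD.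
- by move=> n; rewrite mem_undup => /count_memPn ->.
- rewrite [RHS](eq_bigr (fun n => \sum_(m <- s | m == n) f m)).
    rewrite [RHS](exchange_big_dep xpredT) //=; apply: eq_big_seq => m ms.
    rewrite big_mkcond (bigD1_seq m) ?undup_uniq ?mem_undup //= eqxx.
    by rewrite big1 ?addr0 // => n nm; rewrite eq_sym (negbTE nm).
  move=> n _; rewrite (eq_bigr (fun=> f n)) => [|m /eqP -> //].
  by rewrite big_const_seq iter_addr_0.
Qed.

(** Any choice of a decomposition for each element yields additive projections, because
    decompositions are unique: two of them, extended by zero to a common list, differ by a family
    summing to zero. *)
Lemma decomp_projections : exists pr, is_projections Vc pr.
Proof.
pose Q (x : V) (sf : seq int * (int -> V)) :=
  [/\ uniq sf.1, forall n, Vc n (sf.2 n), forall n, n \notin sf.1 -> sf.2 n = 0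
    & x = \sum_(n <- sf.1) sf.2 n].
have QP x : exists sf, Q x sf.
  by have [s [f sfP]] := decomp_uniq x; exists (s, f).
pose F x := sval (cid (QP x)).
have FP x : Q x (F x) by rewrite /F; case: cid.
have [_ _ free] := Vdec.
have widen (s t : seq int) (f : int -> V) : uniq s -> uniq t ->
    {subset s <= t} -> (forall n, n \notin s -> f n = 0) ->
    \sum_(n <- s) f n = \sum_(n <- t) f n.
  move=> us ut st f0; rewrite [RHS](bigID [in s]) /= [X in _ + X]big1 ?addr0.
    rewrite -[RHS]big_filter; apply/perm_big/uniq_perm; rewrite ?filter_uniq //.
    by move=> n; rewrite mem_filter; apply/idP/andP => [ns|[]//]; split=> //;
      apply: st.
  by move=> n; apply: f0.
have uni x (s : seq int) (f : int -> V) : uniq s -> (forall n, Vc n (f n)) ->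
    (forall n, n \notin s -> f n = 0) -> x = \sum_(n <- s) f n -> (F x).2 = f.
  move=> us Vf f0 xE; have [us' Vf' f0' xE'] := FP x.
  pose t := undup (s ++ (F x).1).
  have ut : uniq t by rewrite undup_uniq.
  apply/funext => n; case: (boolP (n \in t)) => [nt|]; last first.
    by rewrite mem_undup mem_cat negb_or => /andP[/f0-> /f0'->].
  apply/eqP; rewrite -subr_eq0; apply/eqP.
  apply: (free t (fun k => (F x).2 k - f k)) => //.
    by move=> k; apply: decompB.
  rewrite sumrB -(widen _ t _ us' ut _ f0') -?(widen _ t _ us ut _ f0).
  - by rewrite -xE -xE' subrr.
  - by move=> k ks; rewrite mem_undup mem_cat ks.
  - by move=> k ks; rewrite mem_undup mem_cat ks orbT.
exists (fun n x => (F x).2 n); split.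
- by move=> n x; have [] := FP x.
- move=> n x y; have [ux Vx x0 xE] := FP x; have [uy Vy y0 yE] := FP y.
  pose t := undup ((F x).1 ++ (F y).1).
  rewrite (uni (x - y) t (fun n => (F x).2 n - (F y).2 n)) ?undup_uniq //.
  + by move=> k; apply: decompB.
  + move=> k; rewrite mem_undup mem_cat negb_or => /andP[/x0-> /y0->].
    by rewrite subr0.
  + rewrite {1}xE {1}yE sumrB; congr (_ - _); apply: widen;
      rewrite ?undup_uniq // => k ks; rewrite mem_undup mem_cat ks ?orbT //.
- move=> n x nx.
  rewrite (uni x [:: n] (fun k => if k == n then x else 0)) ?eqxx //.
  + by move=> k; case: eqP => [->|] // _; apply: decomp0.
  + by move=> k; rewrite inE => /negbTE ->.
  + by rewrite big_seq1 eqxx.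
- move=> n m x mn mx.
  rewrite (uni x [:: m] (fun k => if k == m then x else 0)) //.
  + by rewrite eq_sym (negbTE mn).
  + by move=> k; case: eqP => [->|] // _; apply: decomp0.
  + by move=> k; rewrite inE => /negbTE ->.
  + by rewrite big_seq1 eqxx.
- by move=> x; have [ux Vx x0 xE] := FP x; exists (F x).1.
Qed.

Definition proj : int -> V -> V := sval (cid decomp_projections).

Lemma projP : is_projections Vc proj.
Proof. by rewrite /proj; case: cid. Qed.

Lemma proj_comp n x : Vc n (proj n x). Proof. by case: projP. Qed.

Lemma proj_id n x : Vc n x -> proj n x = x.
Proof. by case: projP => _ _ + _ _; apply. Qed.

Lemma proj_ne n m x : m != n -> Vc m x -> proj n x = 0.
Proof. by case: projP => _ _ _ + _; apply. Qed.

Lemma projB n x y : proj n (x - y) = proj n x - proj n y.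
Proof. by case: projP. Qed.

Lemma proj0 n : proj n 0 = 0.
Proof. by rewrite -{1}(subrr 0) projB subrr. Qed.

Lemma projD n x y : proj n (x + y) = proj n x + proj n y.
Proof. by rewrite -{1}[y]opprK -[- y]sub0r !projB proj0 sub0r opprK. Qed.

Lemma proj_sum n I (r : seq I) (P : pred I) (F : I -> V) :
  proj n (\sum_(i <- r | P i) F i) = \sum_(i <- r | P i) proj n (F i).
Proof. exact: (big_morph (proj n) (projD n) (proj0 n)). Qed.

Lemma proj_sumE x : exists2 s : seq int, uniq s &
  forall t : seq int, uniq t -> {subset s <= t} ->
    x = \sum_(n <- t) proj n x /\ forall n, n \notin t -> proj n x = 0.
Proof.
have [_ _ _ _ /(_ x) [s us [x0 xE]]] := projP; exists s => // t ut st.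
split; last by move=> n nt; apply: x0; apply: contra nt => /st.
rewrite {1}xE [RHS](bigID [in s]) /= [X in _ + X]big1 ?addr0 => [|n /x0 //].
rewrite -[RHS]big_filter; apply/perm_big/uniq_perm; rewrite ?filter_uniq //.
by move=> n; rewrite mem_filter; apply/idP/andP => [ns|[]//]; split=> //;
  apply: st.
Qed.

End Projections.

Lemma graded_map_proj (V W : zmodType) (Vc : int -> V -> Prop)
    (Wc : int -> W -> Prop) (dV : is_decomposition Vc)
    (dW : is_decomposition Wc) (h : V -> W) (d : int) :
  {morph h : x y / x - y} -> (forall n x, Vc n x -> Wc (n + d) (h x)) ->
  forall n x, proj dW (n + d) (h x) = h (proj dV n x).
Proof.
move=> hB hd n x.
have h0 : h 0 = 0 by rewrite -(subrr 0) hB subrr.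
have hD y z : h (y + z) = h y + h z.
  by rewrite -{1}[z]opprK -[- z]sub0r !hB h0 sub0r opprK.
(* The degree [n] joins the support, so that its summand can be isolated even when it vanishes. *)
have [s us /(_ (undup (n :: s)))] := proj_sumE dV x.
case=> [||xE x0]; first exact: undup_uniq.
  by move=> k ks; rewrite mem_undup inE ks orbT.
rewrite {1}xE (big_morph h hD h0) proj_sum (bigD1_seq n) ?undup_uniq ?mem_undup
  ?inE ?eqxx //=.
rewrite proj_id; last by apply: hd; apply: proj_comp.
rewrite big1 ?addr0 // => k kn; apply: (@proj_ne _ _ _ _ (k + d)).
  by rewrite (inj_eq (addIr d)).
by apply: hd; apply: proj_comp.
Qed.

Lemma graded_map_proj0 (V W : zmodType) (Vc : int -> V -> Prop)
    (Wc : int -> W -> Prop) (dV : is_decomposition Vc)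
    (dW : is_decomposition Wc) (h : V -> W) :
  {morph h : x y / x - y} -> (forall n x, Vc n x -> Wc n (h x)) ->
  forall n x, proj dW n (h x) = h (proj dV n x).
Proof.
move=> hB hd n x; rewrite -[n in LHS]addr0; apply: graded_map_proj => //.
by move=> k y; rewrite addr0; apply: hd.
Qed.

(** * Categories with shift functors *)

Definition castm (C : category) (X Y : C) (p : X = Y) : mor X Y :=
  eq_rect X (mor X) (idm X) Y p.

Lemma functor_pf (C D : category) (o : C -> D)
    (m : forall X Y : C, mor X Y -> mor (o X) (o Y)) p q p' q' :
  @Functor C D o m p q = @Functor C D o m p' q'.
Proof. by congr Functor; apply: Prop_irrelevance. Qed.

(** Strict commutation with shifts compares functors whose values on objects agree only
    propositionally. Once the object maps are identified, irrelevance of equality proofs turns every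
    cast into an identity. *)
Lemma functor_eq (C D : category) (F G : functor C D)
    (FG : forall X, F X = G X) :
  (forall X Y (f : mor X Y),
     compm (castm (FG Y)) (fmap F f) = compm (fmap G f) (castm (FG X))) ->
  F = G.
Proof.
case: F G FG => [o m p q] [o' m' p' q'] /= FG.
have oo' : o = o' by apply/funext.
subst o'.
have -> : FG = fun X => erefl by apply: Prop_irrelevance.
rewrite /castm /= => mm'.
have mE : m = m'.
  apply/functional_extensionality_dep => X.
  apply/functional_extensionality_dep => Y; apply/funext => f.
  by have := mm' X Y f; rewrite comp1m compm1.
by subst m'; exact: functor_pf.
Qed.

Lemma comp_functorA (A B C D : category) (H : functor C D) (G : functor B C)
    (F : functor A B) :
  comp_functor H (comp_functor G F) = comp_functor (comp_functor H G) F.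
Proof. exact: functor_pf. Qed.

Lemma comp_functor1 (C D : category) (F : functor C D) :
  comp_functor F (id_functor C) = F.
Proof. by case: F => o m p q; exact: functor_pf. Qed.

Lemma comp_1functor (C D : category) (F : functor C D) :
  comp_functor (id_functor D) F = F.
Proof. by case: F => o m p q; exact: functor_pf. Qed.

Lemma natiso_refl (C D : category) (F : functor C D) :
  naturally_isomorphic F F.
Proof.
exists (fun X => idm (F X)), (fun X => idm (F X)).
by split=> [X Y f|X|X]; rewrite ?comp1m ?compm1.
Qed.

Lemma natiso_trans (C D : category) (F G H : functor C D) :
  naturally_isomorphic F G -> naturally_isomorphic G H ->
  naturally_isomorphic F H.
Proof.
move=> [e [t [en te et]]] [e' [t' [en' te' et']]].
exists (fun X => compm (e' X) (e X)), (fun X => compm (t X) (t' X)).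
split=> [X Y f|X|X].
- by rewrite -compmA en compmA en' compmA.
- by rewrite -compmA [compm (t' X) _]compmA te' comp1m.
- by rewrite -compmA [compm (e X) _]compmA et comp1m.
Qed.

Lemma natiso_whisker (B C D A : category) (F G : functor C D)
    (H : functor D A) (K : functor B C) :
  naturally_isomorphic F G ->
  naturally_isomorphic (comp_functor H (comp_functor F K))
                       (comp_functor H (comp_functor G K)).
Proof.
move=> [e [t [en te et]]].
exists (fun X => fmap H (e (K X))), (fun X => fmap H (t (K X))).
split=> [X Y f|X|X] /=.
- by rewrite -!fmapM en.
- by rewrite -fmapM te fmap1.
- by rewrite -fmapM et fmap1.
Qed.

(** Graded modules and graph representations are treated alike, so that equivalences compose through
    representation categories of intermediate graphs. *)
Record zcat := ZCat {
  zc_cat :> category;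
  zshift : int -> functor zc_cat zc_cat
}.

Definition zfunctor (C D : zcat) (F : functor C D) : Prop :=
  forall j, comp_functor F (zshift C j) = comp_functor (zshift D j) F.

Definition zequivalent (C D : zcat) : Prop :=
  exists (F : functor C D) (G : functor D C),
    [/\ zfunctor F, zfunctor G,
        naturally_isomorphic (comp_functor G F) (id_functor C)
      & naturally_isomorphic (comp_functor F G) (id_functor D)].

Lemma zequivalent_refl (C : zcat) : zequivalent C C.
Proof.
exists (id_functor C), (id_functor C); split;
  rewrite ?comp_functor1; try exact: natiso_refl;
  by move=> j; rewrite comp_functor1 comp_1functor.
Qed.

Lemma zequivalent_sym (C D : zcat) : zequivalent C D -> zequivalent D C.
Proof. by move=> [F [G [zF zG GF FG]]]; exists G, F. Qed.

Lemma zfunctor_comp (B C D : zcat) (F : functor C D) (G : functor B C) :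
  zfunctor F -> zfunctor G -> @zfunctor B D (comp_functor F G).
Proof.
by move=> zF zG j; rewrite -comp_functorA zG comp_functorA zF comp_functorA.
Qed.

Lemma zequivalent_trans (B C D : zcat) :
  zequivalent B C -> zequivalent C D -> zequivalent B D.
Proof.
move=> [F [G [zF zG GF FG]]] [F' [G' [zF' zG' GF' FG']]].
exists (comp_functor F' F), (comp_functor G G').
split; try exact: zfunctor_comp.
- rewrite -comp_functorA [comp_functor G' _]comp_functorA.
  apply: natiso_trans (natiso_whisker G F GF') _.
  by rewrite comp_1functor.
- rewrite -comp_functorA [comp_functor F _]comp_functorA.
  apply: natiso_trans (natiso_whisker F' G' FG) _.
  by rewrite comp_1functor.
Qed.

Definition GrZ (R : graded_ring) : zcat := ZCat (shift_functor R).

Lemma graded_morita_zequivalent (R R' : graded_ring) :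
  graded_morita_equiv R R' <-> zequivalent (GrZ R) (GrZ R').
Proof.
split=> [[F [zF [G [zG GF FG]]]]|[F [G [zF zG GF FG]]]].
  by exists F, G.
by exists F; split=> //; exists G.
Qed.

Lemma gm_eq (R : graded_ring) (V : lmodType R^c) (c c' : int -> V -> Prop)
    d m d' m' : c = c' ->
  @GradedModule R V c d m = @GradedModule R V c' d' m'.
Proof.
by move=> cc'; subst c'; congr GradedModule; apply: Prop_irrelevance.
Qed.

Lemma gm_castE (R : graded_ring) (V : lmodType R^c) (c c' : int -> V -> Prop)
    d m d' m' (p : @GradedModule R V c d m = @GradedModule R V c' d' m') :
  c = c' ->
  forall x : V, (@castm (Gr R) _ _ p : graded_hom _ _) x = x.
Proof.
move=> cc'; subst c'.
have dd : d = d' by apply: Prop_irrelevance.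
have mm : m = m' by apply: Prop_irrelevance.
subst d' m' => x.
by have -> : p = erefl by apply: Prop_irrelevance.
Qed.

(** * Representations of a graph *)

Section Representations.
Variables (K : fieldType) (E : digraph).

(* Right actions of the generators. The Cuntz-Krieger relation is imposed at
   every vertex, so a sink acts by zero. *)
Record leavitt_rep (M : lmodType K) := LeavittRep {
  rv : vert E -> {linear M -> M};
  re : edge E -> {linear M -> M};
  rg : edge E -> {linear M -> M};
  rvv : forall v w x, rv w (rv v x) = if v == w then rv v x else 0;
  rv1 : forall x, \sum_v rv v x = x;
  re_src : forall e x, re e (rv (src e) x) = re e x;
  re_rng : forall e x, rv (rng e) (re e x) = re e x;
  rg_rng : forall e x, rg e (rv (rng e) x) = rg e x;
  rg_src : forall e x, rv (src e) (rg e x) = rg e x;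
  rge : forall e f x, re f (rg e x) = if e == f then rv (rng e) x else 0;
  reg : forall x, \sum_e rg e (re e x) = x
}.

Record grep := GRep {
  gr_mod :> lmodType K;
  gr_rep : leavitt_rep gr_mod;
  grc : int -> gr_mod -> Prop;
  gr_dec : is_decomposition grc;
  gr_scale : forall n a x, grc n x -> grc n (a *: x);
  gr_v : forall n v x, grc n x -> grc n (rv gr_rep v x);
  gr_e : forall n e x, grc n x -> grc (n + 1) (re gr_rep e x);
  gr_g : forall n e x, grc n x -> grc (n - 1) (rg gr_rep e x)
}.

Arguments grc : clear implicits.

Record rhom (M N : grep) := RHom {
  rh_fun :> M -> N;
  rh_lin : linear rh_fun;
  rh_v : forall v x, rh_fun (rv (gr_rep M) v x) = rv (gr_rep N) v (rh_fun x);
  rh_e : forall e x, rh_fun (re (gr_rep M) e x) = re (gr_rep N) e (rh_fun x);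
  rh_deg : forall n x, grc M n x -> grc N n (rh_fun x)
}.

Lemma rhom_ext (M N : grep) (f g : rhom M N) : (forall x, f x = g x) -> f = g.
Proof.
case: f g => [f a b c d] [g a' b' c' d'] /= /funext fg.
by subst g; congr RHom; apply: Prop_irrelevance.
Qed.

Program Definition rhom_id (M : grep) : rhom M M := @RHom M M id _ _ _ _.

Program Definition rhom_comp (M N P : grep) (f : rhom N P) (g : rhom M N) :
  rhom M P := @RHom M P (fun x => f (g x)) _ _ _ _.
Next Obligation. by move=> M N P f g a u v; rewrite !rh_lin. Qed.
Next Obligation. by move=> M N P f g v x /=; rewrite !rh_v. Qed.
Next Obligation. by move=> M N P f g v x /=; rewrite !rh_e. Qed.
Next Obligation. by move=> M N P f g n x nx; do 2!apply: rh_deg. Qed.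

Program Definition RepCat : category :=
  @Category grep rhom rhom_id rhom_comp _ _ _.
Next Obligation. by move=> *; apply: rhom_ext. Qed.
Next Obligation. by move=> *; apply: rhom_ext. Qed.
Next Obligation. by move=> *; apply: rhom_ext. Qed.

Program Definition grep_shift (j : int) (M : grep) : grep :=
  @GRep M (gr_rep M) (fun n => grc M (n + j)) _ _ _ _ _.
Next Obligation. by move=> j M; apply/shift_decomposition/gr_dec. Qed.
Next Obligation. by move=> j M n a x; apply: gr_scale. Qed.
Next Obligation. by move=> j M n a x; apply: gr_v. Qed.
Next Obligation. by move=> j M n e x nx /=; rewrite addrAC; apply: gr_e. Qed.
Next Obligation. by move=> j M n e x nx /=; rewrite addrAC; apply: gr_g. Qed.

Program Definition rhom_shift (j : int) (M N : grep) (f : rhom M N) :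
    rhom (grep_shift j M) (grep_shift j N) :=
  @RHom (grep_shift j M) (grep_shift j N) f _ _ _ _.
Next Obligation. by move=> j M N f; exact: (rh_lin f). Qed.
Next Obligation. by move=> j M N f; exact: (rh_v f). Qed.
Next Obligation. by move=> j M N f; exact: (rh_e f). Qed.
Next Obligation. by move=> j M N f n x; exact: (rh_deg f). Qed.

Program Definition rep_shift_functor (j : int) : functor RepCat RepCat :=
  @Functor RepCat RepCat (grep_shift j) (@rhom_shift j) _ _.
Next Obligation. by move=> *; apply: rhom_ext. Qed.
Next Obligation. by move=> *; apply: rhom_ext. Qed.

Definition RepZ : zcat := ZCat rep_shift_functor.

Lemma grep_eq (V : lmodType K) (r : leavitt_rep V) (c c' : int -> V -> Prop)
    d s v e g d' s' v' e' g' : c = c' ->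
  @GRep V r c d s v e g = @GRep V r c' d' s' v' e' g'.
Proof. by move=> cc'; subst c'; congr GRep; apply: Prop_irrelevance. Qed.

Lemma grep_castE (V : lmodType K) (r : leavitt_rep V)
    (c c' : int -> V -> Prop) d s v e g d' s' v' e' g'
    (p : @GRep V r c d s v e g = @GRep V r c' d' s' v' e' g') : c = c' ->
  forall x : V, (@castm RepCat _ _ p : rhom _ _) x = x.
Proof.
move=> cc'; subst c'.
have dd : d = d' by apply: Prop_irrelevance.
have ss : s = s' by apply: Prop_irrelevance.
have vv : v = v' by apply: Prop_irrelevance.
have ee : e = e' by apply: Prop_irrelevance.
have gg : g = g' by apply: Prop_irrelevance.
subst d' s' v' e' g' => x.
by have -> : p = erefl by apply: Prop_irrelevance.
Qed.

Section RepTheory.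
Variables (M : lmodType K) (r : leavitt_rep M).

Lemma re_src_eq e v x : re r e (rv r v x) = if v == src e then re r e x else 0.
Proof. by rewrite -re_src rvv; case: eqP => [->|_];
  rewrite ?re_src ?linear0. Qed.

Lemma re_rng_eq e v x : rv r v (re r e x) = if v == rng e then re r e x else 0.
Proof. by rewrite -re_rng rvv eq_sym. Qed.

Lemma rg_src_eq e v x : rv r v (rg r e x) = if v == src e then rg r e x else 0.
Proof. by rewrite -rg_src rvv eq_sym. Qed.

Lemma reg_src v x : \sum_(e | src e == v) rg r e (re r e x) = rv r v x.
Proof.
rewrite -[RHS](reg r) big_mkcond; apply: eq_bigr => e _.
by rewrite re_src_eq eq_sym; case: eqP; rewrite ?linear0.
Qed.

Fixpoint rep_act (t : lpa_term K E) (x : M) : M :=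
  match t with
  | LVert v => rv r v x
  | LEdge e => re r e x
  | LGhost e => rg r e x
  | LZero => 0
  | LAdd s t => rep_act s x + rep_act t x
  | LScale a s => a *: rep_act s x
  | LMul s t => rep_act t (rep_act s x)
  end.

Lemma rep_act_lin t : linear (rep_act t).
Proof.
elim: t => [v|e|e||s IHs t IHt|a s IHs|s IHs t IHt] b x y /=;
  rewrite ?linearP ?scaler0 ?addr0 //.
- by rewrite IHs IHt scalerDr addrACA.
- by rewrite IHs scalerDr !scalerA mulrC.
- by rewrite IHs IHt.
Qed.

Lemma rep_actD t x y : rep_act t (x + y) = rep_act t x + rep_act t y.
Proof. by have := rep_act_lin t 1 x y; rewrite !scale1r. Qed.

Lemma rep_act0 t : rep_act t 0 = 0.
Proof. by have := rep_act_lin t (-1) 0 0; rewrite !scaleN1r !addNr. Qed.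

Lemma rep_actZ t a x : rep_act t (a *: x) = a *: rep_act t x.
Proof. by have := rep_act_lin t a x 0; rewrite rep_act0 !addr0. Qed.

Lemma rep_act_sum I (s : seq I) (P : pred I) (F : I -> lpa_term K E) x :
  rep_act (\big[@LAdd K E/@LZero K E]_(i <- s | P i) F i) x
  = \sum_(i <- s | P i) rep_act (F i) x.
Proof. exact: (big_morph (fun t => rep_act t x)). Qed.

Lemma rep_act_congr s t : lpa_congr s t -> rep_act s =1 rep_act t.
Proof.
elim=> {s t} /=.
- by [].
- by move=> s t _ IH x; rewrite IH.
- by move=> s t u _ IH1 _ IH2 x; rewrite IH1 IH2.
- by move=> s s' t t' _ IH1 _ IH2 x /=; rewrite IH1 IH2.
- by move=> a s s' _ IH x /=; rewrite IH.
- by move=> s s' t t' _ IH1 _ IH2 x /=; rewrite IH1 IH2.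
- by move=> * x /=; rewrite addrA.
- by move=> * x /=; rewrite addrC.
- by move=> * x /=; rewrite add0r.
- by move=> s x /=; rewrite scaleN1r addNr.
- by move=> * x /=; rewrite scalerA.
- by move=> * x /=; rewrite scale1r.
- by move=> * x /=; rewrite scalerDr.
- by move=> * x /=; rewrite scalerDl.
- by [].
- by move=> s t u x /=; rewrite rep_actD.
- by [].
- by move=> a s t x /=; rewrite rep_actZ.
- by [].
- by move=> v w x /=; rewrite rvv; case: eqP.
- by move=> e x /=; rewrite re_src.
- by move=> e x /=; rewrite re_rng.
- by move=> e x /=; rewrite rg_rng.
- by move=> e x /=; rewrite rg_src.
- by move=> e f x /=; rewrite rge; case: eqP.
- move=> v _ x; rewrite rep_act_sum /= -reg_src.
  by apply: eq_bigl => e; rewrite inE.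
Qed.

(** A class acts through a chosen representative; [rep_act_congr] makes the choice harmless.
    Products act from left to right, as befits right modules. *)
Definition lact (a : lpa K E) (x : M) : M := rep_act (repr a) x.

Lemma lactE t x : lact (lpa_cl t) x = rep_act t x.
Proof. exact: (rep_act_congr (lpa_repr t)). Qed.

Lemma lactD a b x : lact (a + b) x = lact a x + lact b x.
Proof. by elim/lpa_ind: a => s; elim/lpa_ind: b => t;
  rewrite -lpa_clD !lactE. Qed.

Lemma lactM a b x : lact (a * b) x = lact b (lact a x).
Proof. by elim/lpa_ind: a => s; elim/lpa_ind: b => t;
  rewrite -lpa_clM !lactE. Qed.

Lemma lactZ k a x : lact (k *: a) x = k *: lact a x.
Proof. by elim/lpa_ind: a => s; rewrite -lpa_clZ !lactE. Qed.

Lemma lact0 x : lact 0 x = 0.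
Proof. exact: (lactE (@LZero K E)). Qed.

Lemma lact_sum I (s : seq I) (P : pred I) (F : I -> lpa K E) x :
  lact (\sum_(i <- s | P i) F i) x = \sum_(i <- s | P i) lact (F i) x.
Proof.
exact: (big_morph (lact^~ x) (fun a b => lactD a b x) (lact0 x)).
Qed.

Lemma lact1 x : lact 1 x = x.
Proof.
by rewrite /GRing.one /= lact_sum -[RHS](rv1 r); apply: eq_bigr => v _;
  rewrite lactE.
Qed.

End RepTheory.

Lemma rhom_additive (M N : grep) (f : rhom M N) x y : f (x + y) = f x + f y.
Proof. by have := rh_lin f 1 x y; rewrite !scale1r. Qed.

Lemma rhom0 (M N : grep) (f : rhom M N) : f 0 = 0.
Proof. by have := rh_lin f (-1) 0 0; rewrite !scaleN1r !addNr. Qed.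

Lemma rhomZ (M N : grep) (f : rhom M N) a x : f (a *: x) = a *: f x.
Proof. by have := rh_lin f a x 0; rewrite rhom0 !addr0. Qed.

Lemma rhomB (M N : grep) (f : rhom M N) x y : f (x - y) = f x - f y.
Proof. by rewrite rhom_additive -[- y]scaleN1r rhomZ scaleN1r. Qed.

(* The ghosts are determined by the vertices and the edges, because the edges
   leaving a vertex identify its component with a product. *)
Lemma rh_g (M N : grep) (f : rhom M N) e x :
  f (rg (gr_rep M) e x) = rg (gr_rep N) e (f x).
Proof.
rewrite -[LHS](reg (gr_rep N)) (bigD1 e) //= -rh_e rge eqxx rh_v.
rewrite rg_rng big1 ?addr0 // => e' e'e.
by rewrite -rh_e rge eq_sym (negbTE e'e) rhom0 linear0.
Qed.

Lemma rhom_act (M N : grep) (f : rhom M N) t x :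
  f (rep_act (gr_rep M) t x) = rep_act (gr_rep N) t (f x).
Proof.
elim: t x => [v|e|e||s IHs t IHt|a s IHs|s IHs t IHt] x /=.
- exact: rh_v.
- exact: rh_e.
- exact: rh_g.
- exact: rhom0.
- by rewrite rhom_additive IHs IHt.
- by rewrite rhomZ IHs.
- by rewrite IHt IHs.
Qed.

End Representations.

Arguments grc {K E} M _ _ : rename.

(** * Modules over the Leavitt path algebra as representations *)

Definition ract (R : pzRingType) (M : lmodType R^c) (m : M) (a : R) : M :=
  (a : R^c) *: m.

Section RightAction.
Variables (R : pzRingType) (M : lmodType R^c).
Implicit Types (m : M) (a b : R).

Lemma ractM m a b : ract m (a * b) = ract (ract m a) b.
Proof. by rewrite /ract scalerA. Qed.

Lemma ract1 m : ract m 1 = m. Proof. exact: scale1r. Qed.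

Lemma ract0 m : ract m 0 = 0. Proof. exact: scale0r. Qed.

Lemma ract0l a : ract (0 : M) a = 0. Proof. exact: scaler0. Qed.

Lemma ractD m a b : ract m (a + b) = ract m a + ract m b.
Proof. exact: scalerDl. Qed.

Lemma ractDl m m' a : ract (m + m') a = ract m a + ract m' a.
Proof. exact: scalerDr. Qed.

Lemma ract_sum m I (s : seq I) (P : pred I) (F : I -> R) :
  ract m (\sum_(i <- s | P i) F i) = \sum_(i <- s | P i) ract m (F i).
Proof. exact: scaler_suml. Qed.

Lemma ract_suml I (s : seq I) (P : pred I) (F : I -> M) a :
  ract (\sum_(i <- s | P i) F i) a = \sum_(i <- s | P i) ract (F i) a.
Proof. exact: scaler_sumr. Qed.

End RightAction.

Section GradedHomTheory.
Variables (R : graded_ring) (M N : graded_module R) (f : graded_hom M N).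

Lemma gh_act m a : f (ract m a) = ract (f m) a.
Proof.
have f0 : f 0 = 0 by have := gh_linear f (-1) 0 0; rewrite !scaleN1r !addNr.
by have := gh_linear f (a : R^c) m 0; rewrite f0 !addr0.
Qed.

Lemma ghD m m' : f (m + m') = f m + f m'.
Proof. by have := gh_linear f 1 m m'; rewrite !scale1r. Qed.

Lemma gh0 : f 0 = 0.
Proof. by have := gh_act 0 0; rewrite !ract0. Qed.

Lemma ghN m : f (- m) = - f m.
Proof. by apply: (addrI (f m)); rewrite -ghD !subrr gh0. Qed.

Lemma ghB m m' : f (m - m') = f m - f m'.
Proof. by rewrite ghD ghN. Qed.

Lemma gh_sum I (s : seq I) (P : pred I) (F : I -> M) :
  f (\sum_(i <- s | P i) F i) = \sum_(i <- s | P i) f (F i).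
Proof. exact: (big_morph f ghD gh0). Qed.

End GradedHomTheory.

Section LeavittModules.
Variables (K : fieldType) (E : digraph).
Notation L := (lpa K E).

Lemma lpa_scaleM a (x y : L) : a *: x * y = a *: (x * y).
Proof. exact: lpa_mulZl. Qed.

Lemma lpa_mulrZ a (x y : L) : x * (a *: y) = a *: (x * y).
Proof. exact: lpa_mulZr. Qed.

Lemma lpa_ghost_edge (e f : edge E) : lpa_ghost K e * lpa_edge K f
  = if e == f then lpa_vert K (rng e) else 0.
Proof.
by rewrite /lpa_ghost /lpa_edge -lpa_clM -lpa_cl_if;
  apply/lpa_clP/lc_ghost_edge.
Qed.

Lemma lpa_cuntz_krieger (v : vert E) : (exists e, src e = v) ->
  \sum_(e | src e == v) lpa_edge K e * lpa_ghost K e = lpa_vert K v.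
Proof.
move=> [e ev].
have vE : [set e | src e == v] != set0.
  by apply/set0Pn; exists e; rewrite inE ev.
rewrite /lpa_vert -(iffRL (lpa_clP _ _) (lc_cuntz_krieger K vE)) lpa_cl_sum.
by apply: eq_big => [f|f _]; rewrite ?inE ?lpa_clM.
Qed.

Hypothesis sinkless : no_sinks E.

(** Without sinks the Cuntz-Krieger relation holds at every vertex, and the vertices add up to 1. *)
Lemma lpa_sum_edges : \sum_e lpa_edge K e * lpa_ghost K e = 1 :> L.
Proof.
rewrite (partition_big (@src E) xpredT) //=; apply: eq_bigr => v _.
exact: lpa_cuntz_krieger.
Qed.

Section Restriction.
Variable M : lmodType L^c.

Definition kmod : Type := M.
HB.instance Definition _ := GRing.Zmodule.on kmod.

(** Restriction of scalars along the central map sending [a] to [a *: 1]. *)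
Definition kscale (a : K) (m : kmod) : kmod := ract (m : M) (a *: (1 : L)).

Fact kscaleA a b m : kscale a (kscale b m) = kscale (a * b) m.
Proof. by rewrite /kscale -ractM lpa_scaleM mul1r scalerA mulrC. Qed.

Fact kscale1 : left_id 1 kscale.
Proof. by move=> m; rewrite /kscale scale1r ract1. Qed.

Fact kscaleDr : right_distributive kscale +%R.
Proof. by move=> a m n; apply: ractDl. Qed.

Fact kscaleDl m : {morph kscale^~ m : a b / a + b}.
Proof. by move=> a b; rewrite /kscale scalerDl ractD. Qed.

HB.instance Definition _ := GRing.Zmodule_isLmodule.Build K kmod
  kscaleA kscale1 kscaleDr kscaleDl.

Fact kact_lin (a : L) : linear ((fun m => ract (m : M) a) : kmod -> kmod).
Proof.
move=> k m n; rewrite /= [LHS]ractDl; congr (_ + _).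
rewrite /GRing.scale /= /kscale -!ractM lpa_scaleM mul1r.
by rewrite lpa_mulrZ mulr1.
Qed.

Definition kact (a : L) : {linear kmod -> kmod} := mklin (kact_lin a).

Program Definition restrict_rep : leavitt_rep E kmod :=
  @LeavittRep K E kmod (fun v => kact (lpa_vert K v))
    (fun e => kact (lpa_edge K e)) (fun e => kact (lpa_ghost K e))
    _ _ _ _ _ _ _ _.
Next Obligation.
move=> v w x; rewrite /= -ractM [_ * _]lpa_vertM; case: eqP => // _.
exact: ract0.
Qed.
Next Obligation. by move=> x; rewrite /= -ract_sum ract1. Qed.
Next Obligation. by move=> e x; rewrite /= -ractM [_ * _]lpa_src_edge. Qed.
Next Obligation. by move=> e x; rewrite /= -ractM [_ * _]lpa_edge_rng. Qed.
Next Obligation. by move=> e x; rewrite /= -ractM [_ * _]lpa_rng_ghost. Qed.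
Next Obligation. by move=> e x; rewrite /= -ractM [_ * _]lpa_ghost_src. Qed.
Next Obligation.
move=> e f x; rewrite /= -ractM lpa_ghost_edge; case: eqP => // _.
exact: ract0.
Qed.
Next Obligation.
move=> x; rewrite /= -[RHS](@ract1 L M) -lpa_sum_edges ract_sum.
by apply: eq_bigr => e _; rewrite ractM.
Qed.

Lemma restrict_act t (m : M) : rep_act restrict_rep t m = ract m (lpa_cl t).
Proof.
elim: t m => [v|e|e||s IHs t IHt|a s IHs|s IHs t IHt] m //=.
- by rewrite [RHS]ract0.
- by rewrite lpa_clD ractD IHs IHt.
- rewrite IHs lpa_clZ /GRing.scale /= /kscale -ractM.
  by rewrite lpa_mulrZ mulr1.
- by rewrite lpa_clM ractM IHs IHt.
Qed.

End Restriction.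

Program Definition restrict_grep (M : graded_module (leavitt K E)) : grep K E :=
  @GRep K E (kmod M) (restrict_rep M) (gm_comp M) _ _ _ _ _.
Next Obligation. by move=> M; apply: gm_decomposition. Qed.
Next Obligation.
move=> M n a x nx; rewrite -[n]addr0; apply: gm_compM => //=.
rewrite /GRing.one /=; apply: lg_scale; apply: lpa_comp_sum => v.
exact: lg_vert.
Qed.
Next Obligation.
move=> M n v x nx; rewrite -[n]addr0; apply: gm_compM => //; exact: lg_vert.
Qed.
Next Obligation. by move=> M n e x nx; apply: gm_compM => //;
  apply: lg_edge. Qed.
Next Obligation. by move=> M n e x nx; apply: gm_compM => //;
  apply: lg_ghost. Qed.

Program Definition restrict_hom (M N : graded_module (leavitt K E))
    (f : graded_hom M N) : rhom (restrict_grep M) (restrict_grep N) :=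
  @RHom K E (restrict_grep M) (restrict_grep N) f _ _ _ _.
Next Obligation.
move=> M N f a x y; rewrite [LHS]ghD; congr (_ + _); exact: gh_act.
Qed.
Next Obligation. by move=> M N f v x; apply: gh_act. Qed.
Next Obligation. by move=> M N f v x; apply: gh_act. Qed.
Next Obligation. by move=> M N f n x; apply: gh_degree. Qed.

Program Definition restrict_functor :
    functor (GrZ (leavitt K E)) (RepZ K E) :=
  @Functor (GrZ (leavitt K E)) (RepZ K E) restrict_grep restrict_hom _ _.
Next Obligation. by move=> *; apply: rhom_ext. Qed.
Next Obligation. by move=> *; apply: rhom_ext. Qed.

Section Lift.
Variables (M : lmodType K) (r : leavitt_rep E M).

(** The alias carries [r], so that the scalar multiplication by the algebra can be recovered from
    the type. *)
Definition lmod : Type := let _ := r in M.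
HB.instance Definition _ := GRing.Zmodule.copy lmod M.

Definition lscale (a : L^c) (m : lmod) : lmod := lact r a m.

Fact lscaleA a b m : lscale a (lscale b m) = lscale (a * b) m.
Proof. by rewrite /lscale [(a * b)]/(@GRing.mul L b a) lactM. Qed.

Fact lscale1 : left_id 1 lscale.
Proof. exact: lact1. Qed.

Fact lscaleDr : right_distributive lscale +%R.
Proof. by move=> a m n; apply: rep_actD. Qed.

Fact lscaleDl m : {morph lscale^~ m : a b / a + b}.
Proof. by move=> a b; apply: lactD. Qed.

HB.instance Definition _ := GRing.Zmodule_isLmodule.Build L^c lmod
  lscaleA lscale1 lscaleDr lscaleDl.

End Lift.

Lemma grep_act_degree (M : grep K E) j a : lpa_comp j a ->
  forall n x, grc M n x -> grc M (n + j) (lact (gr_rep M) a x).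
Proof.
elim=> {j a}.
- by move=> v n x nx; rewrite lactE /= addr0; apply: gr_v.
- by move=> e n x nx; rewrite lactE /=; apply: gr_e.
- by move=> e n x nx; rewrite lactE /=; apply: gr_g.
- by move=> j n x nx; rewrite lact0; exact: decomp0 (gr_dec M) _.
- move=> j a b _ IHa _ IHb n x nx; rewrite lactD.
  by apply: (decompD (gr_dec M)); [apply: IHa | apply: IHb].
- by move=> j k a _ IHa n x nx; rewrite lactZ; apply: gr_scale; apply: IHa.
- by move=> i j a b _ IHa _ IHb n x nx; rewrite lactM addrA; apply: IHb;
    apply: IHa.
Qed.

Program Definition lift_module (M : grep K E) : graded_module (leavitt K E) :=
  @GradedModule (leavitt K E) (lmod (gr_rep M)) (grc M) _ _.
Next Obligation. by move=> M; apply: gr_dec. Qed.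
Next Obligation. by move=> M i j m a im ja; apply: grep_act_degree. Qed.

Program Definition lift_hom (M N : grep K E) (f : rhom M N) :
    graded_hom (lift_module M) (lift_module N) :=
  @GradedHom (leavitt K E) (lift_module M) (lift_module N) f _ _.
Next Obligation.
move=> M N f a x y; rewrite [LHS]rhom_additive; congr (_ + _).
exact: rhom_act.
Qed.
Next Obligation. by move=> M N f n x; apply: rh_deg. Qed.

Program Definition lift_functor : functor (RepZ K E) (GrZ (leavitt K E)) :=
  @Functor (RepZ K E) (GrZ (leavitt K E)) lift_module lift_hom _ _.
Next Obligation. by move=> *; apply: graded_hom_ext. Qed.
Next Obligation. by move=> *; apply: graded_hom_ext. Qed.

(** Both composites keep the underlying additive group, so the natural isomorphisms are identity
    functions; what has to be compared is the two scalar multiplications. *)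
Lemma zequivalent_leavitt_rep : zequivalent (GrZ (leavitt K E)) (RepZ K E).
Proof.
exists restrict_functor, lift_functor; split.
- move=> j.
  have FG X : comp_functor restrict_functor (zshift (GrZ (leavitt K E)) j) X
      = comp_functor (zshift (RepZ K E) j) restrict_functor X by exact: grep_eq.
  apply: (@functor_eq _ _ _ _ FG) => X Y f.
  by apply: rhom_ext => x /=; rewrite !grep_castE.
- move=> j.
  have FG X : comp_functor lift_functor (zshift (RepZ K E) j) X
      = comp_functor (zshift (GrZ (leavitt K E)) j) lift_functor X by exact:
        gm_eq.
  apply: (@functor_eq _ _ _ _ FG) => X Y f.
  by apply: graded_hom_ext => x /=; rewrite !gm_castE.
- have id1 (M : graded_module (leavitt K E)) :
      linear (id : lmod (restrict_rep M) -> M).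
    move=> a x y; congr (_ + _); rewrite /GRing.scale /= /lscale /lact.
    by rewrite restrict_act /lpa_cl reprK.
  have id2 (M : graded_module (leavitt K E)) :
      linear (id : M -> lmod (restrict_rep M)).
    by move=> a x y; exact: esym (id1 M a x y).
  exists (fun M => @GradedHom (leavitt K E) (lift_module (restrict_grep M)) M
     id (id1 M) (fun _ _ => id)).
  exists (fun M => @GradedHom (leavitt K E) M (lift_module (restrict_grep M))
     id (id2 M) (fun _ _ => id)).
  by split=> [X Y f|X|X]; apply: graded_hom_ext.
- have scaleE (M : grep K E) a (x : M) : @kscale (lmod (gr_rep M)) a x = a *: x.
    by rewrite /kscale /ract /GRing.scale /= /lscale lactZ lact1.
  have id1 (M : grep K E) : linear (id : kmod (lmod (gr_rep M)) -> M).
    by move=> a x y; congr (_ + _); exact: scaleE.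
  have id2 (M : grep K E) : linear (id : M -> kmod (lmod (gr_rep M))).
    by move=> a x y; congr (_ + _); rewrite -scaleE.
  have actE (M : grep K E) t x :
      ract (x : lmod (gr_rep M)) (lpa_cl t) = rep_act (gr_rep M) t x.
    exact: lactE.
  exists (fun M => @RHom K E (restrict_grep (lift_module M)) M
     id (id1 M) (fun v => actE M (LVert K v)) (fun e => actE M (LEdge K e))
     (fun _ _ => id)).
  exists (fun M => @RHom K E M (restrict_grep (lift_module M))
     id (id2 M) (fun v x => esym (actE M (LVert K v) x))
     (fun e x => esym (actE M (LEdge K e) x)) (fun _ _ => id)).
  by split=> [X Y f|X|X]; apply: rhom_ext.
Qed.

End LeavittModules.

(** * Elementary equivalence of graphs *)

(* A bipartite graph with edge sets [er] from [vert E] to [vert F] and [es]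
   back, such that the edges of [E] are its paths r s and the edges of [F] its
   paths s r. *)
Record elem_data (E F : digraph) := ElemData {
  er : finType;
  es : finType;
  er_src : er -> vert E;
  er_rng : er -> vert F;
  es_src : es -> vert F;
  es_rng : es -> vert E;
  ear : edge E -> er;
  eas : edge E -> es;
  ebs : edge F -> es;
  ebr : edge F -> er;
  ear_src : forall e, er_src (ear e) = src e;
  eas_rng : forall e, es_rng (eas e) = rng e;
  ea_mid : forall e, er_rng (ear e) = es_src (eas e);
  ea_inj : forall e e', ear e = ear e' -> eas e = eas e' -> e = e';
  ea_surj : forall r s, er_rng r = es_src s -> exists2 e, ear e = r & eas e = s;
  ebs_src : forall f, es_src (ebs f) = src f;
  ebr_rng : forall f, er_rng (ebr f) = rng f;
  eb_mid : forall f, es_rng (ebs f) = er_src (ebr f);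
  eb_inj : forall f f', ebs f = ebs f' -> ebr f = ebr f' -> f = f';
  eb_surj : forall s r, es_rng s = er_src r -> exists2 f, ebs f = s & ebr f = r
}.

Definition elem_sym (E F : digraph) (D : elem_data E F) : elem_data F E :=
  ElemData (ebs_src D) (ebr_rng D) (eb_mid D) (@eb_inj _ _ D) (@eb_surj _ _ D)
    (ear_src D) (eas_rng D) (ea_mid D) (@ea_inj _ _ D) (@ea_surj _ _ D).

Definition sublin (R : pzRingType) (V : lmodType R) (S : submodule V)
    (f : V -> V) (fl : linear f) (fS : forall x, S x -> S (f x)) :
  {linear subm S -> subm S}.
Proof.
apply: (@mklin R (subm S) (subm S) (fun x => mksub (fS _ (submP x)))).
by move=> a x y; apply: val_inj; rewrite /= fl.
Defined.

Lemma fct_linE (I : Type) (R : pzRingType) (V : lmodType R) (a : R)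
  (x y : I -> V) i : (a *: x + y) i = a *: x i + y i.
Proof. by []. Qed.

Section Elementary.
Variables (K : fieldType) (E F : digraph) (D : elem_data E F).

Section PathOperators.
Variables (M : lmodType K) (rho : leavitt_rep E M).

(** The operator of the edge with factors r and s. By [ea_inj] the sum has at most one term, and it
    is zero for a pair that is not composable, so no edge has to be chosen. *)
Definition pe (r : er D) (s : es D) (x : M) : M :=
  \sum_(e | (ear D e == r) && (eas D e == s)) re rho e x.

Definition pg (r : er D) (s : es D) (x : M) : M :=
  \sum_(e | (ear D e == r) && (eas D e == s)) rg rho e x.

Lemma pe_linear r s : linear (pe r s).
Proof.
move=> a x y; rewrite /pe scaler_sumr -big_split; apply: eq_bigr => e _.
by rewrite linearP.
Qed.

Lemma pg_linear r s : linear (pg r s).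
Proof.
move=> a x y; rewrite /pg scaler_sumr -big_split; apply: eq_bigr => e _.
by rewrite linearP.
Qed.

Lemma pe0 r s : pe r s 0 = 0.
Proof. by rewrite /pe big1 // => e _; rewrite linear0. Qed.

Lemma pg0 r s : pg r s 0 = 0.
Proof. by rewrite /pg big1 // => e _; rewrite linear0. Qed.

Lemma ea_pred1 e : (fun e' => (ear D e' == ear D e) && (eas D e' == eas D e))
  =1 pred1 e.
Proof.
move=> e' /=; apply/andP/eqP => [[/eqP rr /eqP ss]|->]; last by rewrite !eqxx.
exact: ea_inj rr ss.
Qed.

Lemma peE e x : pe (ear D e) (eas D e) x = re rho e x.
Proof. by rewrite /pe (big_pred1 e) //; apply: ea_pred1. Qed.

Lemma pgE e x : pg (ear D e) (eas D e) x = rg rho e x.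
Proof. by rewrite /pg (big_pred1 e) //; apply: ea_pred1. Qed.

Lemma pe_nil r s x : er_rng r != es_src s -> pe r s x = 0.
Proof.
move=> rs; rewrite /pe big_pred0 // => e; apply/negP => /andP[/eqP re /eqP se].
by case/negP: rs; rewrite -re -se ea_mid.
Qed.

Lemma pg_nil r s x : er_rng r != es_src s -> pg r s x = 0.
Proof.
move=> rs; rewrite /pg big_pred0 // => e; apply/negP => /andP[/eqP re /eqP se].
by case/negP: rs; rewrite -re -se ea_mid.
Qed.

Lemma pe_rng v r s x :
  rv rho v (pe r s x) = if v == es_rng s then pe r s x else 0.
Proof.
have [rs|rs] := eqVneq (er_rng r) (es_src s); last first.
  by rewrite pe_nil // linear0 if_same.
by have [e <- <-] := ea_surj rs; rewrite peE re_rng_eq eas_rng.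
Qed.

Lemma pe_src v r s x :
  pe r s (rv rho v x) = if v == er_src r then pe r s x else 0.
Proof.
have [rs|rs] := eqVneq (er_rng r) (es_src s); last first.
  by rewrite !pe_nil // if_same.
by have [e <- <-] := ea_surj rs; rewrite !peE re_src_eq ear_src.
Qed.

Lemma pg_src v r s x :
  rv rho v (pg r s x) = if v == er_src r then pg r s x else 0.
Proof.
have [rs|rs] := eqVneq (er_rng r) (es_src s); last first.
  by rewrite pg_nil // linear0 if_same.
by have [e <- <-] := ea_surj rs; rewrite pgE rg_src_eq ear_src.
Qed.

Lemma pge r s r' s' x : pe r' s' (pg r s x) =
  if [&& r == r', s == s' & er_rng r == es_src s] then rv rho (es_rng s) x
  else 0.
Proof.
have [rs|rs] := eqVneq (er_rng r) (es_src s); last first.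
  by rewrite pg_nil // pe0 !andbF.
have [rs'|rs'] := eqVneq (er_rng r') (es_src s'); last first.
  rewrite pe_nil //; case: and3P => // -[/eqP rr /eqP ss _].
  by move: rs'; rewrite -rr -ss rs eqxx.
have [e <- <-] := ea_surj rs; have [e' <- <-] := ea_surj rs'.
by rewrite pgE peE rge eas_rng andbT; have /= -> := ea_pred1 e' e.
Qed.

Lemma peg r s x : pg r s (pe r s x) =
  \sum_(e | (ear D e == r) && (eas D e == s)) rg rho e (re rho e x).
Proof.
have [rs|rs] := eqVneq (er_rng r) (es_src s); last first.
  rewrite pg_nil // big_pred0 // => e; apply/negP => /andP[/eqP re /eqP se].
  by case/negP: rs; rewrite -re -se ea_mid.
have [e <- <-] := ea_surj rs.
by rewrite pgE peE (big_pred1 e) //; apply: ea_pred1.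
Qed.

Lemma sum_peg x : \sum_r \sum_s pg r s (pe r s x) = x.
Proof.
rewrite -[RHS](reg rho) (partition_big (ear D) xpredT) //=.
apply: eq_bigr => r _; rewrite (partition_big (eas D) xpredT) //=.
by apply: eq_bigr => s _; rewrite peg.
Qed.

Lemma sum_peg_src v x :
  \sum_(r | er_src r == v) \sum_s pg r s (pe r s x) = rv rho v x.
Proof.
rewrite -[RHS](sum_peg) big_mkcond; apply: eq_bigr => r _.
case: eqP => [<-|/eqP rv]; last first.
  by rewrite big1 // => s _; rewrite pe_src eq_sym (negbTE rv) pg0.
by apply: eq_bigr => s _; rewrite pe_src eqxx.
Qed.

(** The module SM. The coordinate at [s] lies in the component of M at the end of [s] and plays the
    part of the product of the family with [s]. *)
Program Definition elem_sub : submodule [the lmodType K of (es D -> M)] :=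
  @Submodule K [the lmodType K of (es D -> M)]
    (fun x : (es D -> M) => forall s, rv rho (es_rng s) (x s) = x s) _ _.
Next Obligation. by move=> s; apply: linear0. Qed.
Next Obligation. by move=> a x y Sx Sy s; rewrite fct_linE linearP Sx Sy. Qed.

Lemma elem_subP (x : subm elem_sub) s : rv rho (es_rng s) (val x s) = val x s.
Proof. exact: (submP x). Qed.

Definition nv (v : vert F) (x : (es D -> M)) : (es D -> M) :=
  (fun s => if es_src s == v then x s else 0).

(** For f = s0 r, multiplying by f and then by s amounts to multiplying by s0 and then by the edge r
    s of E. Conversely the ghost [ng] gathers in coordinate s0 the ghosts of all edges r s'. *)
Definition ne (f : edge F) (x : (es D -> M)) : (es D -> M) :=
  (fun s => pe (ebr D f) s (x (ebs D f))).

Definition ng (f : edge F) (x : (es D -> M)) : (es D -> M) :=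
  (fun s => if s == ebs D f then \sum_s' pg (ebr D f) s' (x s') else 0).

Lemma nv_linear v : linear (nv v).
Proof.
move=> a x y; apply/funext => s; rewrite [RHS]fct_linE /nv.
by case: ifP => // _; rewrite scaler0 addr0.
Qed.

Lemma ne_linear f : linear (ne f).
Proof. by move=> a x y; apply/funext => s; exact: pe_linear. Qed.

Lemma ng_linear f : linear (ng f).
Proof.
move=> a x y; apply/funext => s; rewrite [RHS]fct_linE /ng.
case: ifP => // _; last by rewrite scaler0 addr0.
rewrite scaler_sumr -big_split; apply: eq_bigr => s' _.
by rewrite fct_linE pg_linear.
Qed.

Lemma nv_sub v x : elem_sub x -> elem_sub (nv v x).
Proof.
by move=> Sx s; rewrite /= /nv; case: ifP => // _; rewrite linear0.
Qed.

Lemma ne_sub f x : elem_sub x -> elem_sub (ne f x).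
Proof. by move=> Sx s; rewrite /= /nv /ne /ng /= pe_rng eqxx. Qed.

Lemma ng_sub f x : elem_sub x -> elem_sub (ng f x).
Proof.
move=> Sx s; rewrite /= /ng; case: ifP => [/eqP ->|_]; last by rewrite linear0.
rewrite linear_sum; apply: eq_bigr => s' _.
by rewrite pg_src eb_mid eqxx.
Qed.

Program Definition elem_rep : leavitt_rep F (subm elem_sub) :=
  @LeavittRep K F (subm elem_sub) (fun v => sublin (nv_linear v) (@nv_sub v))
    (fun f => sublin (ne_linear f) (@ne_sub f))
    (fun f => sublin (ng_linear f) (@ng_sub f)) _ _ _ _ _ _ _ _.
Next Obligation.
move=> v w x; apply: val_inj; apply/funext => s /=; rewrite /= /nv /ne /ng /=.
case: (eqVneq v w) => [->|vw]; rewrite /= /nv; first by case: (es_src s == w).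
by case: eqP => // ->; rewrite eq_sym (negbTE vw).
Qed.
Next Obligation.
move=> x; apply: val_inj; rewrite raddf_sum; apply/funext => s.
rewrite fct_sumE (bigD1 (es_src s)) //= /nv /ne /ng /= eqxx big1 ?addr0 // => v
  sv.
by rewrite /= /nv /ne /ng /= eq_sym (negbTE sv).
Qed.
Next Obligation.
move=> f x; apply: val_inj; apply/funext => s /=.
by rewrite /= /nv /ne /ng /= ebs_src eqxx.
Qed.
Next Obligation.
move=> f x; apply: val_inj; apply/funext => s /=; rewrite /= /nv /ne /ng /=.
by case: eqP => // /eqP sf; rewrite pe_nil // ebr_rng eq_sym.
Qed.
Next Obligation.
move=> f x; apply: val_inj; apply/funext => s /=; rewrite /= /nv /ne /ng /=.
case: ifP => // _; apply: eq_bigr => s' _; rewrite /= /nv /ne /ng /=.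
by case: eqP => // /eqP sf; rewrite !pg_nil // ebr_rng eq_sym.
Qed.
Next Obligation.
move=> f x; apply: val_inj; apply/funext => s /=; rewrite /= /nv /ne /ng /=.
by case: (eqVneq s) => [->|]; rewrite ?ebs_src ?eqxx ?if_same.
Qed.
Next Obligation.
move=> f f' x; apply: val_inj; apply/funext => s /=; rewrite /= /nv /ne /ng /=.
case: (eqVneq (ebs D f') (ebs D f)) => [bs|bs]; last first.
  rewrite pe0; case: eqP => [ff|_] //.
  by rewrite ff eqxx in bs.
rewrite /pe.
rewrite -[LHS]/(pe _ _ _) (@big_morph _ _ (pe (ebr D f') s) 0 +%R 0 +%R);
  last exact: pe0; last first.
  by move=> y z; have := pe_linear (ebr D f') s 1 y z; rewrite !scale1r.
rewrite (bigD1 s) //= pge big1 ?addr0 => [|s' ss]; last first.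
  by rewrite pge (negbTE ss) andbF.
rewrite eqxx /= elem_subP.
case: (eqVneq f f') => [<-|ff]; last first.
  case: eqP => [br|] //.
  by case/eqP: ff; exact: eb_inj (esym bs) br.
by rewrite eqxx /= ebr_rng /= /nv /ne /ng /= eq_sym.
Qed.
Next Obligation.
move=> x; apply: val_inj; rewrite raddf_sum; apply/funext => s.
(* The coordinate at [s] sits at the end of [s], where the edges r s' with r starting there
   decompose it; the pairs (s, r) that occur are exactly the edges of F with first factor [s]. *)
rewrite fct_sumE -[RHS]elem_subP -sum_peg_src.
under eq_bigr => f _ do rewrite /= /nv /ne /ng /=.
rewrite -big_mkcond /=.
rewrite (partition_big (ebr D) (fun r => er_src r == es_rng s)) /=; last first.
  by move=> f /eqP ->; rewrite eb_mid.
apply: eq_bigr => r /eqP rs.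
have [f fs fr] := eb_surj (esym rs).
rewrite (big_pred1 f) => [|f' /=]; last first.
  rewrite -fs -fr [ebs D f == _]eq_sym; apply/andP/eqP =>
    [[/eqP ss /eqP rr]|->] //.
  exact: eb_inj ss rr.
by apply: eq_bigr => s' _; rewrite /= /nv /ne /ng /= fs fr.
Qed.

End PathOperators.

(** The offset [d] provides for the shift by one that the two mutually inverse functors produce
    together. *)
Lemma elem_decomposition (M : grep K E) (d : int) :
  is_decomposition (fun n (x : subm (elem_sub (gr_rep M))) =>
    forall s, grc M (n + d) (val x s)).
Proof.
pose pr := proj (gr_dec M).
have prS n (x : subm (elem_sub (gr_rep M))) :
    elem_sub (gr_rep M) (fun s => pr (n + d) (val x s)).
  move=> s; rewrite -[in RHS](elem_subP x s).
  apply/esym/graded_map_proj0 => [y z|k y]; first by rewrite linearB.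
  exact: gr_v.
apply: (@projections_decomposition _ _ (fun n x => mksub (prS n x))).
split.
- by move=> n x s; apply: proj_comp.
- by move=> n x y; apply: val_inj; apply/funext => s; exact: projB.
- by move=> n x nx; apply: val_inj; apply/funext => s; exact: proj_id.
- move=> n m x mn mx; apply: val_inj; apply/funext => s.
  by apply: (proj_ne (gr_dec M) _ (mx s)); rewrite (inj_eq (addIr d)).
- move=> x.
  have /boolp.choice [t tP] s : exists t : seq int, uniq t /\
      forall u : seq int, uniq u -> {subset t <= u} ->
      val x s = \sum_(n <- u) pr n (val x s) /\
      forall n, n \notin u -> pr n (val x s) = 0.
    by have [t ut tP] := proj_sumE (gr_dec M) (val x s); exists t.
  (* Each coordinate has its own finite support; since [es D] is finite, their union is a finite
     support for the family. *)
  pose u0 := undup (flatten [seq t s | s : es D]).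
  pose u := [seq n - d | n <- u0].
  have uu : uniq u0 by rewrite undup_uniq.
  have tu s : {subset t s <= u0}.
    move=> n ns; rewrite mem_undup; apply/flatten_mapP; exists s => //.
    by rewrite mem_enum.
  have addNI : injective (fun k : int => k - d) by exact: addIr.
  exists u; first by rewrite map_inj_uniq.
  split=> [n nu|]; apply: val_inj.
    apply/funext => s; have [_ xP] := tP s.
    have [_ x0] := xP u0 uu (tu s); apply: x0.
    by apply: contra nu => nu0; apply/mapP; exists (n + d); rewrite ?addrK.
  rewrite raddf_sum; apply/funext => s; rewrite fct_sumE big_map.
  have [_ xP] := tP s; have [xE _] := xP u0 uu (tu s).
  by rewrite {1}xE; apply: eq_bigr => n _;
    rewrite -[RHS]/(pr (n - d + d) (val x s)) subrK.
Qed.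

End Elementary.

Section ElementaryEquivalence.
Variable K : fieldType.

(** The homogeneous projections commute with [f], hence with its inverse, which therefore preserves
    degrees. *)
Program Definition rhom_inv (E : digraph) (M N : grep K E) (f : rhom M N)
    (g : N -> M) (fK : cancel f g) (gK : cancel g f) : rhom N M :=
  @RHom K E N M g _ _ _ _.
Next Obligation.
by move=> E M N f g fK gK a x y; apply: (can_inj fK); rewrite rh_lin !gK.
Qed.
Next Obligation.
by move=> E M N f g fK gK v x; apply: (can_inj fK); rewrite rh_v !gK.
Qed.
Next Obligation.
by move=> E M N f g fK gK e x; apply: (can_inj fK); rewrite rh_e !gK.
Qed.
Next Obligation.
move=> E M N f g fK gK n x nx.
have <- : proj (gr_dec M) n (g x) = g x; last exact: proj_comp.
apply: (can_inj fK); rewrite gK -(graded_map_proj0 _ (gr_dec N)) ?gK ?proj_id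
  //.
  exact: rhomB.
exact: rh_deg.
Qed.

Section ElemFunctor.
Variables (E F : digraph) (D : elem_data E F) (d : int).

Program Definition elem_grep (M : grep K E) : grep K F :=
  @GRep K F (subm (elem_sub D (gr_rep M))) (elem_rep D (gr_rep M))
    (fun n x => forall s, grc M (n + d) (val x s)) _ _ _ _ _.
Next Obligation. by move=> M; apply: elem_decomposition. Qed.
Next Obligation.
move=> M n a x nx s; rewrite -[\val _ s]/(a *: val x s).
exact: gr_scale (nx s).
Qed.
Next Obligation.
move=> M n v x nx s; rewrite /= /nv /ne /ng /=; case: ifP => _.
  exact: (nx s).
exact: (decomp0 (gr_dec M)).
Qed.
Next Obligation.
move=> M n f x nx s; rewrite /= /nv /ne /ng /= addrAC.
by apply: (decomp_sum (gr_dec M)) => e _; apply: gr_e; apply: (nx (ebs D f)).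
Qed.
Next Obligation.
move=> M n f x nx s; rewrite /= /nv /ne /ng /= addrAC.
case: ifP => _; last exact: (decomp0 (gr_dec M)).
apply: (decomp_sum (gr_dec M)) => s' _.
by apply: (decomp_sum (gr_dec M)) => e _; apply: gr_g; apply: (nx s').
Qed.

Lemma rhom_pe (M N : grep K E) (f : rhom M N) (r : er D) (s : es D) x :
  f (pe (gr_rep M) r s x) = pe (gr_rep N) r s (f x).
Proof.
rewrite /pe (big_morph f (rhom_additive f) (rhom0 f)).
by apply: eq_bigr => e _; rewrite rh_e.
Qed.

Lemma elem_hom_sub (M N : grep K E) (f : rhom M N)
    (x : subm (elem_sub D (gr_rep M))) :
  elem_sub D (gr_rep N) (fun s => f (val x s)).
Proof. by move=> s; rewrite -rh_v elem_subP. Qed.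

Program Definition elem_hom (M N : grep K E) (f : rhom M N) :
    rhom (elem_grep M) (elem_grep N) :=
  @RHom K F (elem_grep M) (elem_grep N) (fun x => mksub (elem_hom_sub f x))
    _ _ _ _.
Next Obligation.
move=> M N f a x y; apply: val_inj; apply/funext => s.
exact: rh_lin.
Qed.
Next Obligation.
move=> M N f v x; apply: val_inj; apply/funext => s.
by rewrite /= /nv /ne /ng /=; case: ifP => // _; rewrite rhom0.
Qed.
Next Obligation.
move=> M N f v x; apply: val_inj; apply/funext => s.
by rewrite /= /nv /ne /ng /= rhom_pe.
Qed.
Next Obligation. by move=> M N f n x nx s; apply: rh_deg. Qed.

Program Definition elem_functor : functor (RepZ K E) (RepZ K F) :=
  @Functor (RepZ K E) (RepZ K F) elem_grep elem_hom _ _.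
Next Obligation.
move=> M; apply: rhom_ext => x; apply: val_inj; apply/funext => s.
by [].
Qed.
Next Obligation.
move=> M N P f g; apply: rhom_ext => x; apply: val_inj; apply/funext => s.
by [].
Qed.

(** The two composites use the degrees [n + d + j] and [n + j + d]: their objects have equal, but
    not convertible, degree predicates. *)
Lemma elem_zfunctor : zfunctor elem_functor.
Proof.
move=> j.
have cc (X : grep K E) : (fun n (x : subm (elem_sub D (gr_rep X))) =>
    forall s, grc X (n + d + j) (val x s))
    = (fun n x => forall s, grc X (n + j + d) (val x s)).
  by apply/funext => n; rewrite addrAC.
have FG X : comp_functor elem_functor (zshift (RepZ K E) j) X
    = comp_functor (zshift (RepZ K F) j) elem_functor X by exact: grep_eq (cc
      X).
apply: (@functor_eq _ _ _ _ FG) => X Y f.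
apply: rhom_ext => x /=; rewrite (grep_castE _ (cc X)).
by apply: val_inj; rewrite (grep_castE _ (cc Y)).
Qed.

End ElemFunctor.

Section ElemUnit.
Variables (E F : digraph) (D : elem_data E F) (d d' : int).
Hypothesis dd' : d' + d = 1.
Notation G := (comp_functor (elem_functor (elem_sym D) d') (elem_functor D d)).

Lemma elem_sym_pe (M : grep K E) (s0 : es D) r z s :
  val (@pe K F E (elem_sym D) _ (elem_rep D (gr_rep M)) s0 r z) s
  = if es_rng s0 == er_src r then pe (gr_rep M) r s (val z s0) else 0.
Proof.
have [sr|sr] := eqVneq; last by rewrite pe_nil.
have [f fs fr] := eb_surj sr.
rewrite -[s0 in LHS]fs -[r in LHS]fr -[ebs D f]/(ear (elem_sym D) f).
by rewrite -[ebr D f]/(eas (elem_sym D) f) peE /= /ne /= fs fr.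
Qed.

Lemma elem_unit_sub1 (M : grep K E) x (r : er D) :
  elem_sub D (gr_rep M) (fun s => pe (gr_rep M) r s x).
Proof. by move=> s; rewrite pe_rng eqxx. Qed.

Lemma elem_unit_sub2 (M : grep K E) x :
  elem_sub (elem_sym D) (elem_rep D (gr_rep M))
    (fun r => mksub (elem_unit_sub1 x r)).
Proof.
move=> r; apply: val_inj; apply/funext => s; rewrite /= /nv /ne /ng /=.
by case: eqP => // /eqP rs; rewrite pe_nil // eq_sym.
Qed.

(** The coordinates of [x] in RSM are its products with the edges r s. An edge raises degrees by
    one, which is the origin of the condition [d' + d = 1]. *)
Definition elem_unit_fun (M : grep K E) (x : M) : G M :=
  mksub (elem_unit_sub2 x).

Lemma elem_unitE (M : grep K E) (x : M) r s :
  val (val (elem_unit_fun x) r) s = pe (gr_rep M) r s x.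
Proof. by []. Qed.

Lemma elem_ext (M : grep K E) (y z : G M) :
  (forall r s, val (val y r) s = val (val z r) s) -> y = z.
Proof.
move=> yz; apply: val_inj; apply/funext => r; apply: val_inj; apply/funext => s.
exact: yz.
Qed.

Program Definition elem_unit (M : grep K E) : rhom M (G M) :=
  @RHom K E M (G M) (@elem_unit_fun M) _ _ _ _.
Next Obligation.
move=> M a x y; apply: elem_ext => r s; rewrite elem_unitE pe_linear.
by rewrite /= /nv /ne /ng /=.
Qed.
Next Obligation.
move=> M v x; apply: elem_ext => r s;
  rewrite elem_unitE pe_src /= /nv /ne /ng /=.
by rewrite eq_sym; case: eqP => //= _; rewrite //=.
Qed.
Next Obligation.
move=> M e x; apply: elem_ext => r s; rewrite elem_unitE /= /nv /ne /ng /=.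
rewrite [RHS]elem_sym_pe /= /nv /ne /ng /= peE eas_rng.
case: eqP => // /eqP er; rewrite -re_rng pe_src (negbTE er) //.
Qed.
Next Obligation.
move=> M n x nx r s; rewrite elem_unitE -addrA dd'.
by apply: (decomp_sum (gr_dec M)) => e _; apply: gr_e.
Qed.

Definition elem_counit (M : grep K E) (y : G M) : M :=
  \sum_r \sum_s pg (gr_rep M) r s (val (val y r) s).

Lemma elem_unitK (M : grep K E) : cancel (elem_unit M) (@elem_counit M).
Proof.
move=> x; rewrite -[RHS](sum_peg D (gr_rep M)); apply: eq_bigr => r _.
by apply: eq_bigr => s _; rewrite elem_unitE.
Qed.

Lemma elem_counitK (M : grep K E) : cancel (@elem_counit M) (elem_unit M).
Proof.
move=> y; apply: elem_ext => r s; rewrite elem_unitE /elem_counit.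
have peD : {morph pe (gr_rep M) r s : u v / u + v}.
  by move=> u v; have := pe_linear (gr_rep M) r s 1 u v; rewrite !scale1r.
rewrite (big_morph _ peD (pe0 _ r s)) (bigD1 r) //=.
rewrite (big_morph _ peD (pe0 _ r s)) (bigD1 s) //= pge !eqxx elem_subP /=.
rewrite big1 => [|s' ss]; last by rewrite pge (negbTE ss) andbF.
rewrite big1 => [|r' rr]; last first.
  rewrite (big_morph _ peD (pe0 _ r s)) big1 // => s' _.
  by rewrite pge (negbTE rr).
(* For a pair that is not composable both sides vanish, the right one because the coordinate of [y]
   at [r] is supported at the end of [r]. *)
rewrite !addr0; case: eqP => // /eqP rs.
by rewrite -[val y r](elem_subP y r) /= /nv eq_sym (negbTE rs).
Qed.

Lemma elem_natiso : naturally_isomorphic G (id_functor (RepZ K E)).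
Proof.
exists (fun M => rhom_inv (@elem_unitK M) (@elem_counitK M)).
exists elem_unit; split=> [M N f|M|M]; apply: rhom_ext => x.
- apply: (can_inj (@elem_unitK N)); rewrite [LHS]elem_counitK.
  apply: elem_ext => r s; rewrite elem_unitE /= /nv /ne /ng /=.
  rewrite -rhom_pe -(elem_unitE (elem_counit x)).
  by rewrite [elem_unit_fun _]elem_counitK.
- exact: elem_counitK.
- exact: elem_unitK.
Qed.

End ElemUnit.

Lemma zequivalent_elem (E F : digraph) (D : elem_data E F) :
  zequivalent (RepZ K E) (RepZ K F).
Proof.
exists (elem_functor D 0), (elem_functor (elem_sym D) 1); split.
- exact: elem_zfunctor.
- exact: elem_zfunctor.
- exact: elem_natiso.
(* Destructing [D] makes [elem_sym (elem_sym D)] convertible to [D]. *)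
- by have := @elem_natiso F E (elem_sym D) 1 0 (add0r 1); case: {+}D.
Qed.

End ElementaryEquivalence.

(** * Splittings and strong shift equivalence *)

Section Splittings.
Variables (K : fieldType) (E : digraph) (endp : edge E -> vert E).
Variable P : fibre_partition endp.

Lemma block_endp v (i : 'I_(blocks P v)) e : e \in block i -> endp e = v.
Proof.
move=> ei; have : e \in \bigcup_(i < blocks P v) block i.
  by apply/bigcupP; exists i.
by rewrite block_cover inE => /eqP.
Qed.

Lemma block_ex e : exists i : 'I_(blocks P (endp e)), e \in block i.
Proof.
have : e \in \bigcup_(i < blocks P (endp e)) block i.
  by rewrite block_cover inE.
by move/bigcupP => [i _ ei]; exists i.
Qed.

Definition block_of e : 'I_(blocks P (endp e)) := xchoose (block_ex e).

Lemma mem_block_of e : e \in block (block_of e).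
Proof. exact: xchooseP (block_ex e). Qed.

End Splittings.

(** R has an arrow from v to each v^i, and S has e from s(e)^i to r(e), where i is the block of e.
    Then e factors as the arrow to s(e)^i followed by e, and e^j as e followed by the arrow to
    r(e)^j. *)
Lemma out_split_elem E F : out_splitting E F -> inhabited (elem_data E F).
Proof.
move=> [P [fv [fe [[gv fvK gvK] [ge feK geK] fsrc frng]]]].
pose b e : {v & 'I_(blocks P v)} := Tagged _ (block_of P e).
split; apply: (@ElemData E F {v & 'I_(blocks P v)} (edge E)
  (fun r => tag r) fv (fun e => fv (b e)) (@rng E) b id (fun f => tag (ge f))
  (fun f => Tagged (fun v => 'I_(blocks P v)) (tagged (ge f)))) => //=.
- by move=> r s /(can_inj fvK) ->; exists s.
- move=> f; rewrite -[in RHS](geK f); case: (ge f) => e j /=.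
  by rewrite (fsrc e j _ (mem_block_of P e)).
- move=> f; rewrite -[in RHS](geK f); case: (ge f) => e j /=.
  by rewrite frng.
- move=> f f' ff ff'; apply: (can_inj geK); move: ff ff'.
  case: (ge f) (ge f') => [e j] [e' j'] /= ee; subst e' => /eqP.
  by rewrite eq_Tagged => /eqP /= ->.
- move=> e [v j] /= ev; subst v.
  by exists (fe (Tagged (fun e => 'I_(blocks P (rng e))) j)); rewrite feK.
Qed.

(** Dually, R has e from s(e) to r(e)_i, where i is the block of e, and S has an arrow from each v_j
    to v. Then e_j factors as the arrow from s(e)_j followed by e. *)
Lemma in_split_elem E F : in_splitting E F -> inhabited (elem_data E F).
Proof.
move=> [P [fv [fe [[gv fvK gvK] [ge feK geK] fsrc frng]]]].
pose b e : {v & 'I_(blocks P v)} := Tagged _ (block_of P e).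
split; apply: (@ElemData E F (edge E) {v & 'I_(blocks P v)}
  (@src E) (fun e => fv (b e)) fv (fun r => tag r) id b
  (fun f => Tagged (fun v => 'I_(blocks P v)) (tagged (ge f)))
  (fun f => tag (ge f))) => //=.
- by move=> r s /(can_inj fvK) <-; exists r.
- move=> f; rewrite -[in RHS](geK f); case: (ge f) => e j /=.
  by rewrite fsrc.
- move=> f; rewrite -[in RHS](geK f); case: (ge f) => e j /=.
  by rewrite (frng e j _ (mem_block_of P e)).
- move=> f f' ff ff'; apply: (can_inj geK); move: ff ff'.
  case: (ge f) (ge f') => [e j] [e' j'] /= /[swap] ee; subst e' => /eqP.
  by rewrite eq_Tagged => /eqP /= ->.
- move=> [v j] e /= ev; subst v.
  by exists (fe (Tagged (fun e => 'I_(blocks P (src e))) j)); rewrite feK.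
Qed.

(** The vertex v^i emits the copies of any edge in its nonempty block, and every edge has a copy
    because its range has at least one block. *)
Lemma out_split_sinkless E F : out_splitting E F -> no_sinks F.
Proof.
move=> [P [fv [fe [[gv fvK gvK] _ fsrc _]]]] v'.
rewrite -(gvK v'); case: (gv v') => v i.
have /set0Pn [e ei] := block_neq0 i.
have ev := block_endp ei; subst v.
exists (fe (Tagged (fun e =>
  'I_(blocks P (rng e))) (Ordinal (blocks_gt0 P (rng e))))).
exact: fsrc.
Qed.

Lemma in_split_sinkless E F : no_sinks E -> in_splitting E F -> no_sinks F.
Proof.
move=> sE [P [fv [fe [[gv fvK gvK] _ fsrc _]]]] v'.
rewrite -(gvK v'); case: (gv v') => v i.
have [e ev] := sE v; subst v.
exists (fe (Tagged (fun e => 'I_(blocks P (src e))) i)).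
exact: fsrc.
Qed.

Lemma fibre_bijection (X Y Z : finType) (p : X -> Z) (q : Y -> Z) :
  (forall z, #|[set x | p x == z]| = #|[set y | q y == z]|) ->
  exists f : X -> Y,
    [/\ injective f, forall x, q (f x) = p x & forall y, exists x, f x = y].
Proof.
move=> pq.
pose A z := enum [set x | p x == z]; pose B z := enum [set y | q y == z].
have AB z : size (A z) = size (B z) by rewrite -!cardE.
have memA x : x \in A (p x) by rewrite mem_enum inE.
(* If [Y] is empty there is no default element for [nth], but then all fibres are empty and so is
   [X]. *)
case: (pickP (xpredT : pred Y)) => [y0 _|Y0]; last first.
  have X0 (x : X) : False.
    have := memA x; rewrite -index_mem AB.
    by case: (B _) => [|y] //; have := Y0 y.
  exists (fun x => match X0 x with end).
  by split=> [x|x|y]; [case: (X0 x) | case: (X0 x) | have := Y0 y].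
pose f x := nth y0 (B (p x)) (index x (A (p x))).
have fB x : f x \in B (p x) by rewrite mem_nth // -AB index_mem.
have qf x : q (f x) = p x by have := fB x; rewrite mem_enum inE => /eqP.
have fI : injective f.
  move=> x x' ff; have pp : p x = p x' by rewrite -!qf ff.
  move/eqP: ff; rewrite /f -pp nth_uniq ?enum_uniq // -?AB ?index_mem //.
    by move/eqP/(congr1 (nth x (A (p x)))); rewrite !nth_index // pp.
  by rewrite pp.
exists f; split=> // y.
have card_fib (T : finType) (g : T -> Z) : #|T| = \sum_z #|[set t | g t == z]|.
  rewrite -sum1_card (partition_big g xpredT) //=; apply: eq_bigr => z _.
  by rewrite -sum1_card; apply: eq_bigl => t; rewrite inE.
have [g _ gK] : bijective f.
  apply: inj_card_bij fI _; rewrite (card_fib X p) (card_fib Y q).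
  by rewrite (eq_bigr _ (fun z _ => pq z)).
by exists (g y).
Qed.

(** * Matrix factorizations as bipartite graphs *)

Section Matrices.
Variable K : fieldType.

(** Equal counts over each pair of ends give a bijection between edges and composable pairs. Edges
    with the same ends are interchangeable, so any bijection respecting the ends will do. *)
Lemma composite_edges (I J I' X er es : finType) (rs : er -> I) (rt : er -> J)
    (ss : es -> J) (st : es -> I') (xs : X -> I) (xt : X -> I') :
  (forall i i', #|[set x | (xs x == i) && (xt x == i')]| =
     (\sum_k #|[set r | (rs r == i) && (rt r == k)]|
              * #|[set s | (ss s == k) && (st s == i')]|)%N) ->
  exists (a : X -> er) (b : X -> es),
    [/\ forall x, rs (a x) = xs x, forall x, st (b x) = xt x,
        forall x, rt (a x) = ss (b x),
        forall x x', a x = a x' -> b x = b x' -> x = x'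
      & forall r s, rt r = ss s -> exists2 x, a x = r & b x = s].
Proof.
move=> count.
pose Y := {u : er * es | rt u.1 == ss u.2}.
pose q (y : Y) := (rs (val y).1, st (val y).2).
have [|f [fI qf fS]] := @fibre_bijection X Y (I * I')%type
    (fun x => (xs x, xt x)) q.
  move=> [i i']; transitivity #|[set x | (xs x == i) && (xt x == i')]|.
    by apply: eq_card => x; rewrite !inE xpair_eqE.
  rewrite count -(card_imset _ val_inj).
  set C := imset _ _.
  have -> : C = [set u | [&& rs u.1 == i, st u.2 == i' & rt u.1 == ss u.2]].
    apply/setP => u; rewrite inE; apply/imsetP/and3P => [[y + ->]|[ui ui' uP]].
      by rewrite inE xpair_eqE => /andP[-> ->]; split=> //; apply: (valP y).
    by exists (exist _ u uP); rewrite // inE xpair_eqE /= ui ui'.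
  rewrite -[RHS]sum1_card (partition_big (fun u : er * es =>
    rt u.1) xpredT) //=.
  apply: eq_bigr => k _; rewrite -cardsX -sum1_card; apply: eq_bigl => -[r s].
  rewrite !inE /= [ss s == k]eq_sym.
  case: (rs r == i); case: (st s == i') => //=; rewrite ?andbF //.
  by case: (eqVneq (rt r) k) => [->|]; rewrite ?andbF ?andbT.
exists (fun x => (val (f x)).1), (fun x => (val (f x)).2); split.
- by move=> x; have [] := qf x.
- by move=> x; have [] := qf x.
- by move=> x; apply/eqP; have := valP (f x).
- move=> x x' aa bb; apply/fI/val_inj.
  by case: (val (f x)) (val (f x')) aa bb => [? ?] [? ?] /= -> ->.
- move=> r s rs_mid; have rsP : rt (r, s).1 == ss (r, s).2 by apply/eqP.
  by have [x fx] := fS (exist _ (r, s) rsP); exists x; rewrite fx.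
Qed.

Lemma elem_of_counts (E F : digraph) (er es : finType)
    (rs : er -> vert E) (rt : er -> vert F) (ss : es -> vert F)
    (st : es -> vert E) :
  (forall i j, #|[set e : edge E | (src e == i) && (rng e == j)]| =
     (\sum_k #|[set r | (rs r == i) && (rt r == k)]|
              * #|[set s | (ss s == k) && (st s == j)]|)%N) ->
  (forall i j, #|[set e : edge F | (src e == i) && (rng e == j)]| =
     (\sum_k #|[set s | (ss s == i) && (st s == k)]|
              * #|[set r | (rs r == k) && (rt r == j)]|)%N) ->
  inhabited (elem_data E F).
Proof.
move=> /composite_edges[a [b [ars bst ab abI abS]]].
move=> /composite_edges[c [d [css drt cd cdI cdS]]].
by split; apply: (@ElemData E F er es rs rt ss st a b c d).
Qed.

Definition mxgraph m (A : 'M[nat]_m) : digraph :=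
  @Digraph 'I_m {ij : 'I_m * 'I_m & 'I_(A ij.1 ij.2)}
    (fun e => (tag e).1) (fun e => (tag e).2).

Lemma card_mxedges m n (A : 'M[nat]_(m, n)) i j :
  #|[set e : {ij : 'I_m * 'I_n & 'I_(A ij.1 ij.2)} |
      ((tag e).1 == i) && ((tag e).2 == j)]| = A i j.
Proof.
pose T (ij : 'I_m * 'I_n) := 'I_(A ij.1 ij.2).
have TI : injective (fun k : T (i, j) => Tagged T k).
  by move=> k k' /eqP; rewrite eq_Tagged => /eqP.
rewrite -[RHS]card_ord -cardsT -(card_imset _ TI); apply: eq_card => -[ij k].
rewrite inE /=; apply/andP/imsetP =>
  [[/eqP i1 /eqP i2]|[k' _ /(congr1 tag) /= ->]] //.
by case: ij k i1 i2 => i' j' k /= i1 i2; subst i' j'; exists k.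
Qed.

Lemma elem_of_elementary m n (A : 'M[nat]_m) (B : 'M[nat]_n) :
  elementary_shift_equiv A B -> inhabited (elem_data (mxgraph A) (mxgraph B)).
Proof.
move=> [R [S [AE BE]]].
apply: (@elem_of_counts (mxgraph A) (mxgraph B)
  {ij : 'I_m * 'I_n & 'I_(R ij.1 ij.2)} {ij : 'I_n * 'I_m & 'I_(S ij.1 ij.2)}
  (fun r => (tag r).1) (fun r => (tag r).2)
  (fun s => (tag s).1) (fun s => (tag s).2)) => i j.
  rewrite [LHS]card_mxedges AE mxE; apply: eq_bigr => k _.
  by rewrite !card_mxedges.
rewrite [LHS]card_mxedges BE mxE; apply: eq_bigr => k _.
by rewrite !card_mxedges.
Qed.

(** The factorization is A = A 1: [er] consists of the edges with renumbered range, [es] of the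
    renumbering of vertices. Elementary equivalence thus also covers the passage from a graph to its
    matrix. *)
Lemma elem_adjmx (E : digraph) : inhabited (elem_data E (mxgraph (adjmx E))).
Proof.
have [|f [fI qf fS]] := @fibre_bijection (edge (mxgraph (adjmx E))) (edge E)
    ('I_#|vert E| * 'I_#|vert E|)%type (fun e => tag e)
    (fun e => (enum_rank (src e), enum_rank (rng e))).
  move=> [i j]; rewrite -[LHS]/(#|[set e : edge (mxgraph (adjmx E)) | _]|).
  transitivity (adjmx E i j).
    rewrite -card_mxedges; apply: eq_card => e.
    by rewrite !inE; case: (tag e) => ? ?; rewrite xpair_eqE.
  rewrite mxE; apply: eq_card => e.
  by rewrite !inE xpair_eqE -!(inj_eq enum_val_inj) !enum_rankK.
have qf1 e : enum_rank (src (f e)) = (tag e).1 by have := congr1 fst (qf e).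
have qf2 e : enum_rank (rng (f e)) = (tag e).2 by have := congr1 snd (qf e).
split; apply: (@ElemData E (mxgraph (adjmx E)) (edge E) 'I_#|vert E|
  (@src E) (fun e => enum_rank (rng e)) id enum_val
  id (fun e => enum_rank (rng e)) (@src (mxgraph (adjmx E))) f) => //=.
- by move=> e; rewrite enum_rankK.
- by move=> r s rs; exists r.
- by move=> e; rewrite -qf1 enum_rankK.
- by move=> e e' _ /fI.
- move=> s r sr; have [e er] := fS r; exists e => //.
  by rewrite -qf1 er -sr enum_valK.
Qed.

Lemma zequivalent_sse m n (A : 'M[nat]_m) (B : 'M[nat]_n) :
  strong_shift_equiv A B ->
  zequivalent (RepZ K (mxgraph A)) (RepZ K (mxgraph B)).
Proof.
elim=> {m n A B}.
- by move=> m n A B /elem_of_elementary[D]; apply: zequivalent_elem D.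
- by move=> *; apply: zequivalent_refl.
- by move=> m n A B _; apply: zequivalent_sym.
- by move=> m n p A B C _ AB _; apply: zequivalent_trans.
Qed.

Lemma morita_of_rep (E F : digraph) : no_sinks E -> no_sinks F ->
  zequivalent (RepZ K E) (RepZ K F) ->
  graded_morita_equiv (leavitt K E) (leavitt K F).
Proof.
move=> sE sF EF; apply/graded_morita_zequivalent.
apply: zequivalent_trans (zequivalent_leavitt_rep K sE) _.
apply: zequivalent_trans EF _; apply: zequivalent_sym.
exact: zequivalent_leavitt_rep.
Qed.

Lemma morita_of_splitting (E F : digraph) : essential E ->
  in_splitting E F \/ out_splitting E F ->
  graded_morita_equiv (leavitt K E) (leavitt K F).
Proof.
move=> [sE _] EF.
have sF : no_sinks F.
  by case: EF => [/in_split_sinkless|/out_split_sinkless]; apply.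
apply: morita_of_rep => //.
by case: EF => [/in_split_elem|/out_split_elem] [D]; apply: zequivalent_elem D.
Qed.

Lemma morita_of_sse (E F : digraph) : essential E -> essential F ->
  strong_shift_equiv (adjmx E) (adjmx F) ->
  graded_morita_equiv (leavitt K E) (leavitt K F).
Proof.
move=> [sE _] [sF _] /zequivalent_sse EF; apply: morita_of_rep => //.
have [DE] := elem_adjmx E; have [DF] := elem_adjmx F.
apply: zequivalent_trans (zequivalent_elem K DE) _.
apply: zequivalent_trans EF _; apply: zequivalent_sym.
exact: zequivalent_elem DF.
Qed.

End Matrices.

(** * Graded equivalences *)

Section SubGraded.
Variables (R : graded_ring) (M : graded_module R) (S : submodule M).
Hypothesis Sproj : forall n x, S x -> S (proj (gm_decomposition M) n x).

Lemma sub_decomposition :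
  is_decomposition (fun n (x : subm S) => gm_comp M n (val x)).
Proof.
apply: (@projections_decomposition _ _ (fun n x => mksub (Sproj n (submP x)))).
split=> [n x|n x y|n x nx|n m x mn mx|x].
- exact: proj_comp.
- by apply: val_inj; apply: projB.
- by apply: val_inj; apply: proj_id.
- by apply: val_inj; apply: proj_ne mn mx.
- have [s us /(_ s us) [//|xE x0]] := proj_sumE (gm_decomposition M) (val x).
  exists s => //; split=> [n /x0 xn|]; apply: val_inj => //.
  by rewrite raddf_sum; exact: xE.
Qed.

Program Definition sub_module : graded_module R :=
  @GradedModule R (subm S) (fun n x => gm_comp M n (val x))
    sub_decomposition _.
Next Obligation. by move=> i j m r im jr; apply: (gm_compM im jr). Qed.

Program Definition sub_incl : graded_hom sub_module M :=
  @GradedHom R sub_module M val _ _.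

Program Definition sub_corestr (N : graded_module R) (f : graded_hom N M)
    (fS : forall x, S (f x)) : graded_hom N sub_module :=
  @GradedHom R N sub_module (fun x => mksub (fS x)) _ _.
Next Obligation.
by move=> N f fS a x y; apply: val_inj; rewrite /= gh_linear.
Qed.
Next Obligation. by move=> N f fS i x ix; apply: gh_degree. Qed.

End SubGraded.

Section ProdGraded.
Variables (R : graded_ring) (M N : graded_module R).

Lemma prod_decomposition : is_decomposition (fun n (x : (M * N)%type) =>
  gm_comp M n x.1 /\ gm_comp N n x.2).
Proof.
set dM := gm_decomposition M; set dN := gm_decomposition N.
apply: (@projections_decomposition _ _ (fun n x =>
  (proj dM n x.1, proj dN n x.2))).
split=> [n x|n x y|n [x y] [/= nx ny]|n m [x y] mn [/= mx my]|[x y]].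
- by split; apply: proj_comp.
- by congr pair; apply: projB.
- by rewrite !proj_id.
- by rewrite (proj_ne dM mn mx) (proj_ne dN mn my).
- have [s us sP] := proj_sumE dM x; have [t ut tP] := proj_sumE dN y.
  pose u := undup (s ++ t); have uu : uniq u by apply: undup_uniq.
  have [|xE x0] := sP u uu; first by move=> k ks; rewrite mem_undup mem_cat ks.
  have [|yE y0] := tP u uu.
    by move=> k ks; rewrite mem_undup mem_cat ks orbT.
  exists u => //; split=> [n nu|] /=; first by rewrite x0 // y0.
  apply: injective_projections.
    by rewrite [RHS](raddf_sum (@fst M N)) {1}xE.
  by rewrite [RHS](raddf_sum (@snd M N)) {1}yE.
Qed.

Program Definition prod_module : graded_module R :=
  @GradedModule R (M * N)%type (fun n x => gm_comp M n x.1 /\ gm_comp N n x.2)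
    prod_decomposition _.
Next Obligation.
by move=> i j m r [im im'] jr; split; apply: gm_compM.
Qed.

Program Definition prod_fst : graded_hom prod_module M :=
  @GradedHom R prod_module M fst _ _.
Next Obligation. by move=> i m []. Qed.

Program Definition prod_snd : graded_hom prod_module N :=
  @GradedHom R prod_module N snd _ _.
Next Obligation. by move=> i m []. Qed.

Program Definition prod_pair (X : graded_module R) (f : graded_hom X M)
    (g : graded_hom X N) : graded_hom X prod_module :=
  @GradedHom R X prod_module (fun x => (f x, g x)) _ _.
Next Obligation. by move=> X f g a x y; rewrite !gh_linear. Qed.
Next Obligation. by move=> X f g i x ix; split; apply: gh_degree. Qed.

Program Definition prod_copair (X : graded_module R) (f : graded_hom M X)
    (g : graded_hom N X) : graded_hom prod_module X :=
  @GradedHom R prod_module X (fun x => f x.1 + g x.2) _ _.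
Next Obligation.
by move=> X f g a x y; rewrite /= !gh_linear scalerDr addrACA.
Qed.
Next Obligation.
move=> X f g i x [ix iy]; apply: (decompD (gm_decomposition X));
  exact: gh_degree.
Qed.

End ProdGraded.

Section HomAdditive.
Variables (R : graded_ring) (M N : graded_module R).

Program Definition gh_zero : graded_hom M N :=
  @GradedHom R M N (fun=> 0) _ _.
Next Obligation. by move=> a x y; rewrite scaler0 addr0. Qed.
Next Obligation. by move=> i x _; apply: (decomp0 (gm_decomposition N)). Qed.

Program Definition gh_add (f g : graded_hom M N) : graded_hom M N :=
  @GradedHom R M N (fun x => f x + g x) _ _.
Next Obligation. by move=> f g a x y; rewrite !gh_linear scalerDr addrACA. Qed.
Next Obligation.
move=> f g i x ix; apply: (decompD (gm_decomposition N)); exact: gh_degree.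
Qed.

Lemma gh_bigE I (s : seq I) (P : pred I) (h : I -> graded_hom M N) x :
  (\big[gh_add/gh_zero]_(i <- s | P i) h i) x = \sum_(i <- s | P i) h i x.
Proof. exact: (big_morph (fun h : graded_hom M N => h x)). Qed.

Program Definition gh_inv (f : graded_hom M N) (g : N -> M)
    (fK : cancel f g) (gK : cancel g f) : graded_hom N M :=
  @GradedHom R N M g _ _.
Next Obligation.
by move=> f g fK gK a x y; apply: (can_inj fK); rewrite gh_linear !gK.
Qed.
Next Obligation.
move=> f g fK gK n x nx.
have <- : proj (gm_decomposition M) n (g x) = g x; last exact: proj_comp.
apply: (can_inj fK); rewrite gK -(graded_map_proj0 _ (gm_decomposition N)).
- by rewrite gK proj_id.
- exact: ghB.
- by move=> k y; apply: gh_degree.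
Qed.

End HomAdditive.

Section FullyFaithful.
Variables (C D : category) (F : functor C D) (G : functor D C).

Lemma equiv_faithful : naturally_isomorphic (comp_functor G F) (id_functor C) ->
  forall X Y (f g : mor X Y), fmap F f = fmap F g -> f = g.
Proof.
move=> [e [t [en te et]]] X Y f g fg.
have ef : compm f (e X) = compm g (e X) by rewrite -[LHS]en -[RHS]en /= fg.
by rewrite -[f]compm1 -[g]compm1 -[idm X]et !compmA ef.
Qed.

Lemma equiv_full : naturally_isomorphic (comp_functor G F) (id_functor C) ->
  (forall X Y (f g : mor X Y), fmap G f = fmap G g -> f = g) ->
  forall X Y (h : mor (F X) (F Y)), exists f, fmap F f = h.
Proof.
move=> [e [t [en te et]]] Gf X Y h.
(* The candidate is [fmap G h] conjugated by the isomorphisms; its image under [F] is compared with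
   [h] after applying the faithful [G]. *)
exists (compm (e Y) (compm (fmap G h) (t X))).
apply: Gf; set f := compm _ _.
have := en _ _ f; rewrite /= /f -!compmA te compm1 => fE.
by rewrite -[LHS]comp1m -[RHS]comp1m -(te Y) -!compmA fE.
Qed.

End FullyFaithful.

Section Additive.
Variables (R R' : graded_ring) (F : functor (Gr R) (Gr R')).
Hypothesis Ffaith : forall X Y (f g : mor X Y), fmap F f = fmap F g -> f = g.
Hypothesis Ffull : forall X Y (h : mor (F X) (F Y)), exists f, fmap F f = h.

(** The zero endomorphism of [F X] is the image of some [v]. Precomposing a zero map with [v] does
    not change it, but precomposing its image with [fmap F v] gives zero. *)
Lemma ff_zero (X Y : Gr R) : fmap F (gh_zero X Y) = gh_zero (F X) (F Y).
Proof.
have [v vE] := Ffull (gh_zero (F X) (F X)).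
pose z : mor X Y := gh_zero X Y; rewrite -[gh_zero X Y]/z.
have -> : z = compm z v by apply: graded_hom_ext.
by rewrite fmapM vE; apply: graded_hom_ext => x; apply: gh0.
Qed.

(** A sum of two maps factors through the biproduct as [c] after [h]. It is therefore enough that
    [F] respects the expression of the identity of the biproduct as i1 p1 + i2 p2. *)
Lemma ff_add (X Y : Gr R) (f g : graded_hom X Y) :
  fmap F (gh_add f g : mor X Y)
  = gh_add (fmap F (f : mor X Y)) (fmap F (g : mor X Y)) :> graded_hom _ _.
Proof.
pose YY : Gr R := prod_module Y Y.
pose p1 : mor YY Y := prod_fst Y Y; pose p2 : mor YY Y := prod_snd Y Y.
pose i1 : mor Y YY := prod_pair (graded_id Y) (gh_zero Y Y).
pose i2 : mor Y YY := prod_pair (gh_zero Y Y) (graded_id Y).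
pose h : mor X YY := prod_pair f g.
pose c : mor YY Y := prod_copair (graded_id Y) (graded_id Y).
(* Endomorphisms of [F YY] come from endomorphisms of [YY], which are determined by their two
   components. *)
have monic (a b : mor (F YY) (F YY)) :
    compm (fmap F p1) a = compm (fmap F p1) b ->
    compm (fmap F p2) a = compm (fmap F p2) b -> a = b.
  have [a' <-] := Ffull a; have [b' <-] := Ffull b.
  rewrite -!fmapM => /Ffaith ab1 /Ffaith ab2; congr fmap.
  apply: graded_hom_ext => x; apply: injective_projections.
    exact: (congr1 (fun k : graded_hom _ _ => k x) ab1).
  exact: (congr1 (fun k : graded_hom _ _ => k x) ab2).
have idE : idm (F YY) = gh_add (compm (fmap F i1) (fmap F p1))
                               (compm (fmap F i2) (fmap F p2)) :> mor _ _.
  have compD (A B D' : Gr R') (k : mor B D') (u v : mor A B) :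
      compm k (gh_add u v : mor A B)
      = gh_add (compm k u : mor A D') (compm k v : mor A D') :> graded_hom A D'.
    by apply: graded_hom_ext => x; apply: ghD.
  have q11 : compm p1 i1 = idm Y by apply: graded_hom_ext.
  have q12 : compm p1 i2 = gh_zero Y Y by apply: graded_hom_ext.
  have q21 : compm p2 i1 = gh_zero Y Y by apply: graded_hom_ext.
  have q22 : compm p2 i2 = idm Y by apply: graded_hom_ext.
  have z0 (k : mor YY Y) : compm (gh_zero Y Y : mor Y Y) k = gh_zero YY Y.
    exact: graded_hom_ext.
  apply: monic; rewrite compm1 compD !compmA -!fmapM ?q11 ?q12 ?q21 ?q22.
    rewrite comp1m z0 ff_zero; apply: graded_hom_ext => x /=.
    by rewrite addr0.
  rewrite comp1m z0 ff_zero; apply: graded_hom_ext => x /=.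
  by rewrite add0r.
have -> : gh_add f g = compm c h :> mor X Y by apply: graded_hom_ext.
rewrite fmapM; apply: graded_hom_ext => x.
rewrite -[RHS]/(fmap F (f : mor X Y) x + fmap F (g : mor X Y) x).
have -> : f = compm p1 h :> mor X Y by apply: graded_hom_ext.
have -> : g = compm p2 h :> mor X Y by apply: graded_hom_ext.
rewrite -[LHS]/(fmap F c (fmap F h x)).
rewrite -[fmap F h x]/((idm (F YY) : graded_hom _ _) (fmap F h x)) idE.
rewrite [LHS]ghD !fmapM; congr (_ + _).
  have q1 : compm c i1 = idm Y.
    by apply: graded_hom_ext => y; apply: addr0.
  have /(congr1 (fmap F)) := q1; rewrite fmapM fmap1.
  by move=> /(congr1 (fun k : graded_hom _ _ => k (fmap F p1 (fmap F h x)))).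
have q2 : compm c i2 = idm Y.
  by apply: graded_hom_ext => y; apply: add0r.
have /(congr1 (fmap F)) := q2; rewrite fmapM fmap1.
by move=> /(congr1 (fun k : graded_hom _ _ => k (fmap F p2 (fmap F h x)))).
Qed.

Lemma ff_sum (X Y : Gr R) (I : finType) (h : I -> mor X Y) :
  fmap F (\big[@gh_add R X Y/gh_zero X Y]_i h i : mor X Y)
  = \big[@gh_add R' (F X) (F Y)/gh_zero _ _]_i (fmap F (h i)).
Proof. exact: (big_morph _ (@ff_add X Y) (ff_zero X Y)). Qed.

End Additive.

(** * Graded modules with a finite basis *)

Section Frames.
Variables (K : fieldType) (E : digraph).
Notation L := (lpa K E).
Notation GL := (leavitt K E).
Implicit Types (v w : vert E) (e : edge E).

Definition vtx v : L := lpa_vert K v.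
Definition edg e : L := lpa_edge K e.
Definition gho e : L := lpa_ghost K e.

Lemma vtxM v w : vtx v * vtx w = if v == w then vtx v else 0.
Proof. exact: lpa_vertM. Qed.

Lemma vtx_idem v : vtx v * vtx v = vtx v.
Proof. by rewrite vtxM eqxx. Qed.

Lemma sum_vtx : \sum_v vtx v = 1 :> L. Proof. by []. Qed.

Lemma vtx_edg v e : vtx v * edg e = if v == src e then edg e else 0.
Proof.
have se : vtx (src e) * edg e = edg e by exact: lpa_src_edge.
by rewrite -{1}se mulrA vtxM; case: eqP => [->|_]; rewrite ?mul0r.
Qed.

Lemma edg_vtx v e : edg e * vtx v = if v == rng e then edg e else 0.
Proof.
have er : edg e * vtx (rng e) = edg e by exact: lpa_edge_rng.
by rewrite -{1}er -mulrA vtxM eq_sym; case: eqP => _; rewrite ?mulr0.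
Qed.

Lemma vtx_gho v e : vtx v * gho e = if v == rng e then gho e else 0.
Proof.
have rg : vtx (rng e) * gho e = gho e by exact: lpa_rng_ghost.
by rewrite -{1}rg mulrA vtxM; case: eqP => [->|_]; rewrite ?mul0r.
Qed.

Lemma gho_vtx v e : gho e * vtx v = if v == src e then gho e else 0.
Proof.
have gs : gho e * vtx (src e) = gho e by exact: lpa_ghost_src.
by rewrite -{1}gs -mulrA vtxM eq_sym; case: eqP => _; rewrite ?mulr0.
Qed.

Lemma gho_edg e f : gho e * edg f = if e == f then vtx (rng e) else 0.
Proof. exact: lpa_ghost_edge. Qed.

Program Definition regm : graded_module GL :=
  @GradedModule GL (L^c)^o (@lpa_comp K E) (@lpa_comp_decomposition K E) _.
Next Obligation. by move=> i j m r; apply: lg_mul. Qed.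

Program Definition psub v : submodule regm :=
  @Submodule _ regm (fun x : L => vtx v * x = x) _ _.
Next Obligation. by move=> v; apply: mulr0. Qed.
Next Obligation.
move=> v a x y /= vtx_ vy; rewrite -[a *: x]/((x : L) * (a : L)).
by rewrite mulrDr vy mulrA vtx_.
Qed.

Lemma psub_proj v n x : psub v x -> psub v (proj (gm_decomposition regm) n x).
Proof.
move=> /= vtx_; rewrite -[in RHS]vtx_; apply/esym/graded_map_proj0 => [y z|k y].
  by rewrite mulrBr.
by move=> ky; rewrite -[k]add0r; apply: lg_mul => //; apply: lg_vert.
Qed.

(** The shift by [- k] puts the generator [v] in degree [k]. *)
Definition Pm v (k : int) : graded_module GL :=
  shift_module (- k) (sub_module (@psub_proj v)).

Definition pval v k (x : Pm v k) : L := val (x : subm (psub v)).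

Definition pmk v k (x : L) (vtx_ : vtx v * x = x) : Pm v k :=
  @mksub _ regm (psub v) x vtx_.

Lemma pvalK v k (x : Pm v k) : vtx v * pval x = pval x.
Proof. exact: (submP (x : subm (psub v))). Qed.

Lemma pval_inj v k : injective (@pval v k).
Proof. by move=> x y xy; apply: val_inj. Qed.

Lemma pvalD v k (x y : Pm v k) : pval (x + y) = pval x + pval y.
Proof. by []. Qed.

Lemma pval0 v k : pval (0 : Pm v k) = 0.
Proof. by []. Qed.

Lemma pval_sum v k I (s : seq I) (P : pred I) (F : I -> Pm v k) :
  pval (\sum_(i <- s | P i) F i) = \sum_(i <- s | P i) pval (F i).
Proof. exact: (big_morph _ (@pvalD v k) (pval0 v k)). Qed.

Lemma pval_act v k (x : Pm v k) (a : L) :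
  pval (ract x (a : GL)) = pval x * a.
Proof. by []. Qed.

Lemma pval_comp v k n (x : Pm v k) :
  gm_comp (Pm v k) n x = lpa_comp (n - k) (pval x).
Proof. by []. Qed.

Definition pgen v k : Pm v k := @pmk v k (vtx v) (vtx_idem v).

Lemma pgenE v k : pval (pgen v k) = vtx v. Proof. by []. Qed.

Lemma pgen_comp v k : gm_comp (Pm v k) k (pgen v k).
Proof. by rewrite pval_comp subrr; apply: lg_vert. Qed.

Lemma pgen_act v k (x : Pm v k) : x = ract (pgen v k) (pval x : GL).
Proof. by apply: pval_inj; rewrite pval_act pgenE pvalK. Qed.

Section Maps.
Variable N : graded_module GL.

Program Definition phom v k (n : N) (kn : gm_comp N k n) :
    graded_hom (Pm v k) N :=
  @GradedHom GL (Pm v k) N (fun x => ract n (pval x : GL)) _ _.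
Next Obligation.
move=> v k n kn a x y; rewrite pvalD ractD; congr (_ + _).
by rewrite -[a *: x]/(ract x (a : GL)) pval_act ractM.
Qed.
Next Obligation.
move=> v k n kn i x ix; rewrite -[i](subrKC k); apply: gm_compM => //.
Qed.

Lemma phomE v k (f : graded_hom (Pm v k) N) x :
  f x = ract (f (pgen v k)) (pval x : GL).
Proof. by rewrite {1}[x]pgen_act gh_act. Qed.

Lemma phom_gen_act v k (f : graded_hom (Pm v k) N) :
  ract (f (pgen v k)) (vtx v : GL) = f (pgen v k).
Proof. by rewrite -gh_act; congr (f _); apply: pval_inj;
  rewrite pval_act vtxM eqxx. Qed.

Lemma phom_gen_comp v k (f : graded_hom (Pm v k) N) :
  gm_comp N k (f (pgen v k)).
Proof. by apply: gh_degree; apply: pgen_comp. Qed.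

Lemma pval_act_hom v k (f : graded_hom N (Pm v k)) n (a : L) :
  pval (f (ract n (a : GL))) = pval (f n) * a.
Proof. by rewrite gh_act pval_act. Qed.

Lemma pval_comp_hom v k (f : graded_hom N (Pm v k)) i n :
  gm_comp N i n -> lpa_comp (i - k) (pval (f n)).
Proof. by move=> /(gh_degree f). Qed.

(** A dual basis: [N] is a direct summand of the sum of the [Pm (fv i) k], all generated in one
    degree. Under [orth] the summand is the whole sum. *)
Record frame (k : int) := Frame {
  fI : finType;
  fv : fI -> vert E;
  ff : forall i, graded_hom (Pm (fv i) k) N;
  fg : forall i, graded_hom N (Pm (fv i) k);
  fsum : forall x, \sum_i ff i (fg i x) = x
}.

Arguments fv {k} b i : rename.
Arguments ff {k} b i : rename.
Arguments fg {k} b i : rename.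
Arguments fsum {k} b x : rename.

Definition orth k (b : frame k) : Prop :=
  (forall i x, fg b i (ff b i x) = x) /\
  (forall i j x, i != j -> fg b i (ff b j x) = 0).

Definition count k (b : frame k) v : nat := #|[set i | fv b i == v]|.

(* The matrix of the identity of [N] from the family [b'] to the family [b]. *)
Definition gmx k (b b' : frame k) (i : fI b) (j : fI b') : L :=
  pval (fg b i (ff b' j (pgen _ _))).
Arguments gmx {k} b b' i j.

Lemma gmx_comp k (b b' : frame k) i j : lpa_comp 0 (gmx b b' i j).
Proof.
rewrite -(subrr k); apply: pval_comp_hom; apply: phom_gen_comp.
Qed.

Lemma gmx_r k (b b' : frame k) (i : fI b) (j : fI b') :
  gmx b b' i j * vtx (fv b' j) = gmx b b' i j.
Proof. by rewrite /gmx -pval_act_hom phom_gen_act. Qed.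

Lemma gmx_act k (b b' : frame k) (i : fI b) (j : fI b') x :
  pval (fg b i (ff b' j x)) = gmx b b' i j * pval x.
Proof. by rewrite phomE pval_act_hom. Qed.

(** The middle family resolves the identity. Hence the matrix of a family with itself is idempotent,
    and two bases have mutually inverse matrices. *)
Lemma gmx_mul k (b b' b'' : frame k) (i : fI b) (j : fI b'') :
  \sum_(l : fI b') gmx b b' i l * gmx b' b'' l j = gmx b b'' i j.
Proof.
rewrite /gmx -[in RHS](fsum b' (ff b'' j _)) gh_sum pval_sum.
by apply: eq_bigr => l _; rewrite [RHS]gmx_act.
Qed.

Lemma gmx_orth k (b : frame k) (i j : fI b) : orth b ->
  gmx b b i j = if i == j then vtx (fv b i) else 0.
Proof.
move=> [b1 b0]; rewrite /gmx; case: eqVneq => [->|ij]; first by rewrite b1.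
by rewrite b0.
Qed.

End Maps.

Arguments fv {N k} b i : rename.
Arguments ff {N k} b i : rename.
Arguments fg {N k} b i : rename.
Arguments fsum {N k} b x : rename.
Arguments gmx {N k} b b' i j.

Section FrameComp.
Variables (N : graded_module GL) (k : int) (I : finType).
Variables (Q : I -> graded_module GL) (f : forall i, graded_hom (Q i) N).
Variables (g : forall i, graded_hom N (Q i)).
Hypothesis fg_sum : forall x, \sum_i f i (g i x) = x.
Variable b : forall i, frame (Q i) k.

Program Definition frame_comp : frame N k :=
  @Frame N k {i : I & fI (b i)} (fun u => fv (b (tag u)) (tagged u))
    (fun u => graded_comp (f (tag u)) (ff (b (tag u)) (tagged u)))
    (fun u => graded_comp (fg (b (tag u)) (tagged u)) (g (tag u))) _.
Next Obligation.
move=> x; rewrite -[RHS]fg_sum.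
under [RHS]eq_bigr => i _ do rewrite -(fsum (b i) (g i x)) gh_sum.
by rewrite sig_big_dep.
Qed.

Lemma orth_frame_comp : (forall i, orth (b i)) ->
  (forall i x, g i (f i x) = x) ->
  (forall i j x, i != j -> g i (f j x) = 0) -> orth frame_comp.
Proof.
move=> bo g1 g0; split=> [[i a] x|[i a] [j c] x] /=.
  by rewrite g1; case: (bo i) => ->.
case: (eqVneq i j) => [ij|ij _]; last by rewrite g0 // gh0.
subst j; rewrite eq_Tagged /= => ac; rewrite g1.
by case: (bo i) => _ ->.
Qed.

Lemma count_frame_comp v : count frame_comp v = \sum_i count (b i) v.
Proof.
rewrite /count -sum1_card big_mkcond /=.
under [RHS]eq_bigr => i _ do rewrite -sum1_card big_mkcond.
rewrite sig_big_dep /=; apply: eq_bigr => -[i a] _.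
by rewrite !inE.
Qed.

End FrameComp.

End Frames.

Arguments fv {K E N k} b i : rename.
Arguments ff {K E N k} b i : rename.
Arguments fg {K E N k} b i : rename.
Arguments fsum {K E N k} b x : rename.
Arguments gmx {K E N k} b b' i j.

(** * Linear independence of the vertices *)

Section VertexFree.
Variables (K : fieldType) (E : digraph).
Hypothesis sinkless : no_sinks E.

(* The edges leaving [v] are used to split each copy of nat into residue
   classes, which realizes the relations on functions on [vert E * nat]. *)
Let M : lmodType K := [the lmodType K of (vert E * nat)%type -> K^o].
Let outs (v : vert E) := enum [set e : edge E | src e == v].
Let deg (v : vert E) := size (outs v).
Let idx (e : edge E) := index e (outs (src e)).

Fact idx_lt e : (idx e < deg (src e))%N.
Proof. by rewrite /idx /deg index_mem mem_enum inE. Qed.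

Fact idx_inj e e' : src e = src e' -> idx e = idx e' -> e = e'.
Proof.
rewrite /idx => <- ee'.
have oute : e \in outs (src e) by rewrite mem_enum inE.
rewrite -[LHS](nth_index e oute) ee'.
have [e'o|e'o] := boolP (e' \in outs (src e)); first by rewrite nth_index.
by move: oute; rewrite -index_mem ee' memNindex // ltnn.
Qed.

Fact deg_gt0 v : (0 < deg v)%N.
Proof. by have [e <-] := sinkless v; apply: leq_ltn_trans (idx_lt e). Qed.

Let fv (v : vert E) (f : M) : M := fun u => if u.1 == v then f u else 0.
Let fe (e : edge E) (f : M) : M := fun u =>
  if u.1 == rng e then f (src e, (u.2 * deg (src e) + idx e)%N) else 0.
Let fg (e : edge E) (f : M) : M := fun u =>
  if (u.1 == src e) && (u.2 %% deg (src e) == idx e)%N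
  then f (rng e, (u.2 %/ deg (src e))%N) else 0.

Fact fv_linear v : linear (fv v).
Proof.
move=> a x y; apply/funext => u; rewrite [RHS]fct_linE /fv.
by case: ifP; rewrite ?scaler0 ?addr0.
Qed.

Fact fe_linear e : linear (fe e).
Proof.
move=> a x y; apply/funext => u; rewrite [RHS]fct_linE /fe.
by case: ifP; rewrite ?scaler0 ?addr0.
Qed.

Fact fg_linear e : linear (fg e).
Proof.
move=> a x y; apply/funext => u; rewrite [RHS]fct_linE /fg.
by case: ifP; rewrite ?scaler0 ?addr0.
Qed.

Program Definition function_rep : leavitt_rep E M :=
  @LeavittRep K E M (fun v => mklin (fv_linear v)) (fun e =>
    mklin (fe_linear e))
    (fun e => mklin (fg_linear e)) _ _ _ _ _ _ _ _.
Next Obligation.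
move=> v w x; apply/funext => u /=; rewrite /fv.
case: (eqVneq v w) => [->|vw]; first by case: (u.1 == w).
by case: eqP => // ->; rewrite eq_sym (negbTE vw).
Qed.
Next Obligation.
move=> x; rewrite fct_sumE; apply/funext => u /=; rewrite (bigD1 u.1) //=.
rewrite /fv eqxx big1 ?addr0 // => v vu; by rewrite eq_sym (negbTE vu).
Qed.
Next Obligation.
by move=> e x; apply/funext => u; rewrite /= /fe /fv /= eqxx.
Qed.
Next Obligation.
by move=> e x; apply/funext => u; rewrite /= /fe /fv /=; case: eqP.
Qed.
Next Obligation.
by move=> e x; apply/funext => u; rewrite /= /fg /fv /= eqxx.
Qed.
Next Obligation.
by move=> e x; apply/funext => u; rewrite /= /fg /fv /=; case: eqP.
Qed.
Next Obligation.
move=> e f x; apply/funext => -[w n]; rewrite /= /fe /fg /=.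
case: (eqVneq (src f) (src e)) => [fe_src|fe_src] /=; last first.
  case: (e =P f) fe_src => [-> /eqP //|_ _]; by case: ifP.
have fi : (idx f < deg (src e))%N by rewrite -fe_src; apply: idx_lt.
have -> : ((n * deg (src f) + idx f) %% deg (src e))%N = idx f.
  by rewrite fe_src modnMDl; apply: modn_small.
have -> : ((n * deg (src f) + idx f) %/ deg (src e))%N = n.
  by rewrite fe_src divnMDl ?deg_gt0 // (divn_small fi) addn0.
case: (eqVneq e f) => [->|ef] /=; first by rewrite eqxx /fv /=;
  case: eqP => [->|].
case: (idx f =P idx e) => [ii|_]; last by case: ifP.
by case/eqP: ef; apply/esym/idx_inj.
Qed.
Next Obligation.
move=> x; rewrite fct_sumE; apply/funext => -[w n] /=.
pose i := (n %% deg w)%N; have iw : (i < deg w)%N by rewrite ltn_mod deg_gt0.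
have [e0 _] := sinkless w; pose e := nth e0 (outs w) i.
have ew : src e = w.
  by have := mem_nth e0 iw; rewrite mem_enum inE => /eqP.
have ei : idx e = i by rewrite /idx ew index_uniq ?enum_uniq.
rewrite (bigD1 e) //= big1 => [|f fe_ne].
  rewrite addr0 /fe /fg /= ew ei !eqxx /=; congr (x (_, _)).
  exact/esym/divn_eq.
rewrite /fg /=; case: eqP => //= wf; case: eqP => //= nf.
by case/eqP: fe_ne; apply: idx_inj; rewrite ?ew // ei /i {1}wf.
Qed.

(** Acting by [a *: vtx K v] on the constant function 1 gives the value [a] at [(v, 0)]. *)
Lemma vertex_free (a : K) (v : vert E) : a *: vtx K v = 0 -> a = 0.
Proof.
move=> av; have := lact0 function_rep (fun=> 1 : K^o); rewrite -av lactZ lactE.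
move/(congr1 (fun f : M => f (v, 0%N))).
have -> : (a *: rep_act function_rep (LVert K v) (fun=> 1)) (v, 0%N) = a * 1.
  by rewrite -[LHS]/(a * fv v (fun=> 1) (v, 0%N)) /fv /= eqxx.
by rewrite mulr1.
Qed.

End VertexFree.

(** * Scalars and the filtration of the degree-zero part *)

Section Scalars.
Variables (K : fieldType) (E : digraph).
Hypothesis sinkless : no_sinks E.
Notation L := (lpa K E).
Notation GL := (leavitt K E).
Notation vtx := (@vtx K E).
Notation edg := (@edg K E).
Notation gho := (@gho K E).

Definition scalar (x : L) : Prop :=
  exists c : vert E -> K, x = \sum_v c v *: vtx v.

Lemma sum_vtx_mulr c w : (\sum_v c v *: vtx v) * vtx w = c w *: vtx w.
Proof.
rewrite mulr_suml (bigD1 w) //= big1 => [|v vw].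
  by rewrite lpa_scaleM vtx_idem addr0.
by rewrite lpa_scaleM vtxM (negbTE vw) scaler0.
Qed.

Lemma sum_vtx_mull c w : vtx w * (\sum_v c v *: vtx v) = c w *: vtx w.
Proof.
rewrite mulr_sumr (bigD1 w) //= big1 => [|v vw].
  by rewrite lpa_mulrZ vtx_idem addr0.
by rewrite lpa_mulrZ vtxM eq_sym (negbTE vw) scaler0.
Qed.

Lemma scalar_inj c c' :
  \sum_v c v *: vtx v = \sum_v c' v *: vtx v :> L -> c =1 c'.
Proof.
move=> cc w; apply/eqP; rewrite -subr_eq0; apply/eqP.
apply: (vertex_free sinkless (v := w)).
by rewrite scalerBl -!sum_vtx_mulr cc subrr.
Qed.

Lemma scalar0 : scalar 0.
Proof. by exists (fun=> 0); rewrite big1 // => v _; rewrite scale0r. Qed.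

Lemma scalar_vtx v : scalar (vtx v).
Proof.
exists (fun w => if w == v then 1 else 0); rewrite (bigD1 v) //= eqxx scale1r.
by rewrite big1 ?addr0 // => w /negbTE ->; rewrite scale0r.
Qed.

Lemma scalarD x y : scalar x -> scalar y -> scalar (x + y).
Proof.
move=> [c ->] [c' ->]; exists (fun v => c v + c' v); rewrite -big_split.
by apply: eq_bigr => v _; rewrite scalerDl.
Qed.

Lemma scalarZ a x : scalar x -> scalar (a *: x).
Proof.
move=> [c ->]; exists (fun v => a * c v); rewrite scaler_sumr.
by apply: eq_bigr => v _; rewrite scalerA.
Qed.

Lemma scalarM x y : scalar x -> scalar y -> scalar (x * y).
Proof.
move=> [c ->] [c' ->]; exists (fun v => c v * c' v); rewrite mulr_suml.
apply: eq_bigr => v _.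
by rewrite lpa_scaleM sum_vtx_mull scalerA.
Qed.

Lemma scalar_sum I (s : seq I) (P : pred I) (F : I -> L) :
  (forall i, P i -> scalar (F i)) -> scalar (\sum_(i <- s | P i) F i).
Proof.
by move=> FS; apply: (big_ind scalar) => //; [apply: scalar0 | apply: scalarD].
Qed.

Definition coef (x : L) : vert E -> K :=
  if pselect (scalar x) is left sx then sval (cid sx) else fun=> 0.

Lemma coefE x : scalar x -> x = \sum_v coef x v *: vtx v.
Proof. by move=> sx; rewrite /coef; case: pselect => // {}sx; case: cid. Qed.

Lemma coef_sum c : coef (\sum_v c v *: vtx v) =1 c.
Proof. by apply: scalar_inj; rewrite -coefE //; exists c. Qed.

Lemma coef0 v : coef 0 v = 0.
Proof.
rewrite -[RHS](coef_sum (fun=> 0) v); congr (coef _ v).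
by rewrite big1 // => w _; rewrite scale0r.
Qed.

Lemma coef_vtx w v : coef (vtx w) v = (w == v)%:R.
Proof.
rewrite -[RHS](coef_sum (fun v => (w == v)%:R) v); congr (coef _ v).
rewrite (bigD1 w) //= eqxx scale1r big1 ?addr0 // => u.
by rewrite eq_sym => /negbTE ->; rewrite scale0r.
Qed.

Lemma coefD x y v : scalar x -> scalar y -> coef (x + y) v = coef x v + coef y
  v.
Proof.
move=> /coefE xE /coefE yE; rewrite {1}xE {1}yE -big_split /=.
under eq_bigr => w _ do rewrite -scalerDl.
exact: coef_sum.
Qed.

Lemma coefM x y v : scalar x -> scalar y -> coef (x * y) v = coef x v * coef y
  v.
Proof.
move=> /coefE xE /coefE yE; rewrite {1}xE {1}yE mulr_suml.
under eq_bigr => w _ do rewrite lpa_scaleM sum_vtx_mull scalerA.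
exact: coef_sum.
Qed.

Lemma coef_big I (s : seq I) (F : I -> L) v : (forall i, scalar (F i)) ->
  coef (\sum_(i <- s) F i) v = \sum_(i <- s) coef (F i) v.
Proof.
move=> FS; elim: s => [|i s IHs]; first by rewrite !big_nil coef0.
by rewrite !big_cons coefD ?IHs //; apply: scalar_sum.
Qed.

Fixpoint word (p : seq (edge E)) : L :=
  if p is e :: p' then edg e * word p' else 1.

Fixpoint gword (p : seq (edge E)) : L :=
  if p is e :: p' then gword p' * gho e else 1.

(* Conjugating by the paths of length [l] refines the degree-zero part of the
   algebra through matrix algebras; [level l x] says that [x] lies in the
   [l]-th of them. *)
Definition level (l : nat) (x : L) : Prop :=
  forall p q, size p = l -> size q = l -> scalar (gword p * x * word q).

(** Each innermost pair of a ghost and an edge reduces to a vertex or to zero, and equal lengths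
    leave no factor unmatched. *)
Lemma scalar_words v p q : size p = size q ->
  scalar (gword p * vtx v * word q).
Proof.
elim: p q v => [|e p IHp] [|f q] v //= pq.
  by rewrite mul1r mulr1; apply: scalar_vtx.
rewrite -[gword p * gho e * _]mulrA gho_vtx mulrA.
case: eqP => _; last by rewrite mulr0 !mul0r; apply: scalar0.
rewrite -[gword p * gho e * _]mulrA gho_edg.
case: eqP => _; last by rewrite mulr0 !mul0r; apply: scalar0.
by apply: IHp; case: pq.
Qed.

(** Without sinks the products [word p * gword p] over all paths of length [l] add up to 1, and this
    sum is inserted between [x] and [y]. *)
Lemma scalar_insert l (x y : L) :
  (forall p, size p = l -> scalar (x * word p * (gword p * y))) ->
  scalar (x * y).
Proof.
elim: l x y => [|l IHl] x y H.
  by have := H [::] erefl; rewrite mulr1 mul1r.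
rewrite -[x]mulr1 -(lpa_sum_edges K sinkless) mulr_sumr mulr_suml.
apply: scalar_sum => e _; rewrite mulrA -[_ * y]mulrA; apply: IHl => p pl.
by have := H (e :: p) (congr1 S pl); rewrite /= !mulrA.
Qed.

(** The relation between the lengths gives the conjugated element degree zero. An edge is absorbed
    by the first edge of [p], a ghost by the first edge of [q]; a product is cut in two by inserting
    paths of the length dictated by the degree of its right factor. *)
Lemma homogeneous_scalar d x : lpa_comp d x -> exists l, forall n m : nat,
  (l <= n)%N -> m%:Z = d + n%:Z -> forall p q, size p = m -> size q = n ->
  scalar (gword p * x * word q).
Proof.
elim=> {d x}.
- move=> v; exists 0%N => n m _; rewrite add0r => -[mn] p q pm qn.
  by apply: scalar_words; rewrite pm qn.
- move=> e; exists 0%N => n m _ mn [|f p] q pm qn.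
    by move: mn; rewrite -pm /= -intS.
  have {mn}mn : m = n.+1 by apply/eqP; rewrite -eqz_nat mn intS.
  rewrite /= -[lpa_edge K e]/(edg e) -[gword p * gho f * edg e]mulrA gho_edg.
  case: eqP => _; last by rewrite mulr0 mul0r; apply: scalar0.
  by apply: scalar_words; apply/succn_inj; rewrite qn -mn -pm.
- move=> e; exists 0%N => n m _ mn p [|f q] pm qn.
    by move: mn; rewrite -qn /= addr0.
  have {mn}mn : n = m.+1.
    by apply/eqP; rewrite -eqz_nat intS mn addrA subrr add0r.
  rewrite /= -[lpa_ghost K e]/(gho e) mulrA -[gword p * gho e * edg f]mulrA
    gho_edg.
  case: eqP => _; last by rewrite mulr0 mul0r; apply: scalar0.
  by apply: scalar_words; apply/succn_inj; rewrite pm -mn -qn.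
- by move=> d; exists 0%N => *; rewrite mulr0 mul0r; apply: scalar0.
- move=> d x y _ [l xl] _ [l' yl]; exists (maxn l l') => n m.
  rewrite geq_max => /andP[ln l'n] mn p q pm qn.
  rewrite mulrDr mulrDl; apply: scalarD; first exact: xl mn _ _ pm qn.
  exact: yl mn _ _ pm qn.
- move=> d a x _ [l xl]; exists l => n m ln mn p q pm qn.
  by rewrite lpa_mulrZ lpa_scaleM; apply: scalarZ; apply: xl mn _ _ pm qn.
(* The bound makes [n] at least [l'], as [y] requires, and the length [d2 + n] of the inserted paths
   at least [l], as [x] requires, even for negative [d2]. *)
- move=> d1 d2 x y _ [l xl] _ [l' yl]; exists (l' + l + `|d2|)%N =>
    n m ln mn p q pm qn.
  have d2n : (l%:Z <= d2 + n%:Z)%R by lia.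
  have [t tE] : exists t : nat, t%:Z = d2 + n%:Z.
    by exists (absz (d2 + n%:Z)); lia.
  rewrite !mulrA -[_ * word q]mulrA; apply: (@scalar_insert t) => u ut.
  apply: scalarM; first by apply: (xl t m) => //; lia.
  by rewrite mulrA; apply: (yl n t) => //; lia.
Qed.

Lemma level_ex x : lpa_comp 0 x -> exists l, forall n, (l <= n)%N -> level n x.
Proof.
move=> /homogeneous_scalar[l xl]; exists l => n ln p q pn qn.
by apply: xl pn qn => //; rewrite add0r.
Qed.

Lemma level0 x : level 0 x -> scalar x.
Proof. by move/(_ [::] [::] erefl erefl); rewrite mul1r mulr1. Qed.

Lemma levelS l x e f : level l.+1 x -> level l (gho e * x * edg f).
Proof.
move=> xl p q pl ql; have := xl (e :: p) (f :: q).
by rewrite /= pl ql !mulrA; apply.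
Qed.

End Scalars.

(** A rank factorization X Y of an idempotent satisfies Y X = 1, by cancelling X on the left and Y
    on the right in X Y X Y = X Y. *)
Lemma idempotent_split (K : fieldType) (I : finType) (c : I -> I -> K) :
  (forall i k, \sum_j c i j * c j k = c i k) ->
  exists (r : nat) (U : I -> 'I_r -> K) (V : 'I_r -> I -> K),
    (forall i j, \sum_a U i a * V a j = c i j) /\
    (forall a b, \sum_i \sum_j V a i * c i j * U j b = (a == b)%:R).
Proof.
move=> cc; pose C : 'M[K]_#|I| := \matrix_(i, j) c (enum_val i) (enum_val j).
have sumE (F : I -> K) : \sum_(i : 'I_#|I|) F (enum_val i) = \sum_i F i.
  by rewrite -(big_enum_val (A := I) F).
have CC : C *m C = C.
  apply/matrixP => i k; rewrite !mxE -cc -sumE.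
  by apply: eq_bigr => j _; rewrite !mxE.
pose X := col_base C; pose Y := row_base C.
have XY : X *m Y = C by apply: mulmx_base.
have X1 : pinvmx X *m X = 1%:M by rewrite mulVpmx ?col_base_full.
have Y1 : Y *m pinvmx Y = 1%:M by rewrite mulmxVp ?row_base_free.
have YX : Y *m X = 1%:M.
  transitivity ((pinvmx X *m X) *m (Y *m X) *m (Y *m pinvmx Y)).
    by rewrite X1 Y1 mul1mx mulmx1.
  transitivity (pinvmx X *m (X *m Y *m (X *m Y)) *m pinvmx Y).
    by rewrite !mulmxA.
  transitivity (pinvmx X *m (X *m Y) *m pinvmx Y); first by rewrite XY CC.
  by rewrite mulmxA X1 mul1mx Y1.
exists (\rank C), (fun i a => X (enum_rank i) a), (fun a i =>
  Y a (enum_rank i)).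
split=> [i j|a b].
  have /matrixP/(_ (enum_rank i) (enum_rank j)) := XY.
  by rewrite !mxE !enum_rankK.
have : Y *m C *m X = 1%:M.
  transitivity (Y *m (X *m Y) *m X); first by rewrite XY.
  by rewrite mulmxA -mulmxA !YX mulmx1.
move=> /matrixP/(_ a b); rewrite !mxE => <-.
rewrite exchange_big /= -sumE; apply: eq_bigr => j _.
rewrite [(Y *m C) a j]mxE mulr_suml -sumE; apply: eq_bigr => i _.
by rewrite !mxE !enum_valK.
Qed.

(** An identity matrix of size [#|A|] factors through a space of dimension [#|B|]. *)
Lemma leq_card_inverse (K : fieldType) (I J : finType) (A : {set I})
    (B : {set J}) (X : I -> J -> K) (Y : J -> I -> K) :
  (forall i k, i \in A -> k \in A ->
     \sum_(j in B) X i j * Y j k = (i == k)%:R) -> (#|A| <= #|B|)%N.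
Proof.
move=> XY; pose mX := \matrix_(i < #|A|, j < #|B|) X (enum_val i) (enum_val j).
pose mY := \matrix_(j < #|B|, i < #|A|) Y (enum_val j) (enum_val i).
apply: (@mulmx1_min _ _ _ mX mY); apply/matrixP => i k.
rewrite !mxE -(inj_eq enum_val_inj) -XY ?enum_valP // [RHS]big_enum_val.
by apply: eq_bigr => j _; rewrite !mxE.
Qed.

(** * Change of basis and the counts of basis elements *)

Section Bases.
Variables (K : fieldType) (E : digraph).
Hypothesis sinkless : no_sinks E.
Notation L := (lpa K E).
Notation GL := (leavitt K E).
Notation vtx := (@vtx K E).
Notation edg := (@edg K E).
Notation gho := (@gho K E).

Definition nedges (v w : vert E) : nat :=
  #|[set e : edge E | (src e == v) && (rng e == w)]|.

Section EdgeFrame.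
Variables (v : vert E) (k : int).
Notation outs := {e in [pred e : edge E | src e == v]}.

Fact outsP (u : outs) : src (val u) == v.
Proof. exact: (valP u). Qed.

Fact edge_elem_proof (u : outs) : vtx v * edg (val u) = edg (val u).
Proof. by rewrite vtx_edg eq_sym outsP. Qed.

Definition edge_elem (u : outs) : Pm K v k := pmk k (edge_elem_proof u).

Fact edge_elem_comp u : gm_comp (Pm K v k) (k + 1) (edge_elem u).
Proof. by rewrite pval_comp addrC addKr; apply: lg_edge. Qed.

Fact ghost_map_proof (u : outs) (x : Pm K v k) :
  vtx (rng (val u)) * (gho (val u) * pval x) = gho (val u) * pval x.
Proof. by rewrite mulrA vtx_gho eqxx. Qed.

Program Definition ghost_map (u : outs) :
    graded_hom (Pm K v k) (Pm K (rng (val u)) (k + 1)) :=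
  @GradedHom GL _ _ (fun x => pmk (k + 1) (ghost_map_proof u x)) _ _.
Next Obligation.
move=> u a x y; apply: pval_inj.
transitivity (gho (val u) * (pval x * (a : L) + pval y)) => //.
by rewrite mulrDr mulrA.
Qed.
Next Obligation.
move=> u i x ix; rewrite pval_comp opprD addrA addrC.
exact: lg_mul (lg_ghost _ _) ix.
Qed.

(** The Cuntz-Krieger relation splits v L into the modules e L, and each e L is a copy of r(e) L
    generated one degree higher. *)
Program Definition edge_frame : frame (Pm K v k) (k + 1) :=
  @Frame K E (Pm K v k) (k + 1) outs (fun u => rng (val u))
    (fun u => phom (rng (val u)) (edge_elem_comp u)) ghost_map _.
Next Obligation.
move=> x; apply: pval_inj; rewrite pval_sum.
transitivity (\sum_(e | src e == v) edg e * gho e * pval x).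
  rewrite (big_sub [pred e | src e == v]).
  by apply: eq_bigr => u _; rewrite pval_act -mulrA.
by rewrite -mulr_suml lpa_cuntz_krieger ?pvalK.
Qed.

Lemma edge_frame_gho (u : outs) x : pval (fg edge_frame u x) = gho (val u) *
  pval x.
Proof. by []. Qed.

Lemma edge_frame_edg (u : outs) x : pval (ff edge_frame u x) = edg (val u) *
  pval x.
Proof. by []. Qed.

Lemma edge_frame_orth : orth edge_frame.
Proof.
split=> [u x|u u' x uu']; apply: pval_inj;
  rewrite edge_frame_gho edge_frame_edg mulrA gho_edg.
  by rewrite eqxx pvalK.
by rewrite (inj_eq val_inj) (negbTE uu') mul0r.
Qed.

Lemma count_edge_frame w : count edge_frame w = nedges v w.
Proof.
rewrite /count /nedges -(card_imset _ val_inj); apply: eq_card => e.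
apply/imsetP/idP => [[u + ->]|].
  by rewrite !inE outsP.
rewrite inE => /andP[ev ew].
by exists (exist _ e ev); rewrite // inE.
Qed.

End EdgeFrame.

(** The row [r] times the adjacency matrix, indexed by the vertices themselves. *)
Definition advance (r : vert E -> nat) (w : vert E) : nat :=
  (\sum_v r v * nedges v w)%N.

Section Expansion.
Variables (N : graded_module GL).

Definition expand k (b : frame N k) : frame N (k + 1) :=
  frame_comp (fsum b) (fun i => edge_frame (fv b i) k).

Lemma orth_expand k (b : frame N k) : orth b -> orth (expand b).
Proof.
move=> [b1 b0]; apply: orth_frame_comp => // i; exact: edge_frame_orth.
Qed.

Lemma count_expand k (b : frame N k) : count (expand b) = advance (count b).
Proof.
apply/funext => w; rewrite count_frame_comp.
under eq_bigr => i _ do rewrite count_edge_frame.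
rewrite (partition_big (fv b) xpredT) //=; apply: eq_bigr => v _.
rewrite (eq_bigr (fun=> nedges v w)) => [|i /eqP -> //].
by rewrite big_const iter_addn_0 mulnC /count cardsE.
Qed.

(** Expansion conjugates the matrix by edges, which is the operation that lowers [level] by one. *)
Lemma gmx_expand k (b b' : frame N k) (i : fI b) (j : fI b')
    (u : fI (edge_frame (fv b i) k)) (u' : fI (edge_frame (fv b' j) k)) :
  gmx (expand b) (expand b') (Tagged (fun i => fI (edge_frame (fv b i) k)) u)
    (Tagged (fun j => fI (edge_frame (fv b' j) k)) u')
  = gho (val u) * gmx b b' i j * edg (val u').
Proof.
transitivity (gho (val u) * pval (fg b i (ff b' j
  (ff (edge_frame (fv b' j) k) u' (pgen K (rng (val u')) (k + 1)))))) => //.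
by rewrite -mulrA gmx_act edge_frame_edg pgenE edg_vtx eqxx.
Qed.

(** The coefficients at [w] of the two matrices multiply to an identity matrix over the members of
    [b] at [w]. Only members of [b'] at [w] contribute, since column j of the first matrix is fixed
    by right multiplication by the vertex of j. *)
Lemma count_scalar_le k (b b' : frame N k) w : orth b ->
  (forall i j, scalar (gmx b b' i j)) -> (forall i j, scalar (gmx b' b i j)) ->
  (count b w <= count b' w)%N.
Proof.
move=> bo sbb' sb'b.
apply: (@leq_card_inverse K _ _ _ _ (fun i j => coef (gmx b b' i j) w)
                                   (fun j i => coef (gmx b' b j i) w)).
move=> i k'; rewrite !inE => /eqP iw /eqP kw.
transitivity (coef (gmx b b i k') w).
  rewrite -(@gmx_mul K E N k b b' b i k') coef_big // => [|j];
    last exact: scalarM.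
  rewrite [RHS](bigID (fun j => fv b' j == w)) /= [X in _ = _ + X]big1.
    rewrite addr0; apply: eq_big => [j|j _]; first by rewrite inE.
    by rewrite coefM.
  move=> j jw; rewrite coefM // -gmx_r coefM //; last exact: scalar_vtx.
  by rewrite coef_vtx // (negbTE jw) mulr0 mul0r.
rewrite gmx_orth //; case: eqP => _; last exact: coef0.
by rewrite coef_vtx // iw eqxx.
Qed.

Lemma count_level_le l k (b b' : frame N k) w : orth b ->
  (forall i j, level l (gmx b b' i j)) -> (forall i j, level l (gmx b' b i j))
    ->
  (iter l advance (count b) w <= iter l advance (count b') w)%N.
Proof.
elim: l k b b' => [|l IHl] k b b' bo lbb' lb'b.
  by apply: count_scalar_le => // i j; apply: level0.
rewrite !iterSr -!count_expand; apply: IHl; first exact: orth_expand.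
  by move=> [i u] [j u']; rewrite (gmx_expand (i := i) (j := j) u u');
    apply: levelS.
by move=> [i u] [j u']; rewrite (gmx_expand (i := i) (j := j) u u');
  apply: levelS.
Qed.

Lemma gmx_level_ex k (b b' : frame N k) :
  exists l, forall i j n, (l <= n)%N -> level n (gmx b b' i j).
Proof.
have /boolp.choice [l lP] (ij : fI b * fI b') :
    exists l, forall n, (l <= n)%N -> level n (gmx b b' ij.1 ij.2).
  exact/level_ex/gmx_comp.
exists (\max_ij l ij) => i j n ln; apply: (lP (i, j)).
by apply: leq_trans ln; apply: (leq_bigmax (i, j)).
Qed.

Lemma count_eventually k (b b' : frame N k) : orth b -> orth b' ->
  exists l, iter l advance (count b) = iter l advance (count b').
Proof.
move=> bo bo'; have [l lP] := gmx_level_ex b b'.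
have [l' lP'] := gmx_level_ex b' b.
exists (maxn l l'); apply/funext => w; apply/eqP; rewrite eqn_leq.
rewrite !count_level_le // => i j; (apply: lP || apply: lP');
  by rewrite ?leq_maxl ?leq_maxr.
Qed.

Section SplitFrame.
Variables (k : int) (b : frame N k).
Hypothesis sb : forall i j, scalar (gmx b b i j).

Let c w (i j : fI b) : K := coef (gmx b b i j) w.

Fact idempotent_coef w i j : \sum_l c w i l * c w l j = c w i j.
Proof.
rewrite /c -(@gmx_mul K E N k b b b i j) coef_big //; last first.
  by move=> l; apply: scalarM.
by apply: eq_bigr => l _; rewrite coefM.
Qed.

(** At each vertex the matrix of the family is an idempotent over K. It is written as U V with V c U
    = 1; the columns of U define the new generators and the rows of V their coordinates. *)
Lemma basis_of_scalar : exists b' : frame N k, orth b'.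
Proof.
have H w := cid (idempotent_split (idempotent_coef w)).
pose r w := sval (H w); have H2 w := cid (svalP (H w)).
pose U w : fI b -> 'I_(r w) -> K := sval (H2 w);
  have H3 w := cid (svalP (H2 w)).
pose V w : 'I_(r w) -> fI b -> K := sval (H3 w).
have UV w i j : \sum_a U w i a * V w a j = c w i j.
  by case: (svalP (H3 w)) => + _; apply.
have VU w a a' : \sum_i \sum_j V w a i * c w i j * U w j a' = (a == a')%:R.
  by case: (svalP (H3 w)) => _; apply.
pose T := {w : vert E & 'I_(r w)}.
pose n i := ff b i (pgen K _ k).
pose x (t : T) : N :=
  \sum_i ract (n i) (U (tag t) i (tagged t) *: vtx (tag t) : GL).
have xk t : gm_comp N k (x t).
  apply: (decomp_sum (gm_decomposition N)) => i _;
    rewrite -[k in gm_comp _ k]addr0.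
  apply: gm_compM; first exact: phom_gen_comp.
  by apply: lg_scale; apply: lg_vert.
have xv t : ract (x t) (vtx (tag t) : GL) = x t.
  by rewrite ract_suml; apply: eq_bigr => i _;
    rewrite -ractM lpa_scaleM vtx_idem.
pose y (t : T) (m : N) : L :=
  \sum_i V (tag t) (tagged t) i *: (vtx (tag t) * pval (fg b i m)).
have yv t m : vtx (tag t) * y t m = y t m.
  rewrite mulr_sumr; apply: eq_bigr => i _.
  by rewrite lpa_mulrZ mulrA vtx_idem.
have ylin t : linear (fun m => pmk k (yv t m)).
  move=> a m m'; apply: pval_inj.
  transitivity (y t m * (a : L) + y t m') => //.
  transitivity (y t (a *: m + m')) => //.
  rewrite mulr_suml -big_split; apply: eq_bigr => i _.
  have -> : pval (fg b i (a *: m + m'))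
      = pval (fg b i m) * (a : L) + pval (fg b i m') by rewrite gh_linear.
  by rewrite mulrDr scalerDr mulrA lpa_scaleM.
have ydeg t i m : gm_comp N i m -> gm_comp (Pm K (tag t) k) i (pmk k (yv t m)).
  move=> im; rewrite pval_comp; apply: lpa_comp_sum => j; apply: lg_scale.
  rewrite -[i - k]add0r; apply: lg_mul; first exact: lg_vert.
  exact: pval_comp_hom.
(* The coordinates of [m] are fixed by the matrix of [b], whose part at each vertex is the product U
   V. *)
have xy m : \sum_t phom (tag t) (xk t) (pmk k (yv t m)) = m.
  rewrite -[RHS](fsum b).
  transitivity (\sum_t \sum_i
    ract (n i) (U (tag t) i (tagged t) *: vtx (tag t) * y t m : GL)).
    by apply: eq_bigr => t _; rewrite /= ract_suml; apply: eq_bigr => i _;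
      rewrite -ractM.
  rewrite exchange_big; apply: eq_bigr => i _; rewrite -ract_sum phomE.
  congr (ract _ _); rewrite -[in RHS](fsum b m) gh_sum pval_sum.
  transitivity (\sum_j \sum_w c w i j *: (vtx w * pval (fg b j m))); last first.
    apply: eq_bigr => j _; rewrite gmx_act (coefE (sb i j)) mulr_suml.
    by apply: eq_bigr => w _; rewrite lpa_scaleM.
  pose p j := pval (fg b j m).
  transitivity (\sum_w \sum_a \sum_j (U w i a * V w a j) *: (vtx w * p j)).
    rewrite [RHS]sig_big_dep /=; apply: eq_bigr => -[w a] _ /=.
    rewrite lpa_scaleM (yv (Tagged _ a)) scaler_sumr; apply: eq_bigr => j _.
    by rewrite scalerA.
  rewrite [RHS]exchange_big; apply: eq_bigr => w _.
  rewrite exchange_big; apply: eq_bigr => j _.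
  by rewrite -scaler_suml UV.
pose b' : frame N k := @Frame K E N k T (fun t => tag t)
  (fun t => phom (tag t) (xk t))
  (fun t => @GradedHom GL N (Pm K (tag t) k) (fun m => pmk k (yv t m))
     (ylin t) (ydeg t)) xy.
have ffE t z : ff b' t z = ract (x t) (pval z : GL) by [].
have fgE t m : pval (fg b' t m) = y t m by [].
have ya t m a : y t (ract m (a : GL)) = y t m * a.
  by rewrite -!fgE pval_act_hom.
have gv w i j : gmx b b i j * vtx w = c w i j *: vtx w.
  by rewrite {1}(coefE (sb i j)) sum_vtx_mulr.
have yx t t' : y t (x t') = \sum_i \sum_j
    (V (tag t) (tagged t) i * c (tag t') i j * U (tag t') j (tagged t'))
      *: (vtx (tag t) * vtx (tag t')).
  apply: eq_bigr => i _; rewrite gh_sum pval_sum mulr_sumr scaler_sumr.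
  apply: eq_bigr => j _; rewrite pval_act_hom -[pval _]/(gmx b b i j).
  rewrite lpa_mulrZ gv !lpa_mulrZ !scalerA; congr (_ *: _).
  by rewrite -!mulrA; congr (_ * _); rewrite mulrC.
exists b'; split=> [[w a] z|[w a] [w' a'] z tt']; apply: pval_inj;
  rewrite ffE fgE ya yx /=.
  under eq_bigr => i _ do rewrite -scaler_suml.
  by rewrite -scaler_suml VU eqxx scale1r vtx_idem pvalK.
case: (eqVneq w w') => [ww|ww]; last first.
  rewrite big1 ?mul0r // => i _; rewrite big1 // => j _.
  by rewrite vtxM (negbTE ww) scaler0.
subst w'; under eq_bigr => i _ do rewrite -scaler_suml.
rewrite -scaler_suml VU; move: tt'; rewrite eq_Tagged /= => /negbTE ->.
by rewrite scale0r mul0r.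
Qed.

End SplitFrame.
End Expansion.
End Bases.

(** * Types of graded modules *)

Section HasType.
Variables (K : fieldType) (E : digraph).
Hypothesis sinkless : no_sinks E.
Notation L := (lpa K E).
Notation GL := (leavitt K E).
Notation vtx := (@vtx K E).

Definition has_type (N : graded_module GL) (k : int) (r : vert E -> nat) :=
  exists2 b : frame N k, orth b & count b = r.

(** Each expansion lowers the level by one at the cost of one degree; at level zero the matrix is
    scalar and splits. *)
Lemma frame_level_basis (N : graded_module GL) l k (b : frame N k) :
  (forall i j, level l (gmx b b i j)) ->
  exists b' : frame N (k + l%:Z), orth b'.
Proof.
elim: l k b => [|l IHl] k b lb.
  by rewrite addr0; apply: (basis_of_scalar sinkless (b := b)) => i j;
    apply: level0.
have -> : k + l.+1%:Z = k + 1 + l%:Z by lia.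
apply: (IHl _ (expand sinkless b)) => -[i u] [j u'].
by rewrite (gmx_expand (i := i) (j := j) u u'); apply: levelS.
Qed.

Lemma frame_basis (N : graded_module GL) k (b : frame N k) :
  exists (l : nat) (b' : frame N (k + l%:Z)), orth b'.
Proof.
have [l lP] := gmx_level_ex sinkless b b; exists l.
by apply: (frame_level_basis (b := b)) => i j; apply: lP.
Qed.

Lemma has_type_iter N k r l :
  has_type N k r -> has_type N (k + l%:Z) (iter l (@advance E) r).
Proof.
elim: l k r => [|l IHl] k r; first by rewrite addr0.
case=> b bo br; rewrite iterSr.
have -> : k + l.+1%:Z = k + 1 + l%:Z by lia.
apply: IHl; exists (expand sinkless b); first exact: orth_expand.
by rewrite count_expand br.
Qed.

Lemma has_type_uniq N k r r' : has_type N k r -> has_type N k r' ->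
  exists l, iter l (@advance E) r = iter l (@advance E) r'.
Proof. by move=> [b bo <-] [b' bo' <-]; apply: (count_eventually sinkless). Qed.

Lemma has_type_comp N k (I : finType) (Q : I -> graded_module GL)
    (f : forall i, graded_hom (Q i) N) (g : forall i, graded_hom N (Q i))
    (r : I -> vert E -> nat) :
  (forall x, \sum_i f i (g i x) = x) -> (forall i x, g i (f i x) = x) ->
  (forall i j x, i != j -> g i (f j x) = 0) ->
  (forall i, has_type (Q i) k (r i)) ->
  has_type N k (fun w => \sum_i r i w)%N.
Proof.
move=> fg g1 g0 QP.
have H i : exists b : frame (Q i) k, orth b /\ count b = r i.
  by have [b bo br] := QP i; exists b.
pose b i := sval (cid (H i)).
have bo i : orth (b i) by case: (svalP (cid (H i))).
have br i : count (b i) = r i by case: (svalP (cid (H i))).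
exists (frame_comp fg b); first exact: orth_frame_comp.
apply/funext => w; rewrite count_frame_comp.
by apply: eq_bigr => i _; rewrite br.
Qed.

Lemma has_type_iso N N' k r (f : graded_hom N N') (g : graded_hom N' N) :
  cancel f g -> cancel g f -> has_type N k r -> has_type N' k r.
Proof.
move=> fK gK Nr.
have -> : r = fun w => (\sum_(i : 'I_1) r w)%N.
  by apply/funext => w; rewrite big_ord1.
apply: (@has_type_comp N' k 'I_1 (fun=> N) (fun=> f) (fun=> g)) => //.
- by move=> x; rewrite big_ord1.
- by move=> i j x; rewrite !ord1 eqxx.
Qed.

(** [Pm K v k] is by definition a shift of this module, so a functor commuting with shifts is
    determined on all of them by its value here. *)
Definition P0 v : graded_module GL := sub_module (@psub_proj K E v).

(** The modules [Pm K v k] and [Pm K v (k + a)] have the same underlying module, so the maps of a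
    basis are reused and only their degrees are checked anew. *)
Lemma has_type_shift N a k r :
  has_type N (k + a) r <-> has_type (shift_module a N) k r.
Proof.
split=> -[b [b1 b0] <-].
  have fdeg i n (x : Pm K (fv b i) k) : gm_comp (Pm K (fv b i) k) n x ->
      gm_comp (shift_module a N) n (ff b i (x : Pm K (fv b i) (k + a))).
    rewrite pval_comp => nx; apply: (gh_degree (ff b i)).
    by rewrite pval_comp; have -> : n + a - (k + a) = n - k by lia.
  have gdeg i n x : gm_comp (shift_module a N) n x ->
      gm_comp (Pm K (fv b i) k) n (fg b i x : Pm K (fv b i) k).
    move=> nx; rewrite pval_comp; have -> : n - k = n + a - (k + a) by lia.
    exact: (gh_degree (fg b i)).
  pose b' : frame (shift_module a N) k := @Frame K E (shift_module a N) k
    (fI b) (fv b)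
    (fun i => @GradedHom GL (Pm K (fv b i) k) (shift_module a N)
       (ff b i) (gh_linear (ff b i)) (fdeg i))
    (fun i => @GradedHom GL (shift_module a N) (Pm K (fv b i) k)
       (fg b i) (gh_linear (fg b i)) (gdeg i)) (fsum b).
  by exists b'.
have fdeg i n (x : Pm K (fv b i) (k + a)) : gm_comp (Pm K (fv b i) (k + a)) n x
  ->
    gm_comp N n (ff b i (x : Pm K (fv b i) k)).
  rewrite pval_comp => nx; rewrite -[n](subrK a).
  apply: (gh_degree (ff b i) (i := n - a)).
  by rewrite pval_comp; have -> : n - a - k = n - (k + a) by lia.
have gdeg i n x : gm_comp N n x ->
    gm_comp (Pm K (fv b i) (k + a)) n (fg b i x : Pm K (fv b i) (k + a)).
  move=> nx; rewrite pval_comp; have -> : n - (k + a) = n - a - k by lia.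
  apply: (gh_degree (fg b i) (i := n - a)).
  by rewrite /= subrK.
pose b' : frame N (k + a) := @Frame K E N (k + a) (fI b) (fv b)
  (fun i => @GradedHom GL (Pm K (fv b i) (k + a)) N
     (ff b i) (gh_linear (ff b i)) (fdeg i))
  (fun i => @GradedHom GL N (Pm K (fv b i) (k + a))
     (fg b i) (gh_linear (fg b i)) (gdeg i)) (fsum b).
by exists b'.
Qed.

Lemma has_type_Pm v k : has_type (Pm K v k) k (fun w => (v == w : nat)).
Proof.
pose b : frame (Pm K v k) k := @Frame K E (Pm K v k) k 'I_1 (fun=> v)
  (fun=> graded_id _) (fun=> graded_id _) (fun x => big_ord1 _ _).
exists b; first by split=> // i j x; rewrite !ord1 eqxx.
apply/funext => w; rewrite /count; case: (eqVneq v w) => [vw|vw].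
  subst w; rewrite -[RHS](card_ord 1); by apply: eq_card => i; rewrite !inE.
by rewrite (eq_card0 (A := [set _ | false])) // => i; rewrite inE.
Qed.

Lemma has_type_P0 v l :
  has_type (P0 v) l%:Z (iter l (@advance E) (fun w => (v == w : nat))).
Proof.
have : has_type (P0 v) (0 - 0) (fun w => (v == w : nat)).
  exact/(iffRL (has_type_shift _ _ _ _))/(has_type_Pm v 0).
by rewrite subr0 -[l%:Z]add0r => /(has_type_iter l).
Qed.

Lemma homogeneous_ind (N : graded_module GL) (P : N -> Prop) : P 0 ->
  (forall x y, P x -> P y -> P (x + y)) ->
  (forall n w x, gm_comp N n x -> ract x (vtx w : GL) = x -> P x) ->
  forall x, P x.
Proof.
move=> P_0 P_D P_h x; have [s us /(_ s us)] := proj_sumE (gm_decomposition N) x.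
case=> [//|-> _]; apply: (big_ind P) => // n _.
rewrite -[proj _ _ _]ract1 -sum_vtx ract_sum; apply: (big_ind P) => // w _.
apply: (P_h n w); last by rewrite -ractM vtx_idem.
by rewrite -[n in gm_comp _ n]addr0; apply: gm_compM;
  [apply: proj_comp | apply: lg_vert].
Qed.

End HasType.

(** * Graded equivalences and shift equivalence *)

Section Transport.
Variables (K : fieldType) (E F : digraph).
Hypotheses (sinklessE : no_sinks E) (sinklessF : no_sinks F).
Notation GE := (leavitt K E).
Notation GF := (leavitt K F).
Variables (phi : functor (Gr GE) (Gr GF)) (psi : functor (Gr GF) (Gr GE)).
Hypothesis zphi : graded_functor phi.
Hypothesis psi_phi :
  naturally_isomorphic (comp_functor psi phi) (id_functor (Gr GE)).
Hypothesis phi_psi :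
  naturally_isomorphic (comp_functor phi psi) (id_functor (Gr GF)).

Let phi_faithful := equiv_faithful psi_phi.
Let psi_faithful := equiv_faithful phi_psi.
Let phi_full := equiv_full psi_phi psi_faithful.

Definition mor_app (R : graded_ring) (X Y : Gr R) (f : mor X Y) (x : X) : Y :=
  (f : graded_hom X Y) x.

Lemma mor_appM (R : graded_ring) (X Y Z : Gr R) (f : mor Y Z) (g : mor X Y) x :
  mor_app (compm f g) x = mor_app f (mor_app g x).
Proof. by []. Qed.

Lemma mor_app1 (R : graded_ring) (X : Gr R) (x : X) : mor_app (idm X) x = x.
Proof. by []. Qed.

Section MorApp.
Variables (R : graded_ring) (X Y : Gr R) (f : mor X Y).

Lemma mor_app_act x (a : R) : mor_app f (ract x a) = ract (mor_app f x) a.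
Proof. exact: gh_act. Qed.

Lemma mor_appB x y : mor_app f (x - y) = mor_app f x - mor_app f y.
Proof. exact: ghB. Qed.

Lemma mor_app_proj n x : proj (gm_decomposition Y) n (mor_app f x)
  = mor_app f (proj (gm_decomposition X) n x).
Proof. by apply: graded_map_proj0; [apply: ghB | apply: gh_degree]. Qed.

End MorApp.

(* Homogeneous elements of [phi Y] come from maps into [Y] out of the images
   under [psi] of the projectives [Pm]. *)
Lemma element_lift (Y : Gr GE) (n : int) (w : vert F) (m : phi Y) :
  gm_comp (phi Y) n m -> ract m (vtx K w : GF) = m ->
  exists (k : mor (psi (Pm K w n)) Y) (z : phi (psi (Pm K w n))),
    mor_app (fmap phi k) z = m /\
    (forall (Z : Gr GE) (h : mor Y Z), mor_app (fmap phi h) m = 0 ->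
       compm h k = gh_zero (psi (Pm K w n)) Z).
Proof.
move=> nm mw; have [e [t [_ _ et]]] := phi_psi.
pose f : @mor (Gr GF) (Pm K w n) (phi Y) := phom w nm.
have [k kE] := phi_full (compm f (e (Pm K w n))).
exists k, (mor_app (t (Pm K w n)) (pgen K w n)); split.
  rewrite kE mor_appM -[mor_app (e _) _]mor_appM et mor_app1.
  by rewrite -[LHS]/(ract m (pval (pgen K w n) : GF)) pgenE mw.
move=> Z h hm; apply: phi_faithful; rewrite fmapM kE ff_zero //.
apply: graded_hom_ext => x.
rewrite -[LHS]/(mor_app (fmap phi h) (ract m (pval (mor_app (e _) x) : GF))).
by rewrite mor_app_act hm ract0l.
Qed.

(** A component in one degree and at one vertex is represented by a map [k] into [Y]. If
    [fmap phi h] kills the component, then [h] after [k] is zero, so [k] is zero by injectivity of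
    [h]. *)
Lemma phi_injective (Y Z : Gr GE) (h : mor Y Z) : injective (mor_app h) ->
  injective (mor_app (fmap phi h)).
Proof.
move=> hI; have kill (x : phi Y) : mor_app (fmap phi h) x = 0 -> x = 0.
  have [s us /(_ s us) [//|xE _]] := proj_sumE (gm_decomposition (phi Y)) x.
  move=> hx; rewrite xE big1 // => n _.
  rewrite -[proj _ _ _]ract1 -sum_vtx ract_sum big1 // => w _.
  set m := ract _ _.
  have nm : gm_comp (phi Y) n m.
    rewrite -[n]addr0; apply: gm_compM; last exact: lg_vert.
    exact: proj_comp.
  have mw : ract m (vtx K w : GF) = m by rewrite -ractM vtx_idem.
  have [k [z [kz kP]]] := element_lift nm mw.
  have hk : compm h k = gh_zero _ _.
    apply: kP; transitivity (ract (mor_app (fmap phi h)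
      (proj (gm_decomposition (phi Y)) n x)) (vtx K w : GF)).
      exact: mor_app_act.
    by rewrite -mor_app_proj hx proj0 ract0l.
  have k0 : k = gh_zero _ _.
    apply: graded_hom_ext => y; apply: hI; rewrite -mor_appM hk.
    by rewrite [RHS]gh0.
  by rewrite -kz k0 ff_zero.
move=> x y xy; apply/eqP; rewrite -subr_eq0; apply/eqP/kill.
by rewrite mor_appB xy subrr.
Qed.

Section Trace.
Variable X : Gr GE.

Record trace_elt := TraceElt {
  tw : vert F;
  td : int;
  ta : mor (psi (Pm K tw td)) X;
  ty : psi (Pm K tw td)
}.

Definition trace_val (t : trace_elt) : X := mor_app (ta t) (ty t).

(** The trace in [X] of the family of modules [psi (Pm K w d)]: the sum of the images of all maps
    from its members. *)
Program Definition trace : submodule X :=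
  @Submodule _ X (fun x => exists (I : finType) (t : I -> trace_elt),
    x = \sum_i trace_val (t i)) _ _.
Next Obligation.
exists 'I_0, (fun i : 'I_0 => match notF (valP i) with end).
by rewrite big_ord0.
Qed.
Next Obligation.
move=> a x y [I [t ->]] [J [u ->]].
exists (I + J)%type, (fun ij => match ij with
  | inl i => TraceElt (ta (t i)) (a *: ty (t i)) | inr j => u j end).
rewrite big_sumType /= scaler_sumr; congr (_ + _); apply: eq_bigr => i _.
exact/esym/mor_app_act.
Qed.

Lemma trace_proj n x : trace x -> trace (proj (gm_decomposition X) n x).
Proof.
move=> [I [t ->]]; exists I, (fun i => TraceElt (ta (t i))
  (proj (gm_decomposition (psi (Pm K (tw (t i)) (td (t i))))) n (ty (t i)))).
rewrite proj_sum; apply: eq_bigr => i _; exact: mor_app_proj.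
Qed.

(** Under [phi] the inclusion of the trace stays injective, and it becomes surjective because
    homogeneous elements of [phi X] lift to maps that land in the trace. By fullness the inverse
    comes from a map into the trace, which by faithfulness is a section of the inclusion. *)
Lemma trace_full x : trace x.
Proof.
pose T : Gr GE := sub_module trace_proj.
pose i : mor T X := sub_incl trace_proj.
have iI : injective (mor_app i) by move=> y z /val_inj.
have fI := phi_injective iI.
have fS (y : phi X) : exists z, mor_app (fmap phi i) z = y.
  apply: (homogeneous_ind (N := phi X) (P := fun y =>
    exists z, mor_app (fmap phi i) z = y)).
  - by exists 0; apply: gh0.
  - move=> y1 y2 [z1 <-] [z2 <-]; exists (z1 + z2); exact: ghD.
  - move=> n w m nm mw; have [k [z [<- _]]] := element_lift nm mw.
    have kT u : trace (mor_app k u).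
      by exists 'I_1, (fun=> TraceElt k u); rewrite big_ord1.
    pose h : mor (psi (Pm K w n)) T := sub_corestr trace_proj kT.
    exists (mor_app (fmap phi h) z); rewrite -mor_appM -fmapM.
    by congr (mor_app (fmap phi _) z); apply: graded_hom_ext.
pose g y := sval (cid (fS y)).
have gK : cancel g (mor_app (fmap phi i)).
  by move=> y; rewrite /g; case: cid.
have fK : cancel (mor_app (fmap phi i)) g by move=> z; apply: fI; rewrite gK.
pose s : mor (phi X) (phi T) := gh_inv fK gK.
have [s' s'E] := phi_full s.
have is1 : compm i s' = idm X.
  apply: phi_faithful; rewrite fmapM s'E fmap1.
  by apply: graded_hom_ext => y; apply: gK.
rewrite -[x]mor_app1 -is1 mor_appM; exact: submP.
Qed.

End Trace.

Lemma phi_shift j (X : Gr GE) : phi (shift_module j X) = shift_module j (phi X).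
Proof. exact: (congr1 (fun G : functor _ _ => G X) (zphi j)). Qed.

Lemma phi_split (X Y : Gr GE) (I : finType) (Q : I -> Gr GE)
    (f : forall i, mor (Q i) Y) (g : forall i, mor X (Q i)) (h : mor X Y) :
  (forall x, \sum_i mor_app (f i) (mor_app (g i) x) = mor_app h x) ->
  forall x, \sum_i mor_app (fmap phi (f i)) (mor_app (fmap phi (g i)) x)
    = mor_app (fmap phi h) x.
Proof.
move=> fgh x.
have -> : h = \big[@gh_add GE X Y/gh_zero X Y]_i (compm (f i) (g i)).
  apply: graded_hom_ext => y; rewrite -[LHS]/(mor_app h y) -fgh.
  by rewrite gh_bigE.
rewrite ff_sum // /mor_app gh_bigE; apply: eq_bigr => i _.
by rewrite fmapM.
Qed.

Lemma phi_projective_type v :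
  exists (k : nat) (r : vert F -> nat), has_type (phi (P0 K v)) k%:Z r.
Proof.
pose X : Gr GE := Pm K v 0; pose x0 : X := pgen K v 0.
have [I [t xE]] := trace_full x0.
pose Q i : Gr GE := psi (Pm K (tw (t i)) (td (t i))).
(* Degree-zero components at [v] still add up to the generator, and each is the image of [v] under a
   degree-preserving map from [X]. *)
pose n i : Q i := ract (proj (gm_decomposition (Q i)) 0 (ty (t i))) (vtx K v :
  GE).
have n0 i : gm_comp (Q i) 0 (n i).
  rewrite -[X in gm_comp _ X _]addr0.
  by apply: gm_compM; [apply: proj_comp | apply: lg_vert].
pose f i : mor (Q i) X := ta (t i).
pose g i : mor X (Q i) := phom v (n0 i).
have fg x : \sum_i mor_app (f i) (mor_app (g i) x) = mor_app (idm X) x.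
  transitivity (ract (ract (proj (gm_decomposition X) 0 x0) (vtx K v : GE))
                     (pval (x : Pm K v 0) : GE)).
    rewrite xE proj_sum !ract_suml; apply: eq_bigr => i _.
    rewrite /trace_val mor_app_proj -!mor_app_act.
    by [].
  rewrite proj_id; last exact: pgen_comp.
  by apply: pval_inj; rewrite !pval_act pgenE vtx_idem pvalK.
(* A frame needs one common degree; absolute values put [k] at or above every [td (t i)], so each
   type can be advanced to it. *)
pose k := (\max_i `|td (t i)|)%N.
have QP i : exists b : frame (phi (Q i)) k%:Z, True.
  have := has_type_iter sinklessF (absz (k%:Z - td (t i)))
    (has_type_Pm K (tw (t i)) (td (t i))).
  have -> : td (t i) + (absz (k%:Z - td (t i)))%:Z = k%:Z.
    have : (`|td (t i)| <= k)%N by apply: (leq_bigmax i).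
    lia.
  have [e [u [_ eu ue]]] := phi_psi.
  pose ei : graded_hom (phi (Q i)) (Pm K (tw (t i)) (td (t i))) := e _.
  pose ui : graded_hom (Pm K (tw (t i)) (td (t i))) (phi (Q i)) := u _.
  have uK : cancel ui ei by move=> x; exact: (congr1 (fun h =>
    mor_app h x) (ue _)).
  have eK : cancel ei ui by move=> x; exact: (congr1 (fun h =>
    mor_app h x) (eu _)).
  by move=> /(has_type_iso uK eK) [b _ _]; exists b.
have phi_fg x : \sum_i mor_app (fmap phi (f i)) (mor_app (fmap phi (g i)) x) =
  x.
  by rewrite (phi_split fg) fmap1.
pose b := frame_comp phi_fg (fun i => sval (cid (QP i))).
have [l [b' b'o]] := frame_basis sinklessF b.
exists (k + l)%N, (count b').
have : has_type (phi X) (k%:Z + l%:Z) (count b') by exists b'.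
move: (count b') => r; rewrite /X /Pm phi_shift =>
  /(iffRL (has_type_shift _ _ _ _)).
by rewrite subr0 PoszD.
Qed.

(** A basis splits [X] into modules [Pm K v d]. The functor preserves the splitting and the shift,
    so a basis element at [v] contributes the row [R v]. *)
Lemma phi_transport (k : int) (R : vert E -> vert F -> nat) :
  (forall v, has_type (phi (P0 K v)) k (R v)) ->
  forall (X : Gr GE) d r, has_type (X : graded_module GE) d r ->
  has_type (phi X) (k + d) (fun w => \sum_v r v * R v w)%N.
Proof.
move=> RP X d r [b [b1 b0] <-].
have -> : (fun w => \sum_v count b v * R v w)%N
    = (fun w => \sum_i R (fv b i) w)%N.
  apply/funext => w; rewrite [RHS](partition_big (fv b) xpredT) //=.
  apply: eq_bigr => v _; rewrite (eq_bigr (fun=> R v w)) => [|i /eqP -> //].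
  by rewrite big_const iter_addn_0 mulnC /count cardsE.
pose Q i : Gr GE := Pm K (fv b i) d.
pose f i : mor (Q i) X := ff b i; pose g i : mor X (Q i) := fg b i.
have fgE x : \sum_i mor_app (f i) (mor_app (g i) x) = mor_app (idm X) x.
  exact: (fsum b).
apply: (@has_type_comp K F (phi X) (k + d) (fI b) (fun i => phi (Q i))
  (fun i => fmap phi (f i)) (fun i => fmap phi (g i)) (fun i => R (fv b i))).
- by move=> x; have := phi_split fgE x; rewrite fmap1.
- move=> i x; rewrite -[LHS]/(mor_app (compm (fmap phi (g i)) (fmap phi (f i)))
    x).
  rewrite -fmapM; have -> : compm (g i) (f i) = idm (Q i).
    by apply: graded_hom_ext => y; apply: b1.
  by rewrite fmap1.
- move=> i j x ij.
  rewrite -[LHS]/(mor_app (compm (fmap phi (g i)) (fmap phi (f j))) x).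
  rewrite -fmapM; have -> : compm (g i) (f j) = gh_zero (Q j) (Q i).
    by apply: graded_hom_ext => y; apply: b0.
  by rewrite ff_zero.
- move=> i; rewrite /Q /Pm phi_shift; apply: (iffLR (has_type_shift _ _ _ _)).
  by rewrite addrK; apply: RP.
Qed.

Lemma phi_types : exists2 k : nat, (0 < k)%N &
  exists R : vert E -> vert F -> nat, forall v, has_type (phi (P0 K v)) k%:Z (R
    v).
Proof.
have /boolp.choice [k kP] := phi_projective_type.
(* The successor keeps the degree positive, which later makes the lag of the shift equivalence at
   least one. *)
exists (\max_v k v).+1 => //.
suff /boolp.choice [R RP] v : exists r, has_type (phi (P0 K v)) (\max_v k
  v).+1%:Z r.
  by exists R.
have [r /(has_type_iter sinklessF ((\max_v k v).+1 - k v))] := kP v.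
have -> : (k v)%:Z + ((\max_v k v).+1 - k v)%N%:Z = (\max_v k v).+1%:Z.
  by have := @leq_bigmax _ k v; lia.
by move=> ?; eexists; eassumption.
Qed.

End Transport.

(** * Types as row vectors *)

Section RowTypes.
Variables (K : fieldType) (E : digraph).
Hypothesis sinkless : no_sinks E.
Notation GL := (leavitt K E).
Notation A := (adjmx E).

Definition row_type (N : graded_module GL) (k : int) (r : 'rV[nat]_#|vert E|) :=
  has_type N k (fun w => r 0 (enum_rank w)).

Lemma adjmxE i w : A i (enum_rank w) = nedges (enum_val i) w.
Proof. by rewrite mxE enum_rankK. Qed.

Lemma advance_row (r : 'rV[nat]_#|vert E|) l :
  iter l (@advance E) (fun w => r 0 (enum_rank w))
  = fun w => (r *m A ^+ l) 0 (enum_rank w).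
Proof.
elim: l => [|l IHl]; first by rewrite expr0 mulmx1.
rewrite iterS IHl exprSr -mulmxE mulmxA; apply/funext => w.
rewrite /advance mxE (reindex (@enum_rank (vert E))) /=; last first.
  exact/onW_bij/enum_rank_bij.
by apply: eq_bigr => v _; rewrite adjmxE enum_rankK.
Qed.

Lemma row_type_iter N k r l : row_type N k r -> row_type N (k + l%:Z) (r *m A
  ^+ l).
Proof. by rewrite /row_type -advance_row; apply: has_type_iter. Qed.

Lemma row_type_uniq N k r r' : row_type N k r -> row_type N k r' ->
  exists l, r *m A ^+ l = r' *m A ^+ l.
Proof.
move=> Nr Nr'; have [l] := has_type_uniq sinkless Nr Nr'.
rewrite !advance_row => rr; exists l; apply/rowP => j.
by have := congr1 (fun f => f (enum_val j)) rr; rewrite /= enum_valK.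
Qed.

Lemma rows_eventually m (X Y : 'M[nat]_(m, #|vert E|)) :
  (forall i, exists l, row i X *m A ^+ l = row i Y *m A ^+ l) ->
  exists l, X *m A ^+ l = Y *m A ^+ l.
Proof.
move=> /boolp.choice [l lP]; exists (\max_i l i)%N; apply/row_matrixP => i.
rewrite !row_mul -(subnKC (leq_bigmax i)) exprD -!mulmxE !mulmxA.
by rewrite lP.
Qed.

Lemma row_type_P0 i l : row_type (P0 K (enum_val i)) l%:Z (row i (A ^+ l)).
Proof.
have -> : row i (A ^+ l) = row i 1%:M *m A ^+ l by rewrite -row_mul mul1mx.
rewrite /row_type -advance_row.
have -> : (fun w => row i 1%:M 0 (enum_rank w)) = fun w =>
  (enum_val i == w : nat).
  apply/funext => w; rewrite !mxE -[i in LHS]enum_valK.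
  by rewrite (inj_eq enum_rank_inj); case: (_ == _).
exact: has_type_P0.
Qed.

End RowTypes.

Definition represents (K : fieldType) (E F : digraph)
    (phi : functor (Gr (leavitt K E)) (Gr (leavitt K F))) (k : nat)
    (R : 'M[nat]_(#|vert E|, #|vert F|)) : Prop :=
  forall i, row_type (phi (P0 K (enum_val i))) k%:Z (row i R).

Section Represents.
Variables (K : fieldType) (E F : digraph).
Hypotheses (sinklessE : no_sinks E) (sinklessF : no_sinks F).
Notation GE := (leavitt K E).
Notation GF := (leavitt K F).
Variables (phi : functor (Gr GE) (Gr GF)) (psi : functor (Gr GF) (Gr GE)).
Hypothesis zphi : graded_functor phi.
Hypothesis psi_phi :
  naturally_isomorphic (comp_functor psi phi) (id_functor (Gr GE)).
Hypothesis phi_psi :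
  naturally_isomorphic (comp_functor phi psi) (id_functor (Gr GF)).
Notation A := (adjmx E).
Notation B := (adjmx F).

Lemma represents_iter k R l : represents phi k R ->
  represents phi (k + l) (R *m B ^+ l).
Proof. by move=> RP i; rewrite row_mul PoszD; apply: row_type_iter. Qed.

Lemma represents_apply k R : represents phi k R ->
  forall (X : Gr GE) d r, row_type (X : graded_module GE) d r ->
  row_type (phi X) (k%:Z + d) (r *m R).
Proof.
move=> RP X d r Xr.
have RP' v : has_type (phi (P0 K v)) k%:Z (fun w =>
  R (enum_rank v) (enum_rank w)).
  have := RP (enum_rank v); rewrite enum_rankK /row_type.
  by under eq_fun do rewrite mxE.
have := phi_transport zphi psi_phi phi_psi RP' Xr; rewrite /row_type.
congr has_type; apply/funext => w.
rewrite mxE (reindex (@enum_rank (vert E))) //=.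
exact/onW_bij/enum_rank_bij.
Qed.

(** The image of P_v has a type in degree k + 1 for two reasons: P_v can be advanced before [phi] is
    applied, or its image afterwards. This compares the rows of A R and R B, which agree up to a
    power of B; that power is absorbed into R by raising the degree. *)
Lemma represents_intertwine : exists2 k, (0 < k)%N &
  exists2 R, represents phi k R & A *m R = R *m B.
Proof.
have [k k0 [R0 R0P]] := phi_types sinklessF zphi psi_phi phi_psi.
pose R : 'M[nat]_(#|vert E|, #|vert F|) :=
  \matrix_(i, j) R0 (enum_val i) (enum_val j).
have RP : represents phi k R.
  move=> i; rewrite /row_type.
  have -> : (fun w => row i R 0 (enum_rank w)) = R0 (enum_val i).
    by apply/funext => w; rewrite !mxE enum_rankK.
  exact: R0P.
have [l lP] : exists l, (A *m R) *m B ^+ l = (R *m B) *m B ^+ l.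
  apply: rows_eventually => i; rewrite !row_mul.
  apply: (row_type_uniq sinklessF (N := phi (P0 K (enum_val i))) (k := k%:Z +
    1)).
    apply: represents_apply => //.
    by have := row_type_P0 K sinklessE i 1; rewrite expr1.
  by have := row_type_iter sinklessF 1 (RP i); rewrite expr1.
exists (k + l)%N; first by rewrite addn_gt0 k0.
exists (R *m B ^+ l); first exact: represents_iter.
by rewrite mulmxA lP -!mulmxA !mulmxE -exprS -exprSr.
Qed.

End Represents.

(** In degree k + k' the module psi (phi P_v) has a row of R S as type, and being isomorphic to P_v
    it also has the corresponding row of A^(k + k'). *)
Lemma represents_inverse (K : fieldType) (E F : digraph)
    (phi : functor (Gr (leavitt K E)) (Gr (leavitt K F)))
    (psi : functor (Gr (leavitt K F)) (Gr (leavitt K E))) k k' R S :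
  no_sinks E -> graded_functor psi ->
  naturally_isomorphic (comp_functor psi phi) (id_functor (Gr (leavitt K E))) ->
  naturally_isomorphic (comp_functor phi psi) (id_functor (Gr (leavitt K F))) ->
  represents phi k R -> represents psi k' S ->
  exists l, R *m S *m adjmx E ^+ l = adjmx E ^+ (k + k' + l).
Proof.
move=> sE zpsi psi_phi phi_psi RP SP.
suff [l lP] : exists l,
    R *m S *m adjmx E ^+ l = adjmx E ^+ (k + k') *m adjmx E ^+ l.
  by exists l; rewrite lP [RHS]exprD.
apply: rows_eventually => i; rewrite row_mul.
apply: (row_type_uniq sE (N := P0 K (enum_val i)) (k := (k + k')%N)).
  have [e [u [_ eu ue]]] := psi_phi.
  have := represents_apply zpsi phi_psi psi_phi SP (RP i).
  rewrite -PoszD [(k' + k)%N]addnC.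
  apply: (has_type_iso (f := e (P0 K (enum_val i))) (g := u (P0 K (enum_val
    i)))).
    by move=> x; exact: (congr1 (fun h => mor_app h x) (eu _)).
  by move=> x; exact: (congr1 (fun h => mor_app h x) (ue _)).
exact: row_type_P0.
Qed.

Lemma shift_equiv_of_morita (K : fieldType) (E F : digraph) :
  no_sinks E -> no_sinks F ->
  graded_morita_equiv (leavitt K E) (leavitt K F) ->
  shift_equiv (adjmx E) (adjmx F).
Proof.
move=> sE sF [phi [zphi [psi [zpsi psi_phi phi_psi]]]].
set A := adjmx E; set B := adjmx F.
have [k k0 [R RP AR]] := represents_intertwine sE sF zphi psi_phi phi_psi.
have [k' k0' [S SP BS]] := represents_intertwine sF sE zpsi phi_psi psi_phi.
have [l lP] := represents_inverse sE zpsi psi_phi phi_psi RP SP.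
have [l' lP'] := represents_inverse sF zphi phi_psi psi_phi SP RP.
pose m := maxn l l'.
have BSn n : B ^+ n *m S = S *m A ^+ n.
  elim: n => [|n IHn]; first by rewrite !expr0 mul1mx mulmx1.
  by rewrite exprSr -mulmxE -mulmxA BS mulmxA IHn -mulmxA mulmxE -exprSr.
have ARn n : A ^+ n *m R = R *m B ^+ n.
  elim: n => [|n IHn]; first by rewrite !expr0 mul1mx mulmx1.
  by rewrite exprSr -mulmxE -mulmxA AR mulmxA IHn -mulmxA mulmxE -exprSr.
(* The factor A^m turns both eventual identities into exact ones, m being large enough for each;
   [ARn] carries it across R as B^m for the second. *)
exists R, (S *m A ^+ m), (k + k' + m)%N; split.
- by rewrite addn_gt0 addn_gt0 k0.
- have mE : (l + (m - l))%N = m by rewrite subnKC // leq_maxl.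
  transitivity (R *m S *m A ^+ l *m A ^+ (m - l)).
    by rewrite lP mulmxE -exprD -[in RHS]addnA mE.
  by rewrite -[LHS]mulmxA mulmxE -exprD mE mulmxA.
- have mE : (l' + (m - l'))%N = m by rewrite subnKC // leq_maxr.
  transitivity (S *m R *m B ^+ l' *m B ^+ (m - l')).
    by rewrite lP' mulmxE -exprD -[in RHS]addnA mE [(k' + k)%N]addnC.
  have BB : B ^+ l' *m B ^+ (m - l') = B ^+ m by rewrite mulmxE -exprD mE.
  by rewrite -[LHS]mulmxA BB -!mulmxA ARn.
- exact: AR.
- rewrite mulmxA BS -[RHS]mulmxA -[LHS]mulmxA; congr (_ *m _).
  by rewrite !mulmxE -exprS -exprSr.
Qed.

Theorem proposition14 (K : fieldType) :
  (forall E F : digraph, essential E ->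
     in_splitting E F \/ out_splitting E F ->
     graded_morita_equiv (leavitt K E) (leavitt K F))
  /\
  (forall E F : digraph, essential E -> essential F ->
     strong_shift_equiv (adjmx E) (adjmx F) ->
     graded_morita_equiv (leavitt K E) (leavitt K F))
  /\
  (forall E F : digraph, no_sinks E -> no_sinks F ->
     graded_morita_equiv (leavitt K E) (leavitt K F) ->
     shift_equiv (adjmx E) (adjmx F)).
Proof.
split; last split.
- exact: morita_of_splitting.
- exact: morita_of_sse.
- exact: shift_equiv_of_morita.
Qed.
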